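(* Let $N\ge2$, let $C=\{z_0,\dots,z_{p-1}\}$ be a cycle of length $p$, and for $k\in\mathbb{Z}$ let $\theta_k\in\mathbb{R}$ satisfy $e^{-2\pi i\theta_k}=z_{k\bmod p}$. Let $m_0\in L^\infty(\mathbb{T})$ be such that there exists some (not necessarily orthogonal) vector $\varphi\in L^2(\mathbb{R})^p$, cyclic for the representation $\mathfrak{R}_C$, with $U\varphi=\pi(m_0)\varphi$. Then for almost every $x\in(-N^p,-1]\cup[1,N^p)$ there exists $k_x\in\mathbb{Z}$ such that $$\sum_{n=-\infty}^{k_x-1}\ \prod_{k=n-1}^{k_x}\left|m_0\left(\tfrac{x}{N^k}+\theta_{-k}\right)\right|^2<\infty\qquad\text{and}\qquad \sum_{n=k_x+1}^{\infty}\frac{1}{\prod_{k=k_x+1}^{n}\left|m_0\left(\tfrac{x}{N^k}+\theta_{-k}\right)\right|^2}<\infty.$$ Conversely, if $m_0\in L^\infty(\mathbb{T})$ is such that for almost every $x\in(-N^p,-1]\cup[1,N^p)$ there exists $k_x\in\mathbb{Z}$ for which both inequalities hold, then there exists a vector $\varphi$ which is cyclic for the representation $\mathfrak{R}_C$ and satisfies $U\varphi=\pi(m_0)\varphi$.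
   Context: $BS(1,N)=\langle u,t\mid utu^{-1}=t^N\rangle$. A cycle is a periodic orbit of $z\mapsto z^N$ on the unit circle $\mathbb{T}$: $C=\{z_0,\dots,z_{p-1}\}$, distinct points with $z_j^N=z_{(j+1)\bmod p}$. $\mathfrak{R}_C$ is the representation of $BS(1,N)$ on $L^2(\mathbb{R})^p$ (elements written $f(\xi,j)$, $\xi\in\mathbb{R}$, $j\in\{0,\dots,p-1\}$) with $u\mapsto U$, $t\mapsto T$, $$Uf(\xi,j)=\tfrac{1}{\sqrt N}f\left(\tfrac{\xi}{N},(j+1)\bmod p\right),\qquad Tf(\xi,j)=z_j f(\xi-1,j).$$ The spectral measure of $T$ is absolutely continuous with respect to Lebesgue measure on $\mathbb{T}$ and $\pi(f):=f(T)$ for $f\in L^\infty(\mathbb{T})$. Functions on $\mathbb{T}$ are identified with $1$-periodic functions on $\mathbb{R}$ by $m_0(x):=m_0(e^{-2\pi i x})$. A term with a zero denominator is regarded as $+\infty$. *)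

(* Defs.v *)
From HB Require Import structures.
From mathcomp Require Import all_boot all_order all_algebra.
From mathcomp Require Import all_classical all_reals all_analysis.
From mathcomp Require Import complex.

Set Implicit Arguments.
Unset Strict Implicit.
Unset Printing Implicit Defensive.
Import Order.TTheory GRing.Theory Num.Theory.
Import numFieldNormedType.Exports.

Local Open Scope classical_set_scope.
Local Open Scope ring_scope.
Local Open Scope complex_scope.

(* e^{-2 pi i x} *)
Definition ecirc (R : realType) (x : R) : R[i] :=
  cos (2 * pi * x) +i* - sin (2 * pi * x).

Definition cintegral (d : measure_display) (X : measurableType d)
    (R : realType) (mu : {measure set X -> \bar R}) (D : set X)
    (h : X -> R[i]) : R[i] :=
  Rintegral mu D (fun x => complex.Re (h x)) +i*
  Rintegral mu D (fun x => complex.Im (h x)).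

(* A class in L^oo(T) is given by a representative; its values off the unit
   circle are irrelevant. *)
Definition Linfty_circle (R : realType) (m : R[i] -> R[i]) : Prop :=
  (fun x : R => complex.Re (m (ecirc x))) \in Lfun lebesgue_measure +oo%E /\
  (fun x : R => complex.Im (m (ecirc x))) \in Lfun lebesgue_measure +oo%E.

(** * The Hilbert space L^2(R)^p *)

(* Vectors are represented by functions f(xi, j) satisfying [L2]; equality of
   vectors is [aeeq]. *)
Definition vect (R : realType) (p : nat) := R -> 'I_p -> R[i].

Definition L2 (R : realType) (p : nat) (f : vect R p) : Prop :=
  forall j : 'I_p,
    (fun x => complex.Re (f x j)) \in Lfun lebesgue_measure 2%:E /\
    (fun x => complex.Im (f x j)) \in Lfun lebesgue_measure 2%:E.

Definition aeeq (R : realType) (p : nat) (f g : vect R p) : Prop :=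
  forall j : 'I_p, {ae @lebesgue_measure R, forall x, f x j = g x j}.

Definition dot (R : realType) (p : nat) (f g : vect R p) : R[i] :=
  \sum_(j < p) cintegral (@lebesgue_measure R) setT (fun x => f x j * (g x j)^*).

Definition sqnorm (R : realType) (p : nat) (f : vect R p) : \bar R :=
  (\sum_(j < p) \int[@lebesgue_measure R]_x (Normc.normc (f x j) ^+ 2)%:E)%E.

(* An everywhere defined bounded linear operator on L^2(R)^p. Compatibility
   with [aeeq] follows from linearity and boundedness. *)
Definition bounded_op (R : realType) (p : nat) (S : vect R p -> vect R p)
    : Prop :=
  [/\ forall f, L2 f -> L2 (S f),
      forall (a : R[i]) f g, L2 f -> L2 g ->
        aeeq (S (fun x j => a * f x j + g x j))
             (fun x j => a * S f x j + S g x j)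
    & exists c : R, forall f, L2 f -> (sqnorm (S f) <= c%:E * sqnorm f)%E].

(** * Spectral measures on the circle and functional calculus *)

(* A projection-valued measure on the Borel sets of the unit circle, the
   circle being parametrised by x |-> e^{-2 pi i x}, x in [0, 1[.
   [pvm_meas f] is the scalar measure A |-> <E(A) f, f>. *)
Record pvm (R : realType) (p : nat) := Pvm {
  pvm_proj : set R -> vect R p -> vect R p;
  pvm_meas : vect R p -> {measure set (measurableTypeR R) -> \bar R};
  pvm_bounded : forall A : set (measurableTypeR R), measurable A ->
    bounded_op (pvm_proj A);
  pvm_idem : forall (A : set (measurableTypeR R)) f, measurable A -> L2 f ->
    aeeq (pvm_proj A (pvm_proj A f)) (pvm_proj A f);
  pvm_adj : forall (A : set (measurableTypeR R)) f g, measurable A ->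
    L2 f -> L2 g -> dot (pvm_proj A f) g = dot f (pvm_proj A g);
  pvm_id : forall f, L2 f -> aeeq (pvm_proj `[0, 1[ f) f;
  pvm_measE : forall (A : set (measurableTypeR R)) f, measurable A -> L2 f ->
    pvm_meas f A = (complex.Re (dot (pvm_proj A f) f))%:E
}.

(* S = \int h dE, in the weak sense: <S f, f> = \int h d<E f, f> for all f,
   which determines S by polarization. *)
Definition spectral_integral (R : realType) (p : nat) (E : pvm R p)
    (h : R -> R[i]) (S : vect R p -> vect R p) : Prop :=
  bounded_op S /\
  forall f, L2 f -> dot (S f) f = cintegral (pvm_meas E f) `[0, 1[ h.

(* S = m(A), where A = \int z dE(z) is unitary with spectral measure E and
   m(A) = \int m(z) dE(z). *)
Definition functional_calculus (R : realType) (p : nat)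
    (A : vect R p -> vect R p) (m : R[i] -> R[i]) (S : vect R p -> vect R p)
    : Prop :=
  exists E : pvm R p,
    spectral_integral E (@ecirc R) A /\
    spectral_integral E (fun x => m (ecirc x)) S.

(** * The representation of BS(1, N) attached to a cycle *)

Definition is_cycle (R : realType) (N p : nat) (z : 'I_p -> R[i]) : Prop :=
  [/\ (0 < p)%N, injective z, forall j, `|z j| = 1
    & forall j, z j ^+ N = z (ordS j)].

Definition repU (R : realType) (N p : nat) (f : vect R p) : vect R p :=
  fun x j => ((Num.sqrt N%:R)^-1)%:C * f (x / N%:R) (ordS j).

Definition repUV (R : realType) (N p : nat) (f : vect R p) : vect R p :=
  fun x j => (Num.sqrt N%:R)%:C * f (x * N%:R) (ord_pred j).

Definition repT (R : realType) (p : nat) (z : 'I_p -> R[i]) (f : vect R p)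
    : vect R p :=
  fun x j => z j * f (x - 1) j.

Definition repTV (R : realType) (p : nat) (z : 'I_p -> R[i]) (f : vect R p)
    : vect R p :=
  fun x j => (z j)^-1 * f (x + 1) j.

(* The elements of BS(1, N) are represented by words in u, u^-1, t, t^-1. *)
Inductive bs_letter := Lu | LuV | Lt | LtV.

Definition rep_letter (R : realType) (N p : nat) (z : 'I_p -> R[i])
    (l : bs_letter) : vect R p -> vect R p :=
  match l with
  | Lu => @repU R N p
  | LuV => @repUV R N p
  | Lt => repT z
  | LtV => repTV z
  end.

Definition rep (R : realType) (N p : nat) (z : 'I_p -> R[i])
    (w : seq bs_letter) (f : vect R p) : vect R p :=
  foldr (rep_letter N z) f w.

Lemma repUK (R : realType) (N p : nat) : (0 < N)%N ->
  cancel (@repU R N p) (@repUV R N p).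
Proof.
move=> N0 f; apply/funext => x; apply/funext => j.
have N0' : N%:R != 0 :> R by rewrite pnatr_eq0 -lt0n.
rewrite /repUV /repU mulrA -rmorphM /= mulfV ?mul1r; last first.
  by rewrite sqrtr_eq0 -ltNge ltr0n.
by rewrite mulfK// ord_predK.
Qed.

Lemma repUVK (R : realType) (N p : nat) : (0 < N)%N ->
  cancel (@repUV R N p) (@repU R N p).
Proof.
move=> N0 f; apply/funext => x; apply/funext => j.
have N0' : N%:R != 0 :> R by rewrite pnatr_eq0 -lt0n.
rewrite /repUV /repU mulrA -rmorphM /= mulVf ?mul1r; last first.
  by rewrite sqrtr_eq0 -ltNge ltr0n.
by rewrite divfK// ordSK.
Qed.

Lemma repTK (R : realType) (N p : nat) (z : 'I_p -> R[i]) : is_cycle N z ->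
  cancel (repT z) (repTV z).
Proof.
case=> _ _ z1 _ f; apply/funext => x; apply/funext => j.
by rewrite /repTV /repT addrK mulKf// -normr_eq0 z1 oner_eq0.
Qed.

Lemma repTVK (R : realType) (N p : nat) (z : 'I_p -> R[i]) : is_cycle N z ->
  cancel (repTV z) (repT z).
Proof.
case=> _ _ z1 _ f; apply/funext => x; apply/funext => j.
by rewrite /repTV /repT subrK mulVKf// -normr_eq0 z1 oner_eq0.
Qed.

(* The defining relation u t u^-1 = t^N; with the four cancellation lemmas
   above it shows that [rep] factors through BS(1, N). *)
Lemma rep_relation (R : realType) (N p : nat) (z : 'I_p -> R[i])
    (f : vect R p) : (0 < N)%N -> is_cycle N z ->
  rep N z [:: Lu; Lt; LuV] f = rep N z (nseq N Lt) f.
Proof.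
move=> N0 [_ _ _ zS].
have N0' : N%:R != 0 :> R by rewrite pnatr_eq0 -lt0n.
have TE n : rep N z (nseq n Lt) f = fun x j => z j ^+ n * f (x - n%:R) j.
  elim: n => [|n IH]; apply/funext => x; apply/funext => j.
    by rewrite /= expr0 mul1r subr0.
  by rewrite /= -/(rep _ _ _ _) IH /repT mulrA -exprS -addrA -opprD -mulrS.
rewrite TE; apply/funext => x; apply/funext => j.
rewrite /= /repU /repT /repUV zS mulrCA; congr (_ * _).
rewrite mulrA -rmorphM /= mulVf ?mul1r; last first.
  by rewrite sqrtr_eq0 -ltNge ltr0n.
by rewrite mulrBl divfK// mul1r ordSK.
Qed.

(* The linear span of the orbit of phi under BS(1, N) is dense. *)
Definition cyclic_vector (R : realType) (N p : nat) (z : 'I_p -> R[i])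
    (phi : vect R p) : Prop :=
  L2 phi /\
  forall f, L2 f -> forall e : R, 0 < e ->
    exists s : seq (R[i] * seq bs_letter),
      (sqnorm (fun x j => f x j - \sum_(c <- s) c.1 * rep N z c.2 phi x j)%R
         < e%:E)%E.

(* |m(x / N^k + theta_{-k})|^2, a function m on the circle being identified
   with the 1-periodic function x |-> m(e^{-2 pi i x}). *)
Definition sq_mod (R : realType) (N : nat) (theta : int -> R)
    (m : R[i] -> R[i]) (x : R) (k : int) : R :=
  Normc.normc (m (ecirc (x / N%:R ^ k + theta (- k)))) ^+ 2.

(* The inverse in \bar R satisfies 0^-1 = +oo. *)
Definition sums_finite (R : realType) (N : nat) (theta : int -> R)
    (m : R[i] -> R[i]) (x : R) (kx : int) : Prop :=
  (\esum_(n in [set n : int | (n <= kx - 1)%R])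
      (\big[*%R/1%R]_(k \in [set k : int | (n - 1 <= k <= kx)%R])
         sq_mod N theta m x k)%:E < +oo)%E /\
  (\esum_(n in [set n : int | (kx + 1 <= n)%R])
      ((\big[*%R/1%R]_(k \in [set k : int | (kx + 1 <= k <= n)%R])
          sq_mod N theta m x k)%:E)^-1 < +oo)%E.

(* Main.v *)
(* The Fourier transform W turns T into multiplication by w = e^{-2 pi i x} z_j
   and U into the dilation f(x, j) |-> sqrt N f(N x, j + 1). As the spectral
   measures of T are computed in this picture, U phi = pi(m0) phi reads
   sqrt N h(N x, j + 1) = m0(w) h(x, j) for h = W phi, and phi is cyclic iff h
   does not vanish identically on almost every orbit of (x, j) |-> (N x, j + 1).
   Along an orbit h is therefore determined by one nonzero value, and square
   integrability of h amounts, after cutting R into the annuli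
   N^i <= |x| < N^(i+1), to the convergence of the two series. Conversely, the
   convergence for some k_x allows to solve the recursion along each orbit and
   to normalise the solution so that it is square integrable.

   W is the unitary extension of the map sending indicators of intervals to the
   functions (e^{-2 pi i a x} - e^{-2 pi i b x}) / x up to a constant: the two
   families have the same Gram matrix, because the integral of (1 - cos(d x)) /
   x^2 is proportional to |d|, and both are total. Totality and the cyclicity
   criterion rest on the fact that an integrable function on R x Z/p vanishes
   if its integrals against all powers of e^{-2 pi i x / L} z_j do, for a
   sequence of L tending to infinity; here the z_j are distinct. *)

From HB Require Import structures.
Require Import Defs.
From mathcomp Require Import all_boot all_order all_algebra.
From mathcomp Require Import all_classical all_reals all_analysis.
From mathcomp Require Import complex measurable_realfun ess_sup_inf ring lra zify.

Set Implicit Arguments.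
Unset Strict Implicit.
Unset Printing Implicit Defensive.
Import Order.TTheory GRing.Theory Num.Theory.
Import numFieldNormedType.Exports.

Local Open Scope classical_set_scope.
Local Open Scope ring_scope.
Local Open Scope complex_scope.

(** * Inner product spaces *)

(** [functional_calculus] offers only some projection-valued measure E with <T f, f> = int e d<E f,
    f>, so passing from T to m0(T) requires knowing every such E. The key is a localisation: on the
    range of E(B), with B an arc of length d, T differs from a scalar by at most 2 pi d. Cutting an
    arc into n pieces gives orthogonal pieces with relative error of order 1/n, so on the transform
    side the range of E([a, b[) lives where w lies in the arc. Applied to [0, b[ and [b, 1[, whose
    projections add up to the identity, this forces E([0, b[) to be multiplication by an indicator.
    A second point is a change of fundamental domain. The theorem lets x range over an annulus of
    ratio N^p in one copy of R, whereas the series are handled on the annulus of ratio N in all p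
    copies. Off x = 0, both are fundamental domains of (x, j) |-> (N x, j + 1). *)

Section InnerProduct.
Variables (R : realType) (V : lmodType R[i]) (D : V -> V -> R[i]).

(** The form is only positive semidefinite: functions that agree almost everywhere remain distinct
    elements, so equality of vectors is expressed as [nrm (f - g) = 0]. *)
Record inner_product : Prop := {
  ip_linear : forall a f g h, D (a *: f + g) h = a * D f h + D g h;
  ip_conj : forall f g, D g f = (D f g)^*;
  ip_ge0 : forall f, 0 <= complex.Re (D f f)
}.

Definition nrm (f : V) : R := Num.sqrt (complex.Re (D f f)).

Definition complete_for_nrm : Prop := forall u : nat -> V,
  (forall e, 0 < e -> exists n0, forall m n, (n0 <= m)%N -> (n0 <= n)%N ->
     nrm (u m - u n) < e) ->
  exists l, forall e, 0 < e -> exists n0, forall n, (n0 <= n)%N ->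
     nrm (u n - l) < e.

Definition lincomb (I : Type) (a : I -> V) (s : seq (R[i] * I)) : V :=
  \sum_(c <- s) c.1 *: a c.2.

Definition total_family (I : Type) (a : I -> V) : Prop :=
  forall f, (forall i, D f (a i) = 0) -> nrm f = 0.

Hypothesis HD : inner_product.

Lemma ip0l h : D 0 h = 0.
Proof.
have := ip_linear HD 0 0 0 h; rewrite scale0r addr0 mul0r add0r => /eqP.
have := ip_linear HD 1 0 0 h; rewrite scale1r addr0 mul1r => /eqP.
by rewrite -subr_eq0 opprD addrA subrr sub0r oppr_eq0 => /eqP.
Qed.

Lemma ipDl f g h : D (f + g) h = D f h + D g h.
Proof. by rewrite -{1}[f]scale1r (ip_linear HD) mul1r. Qed.

Lemma ipZl a f h : D (a *: f) h = a * D f h.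
Proof. by rewrite -[a *: f]addr0 (ip_linear HD) ip0l addr0. Qed.

Lemma ipNl f h : D (- f) h = - D f h.
Proof. by rewrite -scaleN1r ipZl mulN1r. Qed.

Lemma ipBl f g h : D (f - g) h = D f h - D g h.
Proof. by rewrite ipDl ipNl. Qed.

Lemma ipDr f g h : D h (f + g) = D h f + D h g.
Proof. by rewrite (ip_conj HD) ipDl rmorphD /= -!(ip_conj HD). Qed.

Lemma ipZr a f h : D h (a *: f) = a^* * D h f.
Proof. by rewrite (ip_conj HD) ipZl rmorphM /= -!(ip_conj HD). Qed.

Lemma ipNr f h : D h (- f) = - D h f.
Proof. by rewrite (ip_conj HD) ipNl rmorphN /= -!(ip_conj HD). Qed.

Lemma ipBr f g h : D h (f - g) = D h f - D h g.
Proof. by rewrite ipDr ipNr. Qed.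

Lemma ip_suml (I : Type) (s : seq I) (F : I -> V) h :
  D (\sum_(i <- s) F i) h = \sum_(i <- s) D (F i) h.
Proof.
elim: s => [|i s IH]; first by rewrite !big_nil ip0l.
by rewrite !big_cons ipDl IH.
Qed.

Lemma nrm_ge0 f : 0 <= nrm f. Proof. exact: sqrtr_ge0. Qed.

Lemma sqr_nrm f : nrm f ^+ 2 = complex.Re (D f f).
Proof. by rewrite sqr_sqrtr// (ip_ge0 HD). Qed.

Lemma ip_nrm f : D f f = (nrm f ^+ 2)%:C.
Proof.
rewrite sqr_nrm; have := ip_conj HD f f; case: (D f f) => x y /= [] /eqP.
by rewrite -addr_eq0 -mulr2n mulrn_eq0 /= => /eqP ->.
Qed.

Lemma nrmZ a f : nrm (a *: f) = Normc.normc a * nrm f.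
Proof.
rewrite /nrm ipZl ipZr mulrA ip_nrm; case: a => x y /=.
rewrite !mulr0 !subr0 mulrN opprK -!expr2 sqr_nrm -sqrtrM//.
by rewrite addr_ge0 ?sqr_ge0.
Qed.

Lemma nrmN f : nrm (- f) = nrm f.
Proof. by rewrite -scaleN1r nrmZ /= oppr0 sqrrN expr1n expr0n addr0 sqrtr1 mul1r. Qed.

Lemma nrmBC f g : nrm (f - g) = nrm (g - f).
Proof. by rewrite -nrmN opprB. Qed.

Lemma nrm0 : nrm 0 = 0.
Proof. by rewrite -(scale0r 0) nrmZ Normc.normc0 mul0r. Qed.

Lemma sqr_nrmD f g :
  nrm (f + g) ^+ 2 = nrm f ^+ 2 + 2 * complex.Re (D f g) + nrm g ^+ 2.
Proof.
rewrite !sqr_nrm !ipDl !ipDr (ip_conj HD f g).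
by case: (D f g) => x y; case: (D f f) => ? ?; case: (D g g) => ? ? /=; ring.
Qed.

Lemma sqr_nrmB f g :
  nrm (f - g) ^+ 2 = nrm f ^+ 2 - 2 * complex.Re (D f g) + nrm g ^+ 2.
Proof. by rewrite sqr_nrmD nrmN ipNr raddfN /= mulrN. Qed.

Lemma parallelogram f g :
  nrm (f - g) ^+ 2 = 2 * nrm f ^+ 2 + 2 * nrm g ^+ 2 - nrm (f + g) ^+ 2.
Proof. by rewrite sqr_nrmB sqr_nrmD; ring. Qed.

(** The discriminant argument, with the optimal t = b / c; for c = 0 the value t = (e + 1) / (2 b)
    is contradictory unless b = 0. It yields Cauchy-Schwarz with e = |f|^2, and with e = 1 / (n + 1)
    the almost orthogonality of a near minimiser. *)
Lemma quadratic_bound (b c e : R) : 0 <= c ->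
  (forall t, 2 * t * b <= e + t ^+ 2 * c) -> b ^+ 2 <= e * c.
Proof.
move=> c0 H; have [c_eq0|c_neq0] := eqVneq c 0.
  rewrite c_eq0 mulr0; have [->|b0] := eqVneq b 0; first by rewrite expr0n.
  have := H ((e + 1) / (2 * b)); rewrite c_eq0 mulr0 addr0.
  rewrite (_ : 2 * _ * b = e + 1); first by lra.
  by field.
have c_gt0 : 0 < c by rewrite lt0r c_neq0.
have := H (b / c).
rewrite (_ : 2 * (b / c) * b = 2 * (b ^+ 2 / c)); last by field.
rewrite (_ : (b / c) ^+ 2 * c = b ^+ 2 / c); last by field.
by rewrite -ler_pdivrMr//; lra.
Qed.

Lemma cauchy_schwarz_Re f g : complex.Re (D f g) <= nrm f * nrm g.
Proof.
have H : complex.Re (D f g) ^+ 2 <= nrm f ^+ 2 * nrm g ^+ 2.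
  apply: quadratic_bound; first exact: sqr_ge0.
  move=> t; have := sqr_ge0 (nrm (f - t%:C *: g)).
  rewrite sqr_nrmB ipZr nrmZ exprMn /= expr0n /= addr0 sqrtr_sqr real_normK ?num_real//.
  by case: (D f g) => x y /=; rewrite !oppr0 !mul0r; lra.
rewrite -exprMn in H.
rewrite (le_trans (ler_norm _))//.
by rewrite -(ler_pXn2r (_ : 0 < 2)%N)// ?nnegrE ?mulr_ge0 ?nrm_ge0// real_normK ?num_real.
Qed.

Lemma nrmD f g : nrm (f + g) <= nrm f + nrm g.
Proof.
rewrite -(ler_pXn2r (_ : 0 < 2)%N)// ?nnegrE ?addr_ge0 ?nrm_ge0//.
by rewrite sqr_nrmD; have := cauchy_schwarz_Re f g; nra.
Qed.

Lemma nrm_dist f g h : nrm (f - h) <= nrm (f - g) + nrm (g - h).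
Proof. by rewrite (le_trans _ (nrmD _ _))// addrA subrK. Qed.

Lemma nrm0_ip f h : nrm f = 0 -> D f h = 0.
Proof.
move=> f0; have R0 g : complex.Re (D f g) = 0.
  apply/eqP; rewrite eq_le; apply/andP; split.
    by rewrite (le_trans (cauchy_schwarz_Re _ _))// f0 mul0r.
  have := cauchy_schwarz_Re f (- g).
  by rewrite f0 mul0r ipNr raddfN /= oppr_le0.
have := R0 ('i *: h); have := R0 h; rewrite ipZr.
by case: (D f h) => x y /= -> ; rewrite !mul0r sub0r mulNr mul1r opprK => ->.
Qed.

Lemma ip_nrm0 f : (forall h, D f h = 0) -> nrm f = 0.
Proof. by move=> /(_ f); rewrite /nrm => -> /=; rewrite sqrtr0. Qed.

Lemma nrm_subP f g : nrm (f - g) = 0 <-> (forall h, D f h = D g h).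
Proof.
split=> [fg h|fg].
  by apply/eqP; rewrite -subr_eq0 -ipBl nrm0_ip.
by apply: ip_nrm0 => h; rewrite ipBl fg subrr.
Qed.

Lemma nrm_subr0 f g : nrm (f - g) = 0 -> nrm f = nrm g.
Proof.
move=> fg; apply/eqP; rewrite eq_le; apply/andP; split.
  by have := nrmD (f - g) g; rewrite subrK fg add0r.
by have := nrmD (g - f) f; rewrite subrK nrmBC fg add0r.
Qed.

(** The factor n is affordable in [arc_support], where the squared norms of n + 1 pieces add up to
    O(1 / n^2). The induction uses 2 |s| |v| <= |s|^2 / n + n |v|^2. *)
Lemma sqr_nrm_sum n (F : 'I_n -> V) :
  nrm (\sum_(i < n) F i) ^+ 2 <= n%:R * \sum_(i < n) nrm (F i) ^+ 2.
Proof.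
elim: n F => [|n IH] F; first by rewrite !big_ord0 nrm0 expr0n mul0r.
rewrite !big_ord_recr /= sqr_nrmD; set v := F ord_max; set s := \sum_(i < n) _.
have := IH (fun i => F (widen_ord (leqnSn n) i)); rewrite -/s.
set S := \sum_(i < n) _ => sS.
have S0 : 0 <= S by apply: sumr_ge0 => i _; exact: sqr_ge0.
have CS := cauchy_schwarz_Re s v.
rewrite -natr1; have n0 : 0 <= n%:R :> R by [].
move: (nrm_ge0 s) (nrm_ge0 v) => s0 v0.
suff : 2 * (nrm s * nrm v) <= S + n%:R * nrm v ^+ 2 by nra.
have [n00|nn0] := eqVneq (n%:R : R) 0.
  have /eqP -> : nrm s == 0.
    by rewrite -sqrf_eq0 eq_le sqr_ge0 andbT (le_trans sS)// n00 mul0r.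
  by rewrite mul0r mulr0 n00 mul0r addr0.
have n_gt0 : 0 < n%:R :> R by rewrite lt0r nn0.
have H : nrm s ^+ 2 / n%:R <= S by rewrite ler_pdivrMr// mulrC.
rewrite (le_trans _ (lerD H (lexx _)))//.
have : 0 <= (nrm s - n%:R * nrm v) ^+ 2 / n%:R by rewrite divr_ge0 ?sqr_ge0.
rewrite (_ : (_ - _) ^+ 2 / _ = nrm s ^+ 2 / n%:R - 2 * (nrm s * nrm v) + n%:R * nrm v ^+ 2).
  by lra.
by field.
Qed.

Hypothesis HC : complete_for_nrm.

(* A minimizing sequence of |f - k| is Cauchy; the difference of [f] and its
   limit is orthogonal to K. *)
Lemma dense_of_total (K : V -> Prop) : K 0 ->
  (forall a f g, K f -> K g -> K (a *: f + g)) ->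
  (forall g, (forall k, K k -> D g k = 0) -> nrm g = 0) ->
  forall f e, 0 < e -> exists2 k, K k & nrm (f - k) < e.
Proof.
move=> K0 KL Kt f e e0.
pose A := [set nrm (f - k) ^+ 2 | k in K].
have A0 : lbound A 0 by move=> _ [k _ <-]; exact: sqr_ge0.
have infA : has_inf A by split; [exists (nrm (f - 0) ^+ 2), 0|exists 0].
pose m := inf A.
have m_le k : K k -> m <= nrm (f - k) ^+ 2.
  by move=> Kk; apply: ge_inf; [case: infA|exists k].
have [u uP] : exists u : nat -> V, forall n,
    K (u n) /\ nrm (f - u n) ^+ 2 < m + n.+1%:R^-1.
  suff H n : exists v, K v /\ nrm (f - v) ^+ 2 < m + n.+1%:R^-1.
    by have [u uP] := choice H; exists u.
  have [_ [k Kk <-]] : exists2 x, A x & x < m + n.+1%:R^-1.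
    by apply: inf_adherent.
  by exists k.
(* Parallelogram identity: the midpoint of [u m'] and [u n] lies in K, so its squared distance to
   [f] is at least [m]. *)
have uC m' n : nrm (u m' - u n) ^+ 2 <= 2 * m'.+1%:R^-1 + 2 * n.+1%:R^-1.
  have [Km lm] := uP m'; have [Kn ln] := uP n.
  rewrite (_ : u m' - u n = (f - u n) - (f - u m')); last first.
    by rewrite opprB [RHS]addrC addrA subrK.
  rewrite parallelogram.
  have := m_le _ (KL (2^-1) _ _ (KL 1 _ _ Km Kn) K0).
  rewrite addr0 scale1r.
  have -> : f - u n + (f - u m') = (2%:R)%:C *: (f - 2^-1 *: (u m' + u n)).
    rewrite scalerBr scalerA (_ : (2%:R)%:C * 2^-1 = 1); last first.
      by rewrite rmorph_nat mulfV// pnatr_eq0.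
    rewrite scale1r rmorph_nat scaler_nat mulr2n opprD addrACA.
    by congr (_ + _); rewrite addrC.
  rewrite nrmZ exprMn /= expr0n addr0 sqrtr_sqr ger0_norm//.
  move: lm ln; move: (m'.+1%:R^-1) (n.+1%:R^-1) => c1 c2.
  by rewrite !expr2; nra.
have inv_small (d : R) : 0 < d -> exists n0 : nat, forall n, (n0 <= n)%N -> n.+1%:R^-1 < d.
  move=> d0; have [n0 _ Hn0] := near_infty_natSinv_lt (PosNum d0).
  by exists n0 => n /Hn0.
have [l lP] : exists l, forall e, 0 < e -> exists n0, forall n, (n0 <= n)%N ->
    nrm (u n - l) < e.
  apply: HC => d d0.
  have [|n0 Hn0] := inv_small (d ^+ 2 / 4); first by rewrite divr_gt0 ?exprn_gt0.
  exists n0 => a b /Hn0 Ha /Hn0 Hb.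
  rewrite -(ltr_pXn2r (_ : 0 < 2)%N)// ?nnegrE ?nrm_ge0 ?(ltW d0)//.
  rewrite (le_lt_trans (uC _ _))//.
  by move: Ha Hb; move: (a.+1%:R^-1) (b.+1%:R^-1) => c1 c2; lra.
have gperp k : K k -> D (f - l) k = 0.
  (* Real parts suffice, since K is stable under multiplication by i. *)
  have R0 k' : K k' -> complex.Re (D (f - l) k') = 0.
    move=> Kk; have near0 n :
        complex.Re (D (f - u n) k') ^+ 2 <= n.+1%:R^-1 * nrm k' ^+ 2.
      have [Kn ln] := uP n.
      apply: quadratic_bound; first exact: sqr_ge0.
      move=> t; have := m_le _ (KL t%:C _ _ Kk Kn).
      rewrite opprD addrC -addrA [- _ + f]addrC addrC.
      rewrite sqr_nrmB nrmZ exprMn ipZr /= expr0n addr0 sqrtr_sqr real_normK ?num_real//.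
      case: (D _ _) => x y /=; rewrite !oppr0 !mul0r.
      by move: ln; move: (n.+1%:R^-1) => c; lra.
    apply/eqP; rewrite -sqrf_eq0 eq_le sqr_ge0 andbT.
    apply/ler_addgt0Pr => d d0; rewrite add0r.
    (* Chosen so that the final bound 4 (d / c) |k'|^2 is at most d. *)
    pose c := 4 * (nrm k' ^+ 2 + 1).
    have c0 : 0 < c by rewrite mulr_gt0// ltr_wpDl ?sqr_ge0.
    have [n0 Hn0] := inv_small (d / c) (divr_gt0 d0 c0).
    have [|n1 Hn1] := lP (Num.sqrt (d / c)); first by rewrite sqrtr_gt0 divr_gt0.
    set n := maxn n0 n1.
    have {Hn0}H1 := Hn0 _ (leq_maxl n0 n1); have {Hn1}H2 := Hn1 _ (leq_maxr n0 n1).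
    rewrite -/n in H1 H2.
    have -> : f - l = (u n - l) + (f - u n) by rewrite [RHS]addrC addrA subrK.
    rewrite ipDl raddfD /=.
    set x := complex.Re _; set y := complex.Re _.
    have Hx : x ^+ 2 <= nrm (u n - l) ^+ 2 * nrm k' ^+ 2.
      rewrite -exprMn -[x ^+ 2]real_normK ?num_real//.
      rewrite ler_pXn2r ?nnegrE ?mulr_ge0 ?nrm_ge0//.
      rewrite ler_norml cauchy_schwarz_Re andbT lerNl.
      by have := cauchy_schwarz_Re (- (u n - l)) k'; rewrite nrmN ipNl raddfN.
    have Hy : y ^+ 2 <= n.+1%:R^-1 * nrm k' ^+ 2 by exact: near0.
    have H3 : nrm (u n - l) ^+ 2 < d / c.
      rewrite -[ltRHS]sqr_sqrtr; last by rewrite divr_ge0 ?ltW.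
      by rewrite ltr_pXn2r ?nnegrE ?nrm_ge0 ?sqrtr_ge0.
    have k0 := sqr_ge0 (nrm k').
    have : (x + y) ^+ 2 <= 2 * (d / c * nrm k' ^+ 2) + 2 * (d / c * nrm k' ^+ 2).
      have := sqr_ge0 (x - y).
      have {Hx} := le_trans Hx (ler_wpM2r k0 (ltW H3)).
      have {Hy} := le_trans Hy (ler_wpM2r k0 (ltW H1)).
      by move: (d / c * _) => w; rewrite sqrrB sqrrD; lra.
    move/le_trans; apply.
    rewrite (_ : _ + _ = d * (4 * nrm k' ^+ 2 / c)); last by field; rewrite gt_eqF.
    rewrite ler_piMr//; first exact: ltW.
    by rewrite ler_pdivrMr// mul1r /c; lra.
  move=> Kk; have := R0 k Kk; have := R0 ('i *: k).
  rewrite ipZr; case: (D _ _) => x y /= H ->.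
  have := H _; rewrite !mul0r sub0r mulNr mul1r opprK => ->//.
  by rewrite -[_ *: _]addr0; apply: KL.
have {gperp}g0 := Kt _ gperp.
have [n0 /(_ n0 (leqnn _)) Hn0] := lP e e0.
exists (u n0); first by case: (uP n0).
by rewrite (le_lt_trans (nrm_dist _ l _))// g0 add0r nrmBC.
Qed.

Lemma lincomb_closed (I : Type) (a : I -> V) c s s' :
  exists s'', lincomb a s'' = c *: lincomb a s + lincomb a s'.
Proof.
exists ([seq (c * x.1, x.2) | x <- s] ++ s').
rewrite /lincomb big_cat big_map scaler_sumr; congr (_ + _).
by apply: eq_bigr => x _; rewrite scalerA.
Qed.

Lemma lincomb_dense (I : Type) (a : I -> V) : total_family a ->
  forall f e, 0 < e -> exists s, nrm (f - lincomb a s) < e.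
Proof.
move=> ta f e e0.
have [||g gP|_ [s ->] ?] := @dense_of_total (fun v => exists s, v = lincomb a s) _ _ _ f e e0.
- by exists [::]; rewrite /lincomb big_nil.
- by move=> c _ _ [s ->] [s' ->]; have [s'' <-] := lincomb_closed a c s s'; exists s''.
- apply: ta => i; apply: gP; exists [:: (1, i)].
  by rewrite /lincomb big_seq1 scale1r.
- by exists s.
Qed.

(* The graph of the isometry that sends the family [a] to [b]. *)
Definition gram_rel (I : Type) (a b : I -> V) f g := forall e : R, 0 < e ->
  exists s, nrm (f - lincomb a s) < e /\ nrm (g - lincomb b s) < e.

Section GramRel.
Variables (I : Type) (a b : I -> V).
Hypothesis ab : forall i k, D (a i) (a k) = D (b i) (b k).

Lemma nrm_lincomb s : nrm (lincomb a s) = nrm (lincomb b s).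
Proof.
rewrite /nrm /lincomb !ip_suml; congr (Num.sqrt (complex.Re _)).
apply: eq_bigr => x _; rewrite !ipZl; congr (_ * _).
rewrite (ip_conj HD) [RHS](ip_conj HD); congr (_^*).
rewrite !ip_suml; apply: eq_bigr => y _; rewrite !ipZl; congr (_ * _).
exact: ab.
Qed.

Lemma gram_rel0 : gram_rel a b 0 0.
Proof. by move=> e e0; exists [::]; rewrite /lincomb !big_nil subr0 nrm0. Qed.

Lemma gram_rel_nrm f g : gram_rel a b f g -> nrm f = nrm g.
Proof.
move=> fg; have H e : 0 < e -> `|nrm f - nrm g| <= e.
  move=> e0; have [|s [sf sg]] := fg (e / 2); first by rewrite divr_gt0.
  have := nrmD (f - lincomb a s) (lincomb a s).
  have := nrmD (g - lincomb b s) (lincomb b s).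
  have := nrmD (lincomb a s - f) f.
  have := nrmD (lincomb b s - g) g.
  rewrite !subrK [nrm (lincomb _ _ - f)]nrmBC [nrm (lincomb _ _ - g)]nrmBC.
  by rewrite nrm_lincomb ler_norml; move=> *; apply/andP; split; lra.
apply/eqP; rewrite -subr_eq0 -normr_le0; apply/ler_addgt0Pr => e e0.
by rewrite add0r H.
Qed.

Lemma gram_rel_lin c f g f' g' : gram_rel a b f g -> gram_rel a b f' g' ->
  gram_rel a b (c *: f + f') (c *: g + g').
Proof.
move=> fg fg' e e0.
have c0 : 0 <= Normc.normc c by rewrite /Normc.normc; case: (c) => x y; exact: sqrtr_ge0.
pose d := e / 2 / (Normc.normc c + 1).
have d0 : 0 < d by rewrite !divr_gt0// ltr_wpDl.
have [s [sf sg]] := fg d d0.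
have [|s' [sf' sg']] := fg' (e / 2); first by rewrite divr_gt0.
exists ([seq (c * x.1, x.2) | x <- s] ++ s').
have K (w : I -> V) u u' : nrm (u - lincomb w s) < d -> nrm (u' - lincomb w s') < e / 2 ->
    nrm (c *: u + u' - lincomb w ([seq (c * x.1, x.2) | x <- s] ++ s')) < e.
  move=> su su'.
  rewrite /lincomb big_cat big_map.
  under eq_bigr do rewrite /= -scalerA.
  rewrite -scaler_sumr /= opprD addrACA -scalerBr.
  rewrite (le_lt_trans (nrmD _ _))// [e]splitr ler_ltD//.
  rewrite nrmZ (le_trans (ler_wpM2l c0 (ltW su)))//.
  rewrite /d mulrA ler_pdivrMr ?ltr_wpDl// mulrC ler_wpM2l ?lerDl//.
  by rewrite divr_ge0// ltW.
by split; apply: K.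
Qed.

(** Polarization: norms are preserved and the relation is linear, so f + f' gives the real part and
    f + i f' the imaginary part. *)
Lemma gram_rel_ip f g f' g' :
  gram_rel a b f g -> gram_rel a b f' g' -> D f f' = D g g'.
Proof.
have K u v u' v' : gram_rel a b u v -> gram_rel a b u' v' ->
    complex.Re (D u u') = complex.Re (D v v').
  move=> uv uv'; have := gram_rel_nrm (gram_rel_lin 1 uv uv').
  rewrite !scale1r => /(congr1 (fun x => x ^+ 2)); rewrite !sqr_nrmD.
  by rewrite (gram_rel_nrm uv) (gram_rel_nrm uv'); lra.
move=> fg fg'; have := K _ _ _ _ fg fg'.
have := K _ _ _ _ fg (gram_rel_lin 'i fg' gram_rel0).
rewrite !addr0 !ipZr; case: (D f f') => x y; case: (D g g') => x' y' /=.
by rewrite !mul0r !sub0r !mulNr !mul1r !opprK => -> ->.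
Qed.

Lemma gram_rel_exists : total_family a -> forall f, exists g, gram_rel a b f g.
Proof.
move=> ta f.
have inv_small (d : R) : 0 < d -> exists n0 : nat, forall n, (n0 <= n)%N -> n.+1%:R^-1 < d.
  move=> d0; have [n0 _ Hn0] := near_infty_natSinv_lt (PosNum d0).
  by exists n0 => n /Hn0.
have H n : exists s, nrm (f - lincomb a s) < n.+1%:R^-1.
  by apply: lincomb_dense.
have [s sP] := choice H.
have eqn x y : nrm (lincomb b x - lincomb b y) = nrm (lincomb a x - lincomb a y).
  have [x' x'E] : exists z, forall w : I -> V, lincomb w z = lincomb w x - lincomb w y.
    exists (x ++ [seq (- i.1, i.2) | i <- y]) => w.
    rewrite /lincomb big_cat big_map -sumrN; congr (_ + _).
    by apply: eq_bigr => i _; rewrite scaleNr.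
  by rewrite -!x'E -nrm_lincomb.
have [g gP] : exists l, forall e, 0 < e -> exists n0, forall n, (n0 <= n)%N ->
    nrm (lincomb b (s n) - l) < e.
  apply: HC => e e0; have [|n0 Hn0] := inv_small (e / 2); first by rewrite divr_gt0.
  exists n0 => m n /Hn0 Hm /Hn0 Hn; rewrite eqn.
  rewrite (le_lt_trans (nrm_dist _ f _))// [e]splitr ltrD//.
    by rewrite nrmBC (lt_trans (sP _)).
  by rewrite (lt_trans (sP _)).
exists g => e e0; have [n0 Hn0] := inv_small _ e0; have [n1 Hn1] := gP _ e0.
exists (s (maxn n0 n1)); split.
  by rewrite (lt_trans (sP _))// Hn0 ?leq_maxl.
by rewrite nrmBC Hn1 ?leq_maxr.
Qed.

End GramRel.

(** [W] and [W'] are choices of related vectors, in the two directions of the same relation. [W] is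
    linear only up to null vectors, which [isometry_linear] recovers from the preservation of the
    form. *)
Lemma unitary_of_families (I : Type) (a b : I -> V) :
  total_family a -> total_family b ->
  (forall i k, D (a i) (a k) = D (b i) (b k)) ->
  exists W W' : V -> V,
    [/\ forall f g, D (W f) (W g) = D f g,
        forall g, nrm (W (W' g) - g) = 0 & forall i, nrm (W (a i) - b i) = 0].
Proof.
move=> ta tb ab.
have [W WP] := choice (gram_rel_exists ab ta).
have [W' W'P] := choice (gram_rel_exists (fun i k => esym (ab i k)) tb).
exists W, W'.
have key f g : gram_rel a b f g -> nrm (W f - g) = 0.
  move=> fg; have := gram_rel_nrm ab (gram_rel_lin (-1) fg (WP f)).
  by rewrite !scaleN1r addNr nrm0 => ->; rewrite addrC.
split.
- by move=> f g; apply/esym; apply: (gram_rel_ip ab).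
- by move=> g; apply: key => e e0; have [s [s1 s2]] := W'P g e e0; exists s.
- move=> i; apply: key => e e0; exists [:: (1, i)].
  by rewrite /lincomb !big_seq1 !scale1r !subrr nrm0.
Qed.

(** Testing against b_i and moving T to its adjoint reduces the relation for all f to the adjoints
    on the family: <W T f, b_i> = <f, Ts a_i> = <W f, Ts' b_i> = <T' W f, b_i>. *)
Lemma intertwine (I : Type) (b : I -> V) (a : I -> V) (W T Ts T' Ts' : V -> V) :
  total_family b ->
  (forall f g, D (W f) (W g) = D f g) -> (forall i, nrm (W (a i) - b i) = 0) ->
  (forall f g, D (T f) g = D f (Ts g)) -> (forall f g, D (T' f) g = D f (Ts' g)) ->
  (forall i, nrm (W (Ts (a i)) - Ts' (b i)) = 0) ->
  forall f, nrm (W (T f) - T' (W f)) = 0.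
Proof.
move=> tb WW Wa TT TT' H f; apply: tb => i; rewrite ipBl TT'.
have /nrm_subP E1 := Wa i; have /nrm_subP E2 := H i.
rewrite (ip_conj HD) -E1 -(ip_conj HD) WW TT.
by rewrite [D (W f) _](ip_conj HD) -E2 -(ip_conj HD) WW subrr.
Qed.

(** The quadratic forms at c g + f with c = 1 and c = i determine the sesquilinear form. Linearity
    is assumed under D because operators here are linear only up to null vectors. *)
Lemma polarization (A B : V -> V) :
  (forall c f g h, D (A (c *: f + g)) h = c * D (A f) h + D (A g) h) ->
  (forall c f g h, D (B (c *: f + g)) h = c * D (B f) h + D (B g) h) ->
  (forall f, D (A f) f = D (B f) f) ->
  forall f, nrm (A f - B f) = 0.
Proof.
move=> Al Bl AB f; apply/nrm_subP => g.
have A0 h : D (A 0) h = 0.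
  by have := Al (-1) 0 0 h; rewrite scaler0 addr0 mulN1r addNr.
have B0 h : D (B 0) h = 0.
  by have := Bl (-1) 0 0 h; rewrite scaler0 addr0 mulN1r addNr.
have H (c : R[i]) : D (A f) g * c^* + c * D (A g) f = D (B f) g * c^* + c * D (B g) f.
  have := AB (c *: g + f); rewrite Al Bl !ipDr !ipZr !AB.
  have Ac u v : D (A u) (c *: v) = c^* * D (A u) v by rewrite ipZr.
  move/eqP; rewrite -subr_eq0 => /eqP E.
  apply/eqP; rewrite -subr_eq0 -E; apply/eqP; ring.
have := H (1 +i* 0); have := H (0 +i* 1).
move: (D (A f) g) (D (A g) f) (D (B f) g) (D (B g) f) => [x y] [x1 y1] [x2 y2] [x3 y3].
by move=> [E1 E2] [E3 E4]; congr (_ +i* _); lra.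
Qed.

End InnerProduct.

(** * Lebesgue measure on the line *)

Section RealLebesgue.
Variable R : realType.
Local Notation mu := (@lebesgue_measure R).

Lemma Lfun2P (u : R -> R) : u \in Lfun mu 2%:E <->
  measurable_fun setT u /\ mu.-integrable setT (fun x => (u x ^+ 2)%:E).
Proof.
split=> [u2|[mu_ iu]].
  split; last exact: Lfun2_integrable_sqr.
  by move: u2; rewrite inE => /andP[]; rewrite inE.
rewrite inE; apply/andP; split; rewrite inE//=.
rewrite /finite_norm unlock /Lnorm poweR_lty//.
move/integrableP : iu => [_]; apply: le_lt_trans.
rewrite le_eqVlt; apply/orP; left; apply/eqP; apply: eq_integral => x _ /=.
by rewrite powR_mulrn// real_normK ?num_real// ger0_norm ?sqr_ge0.
Qed.

Lemma Lfun2_dom (u g : R -> R) : measurable_fun setT u ->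
  mu.-integrable setT (EFin \o g) -> (forall x, u x ^+ 2 <= g x) ->
  u \in Lfun mu 2%:E.
Proof.
move=> mu_ ig ug; apply/Lfun2P; split => //.
apply: (le_integrable _ _ _ ig) => //.
  by apply/measurable_EFinP; exact: measurable_funX.
move=> x _ /=; rewrite lee_fin ger0_norm ?sqr_ge0//.
by rewrite (le_trans (ug x))// ler_norm.
Qed.

Lemma ae_impl (P Q : R -> Prop) : (forall x, P x -> Q x) ->
  {ae mu, forall x, P x} -> {ae mu, forall x, Q x}.
Proof. by move=> PQ; exact: (@filterS _ _ (ae_filter_ringOfSetsType mu) P Q PQ). Qed.

Lemma ae_conj (P Q : R -> Prop) : {ae mu, forall x, P x} ->
  {ae mu, forall x, Q x} -> {ae mu, forall x, P x /\ Q x}.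
Proof.
move=> aP aQ; have := @filterI _ _ (ae_filter_ringOfSetsType mu) _ _ aP aQ.
by apply: ae_impl.
Qed.

(** Lebesgue differentiation: the primitive of h from -n is constantly 0, and its derivative is h
    almost everywhere beyond -n. *)
Lemma ae_eq0_of_itv (h : R -> R) : mu.-integrable setT (EFin \o h) ->
  (forall a b, a < b -> \int[mu]_(x in `]a, b]) h x = 0) ->
  {ae mu, forall x, h x = 0}.
Proof.
move=> ih h0.
have lh : locally_integrable setT h.
  by rewrite -(patch_setT (cst 0) h); exact: integrable_locally.
have H (n : nat) : {ae mu, forall x, - n%:R < x -> h x = 0}.
  have := @FTC1 R h (BRight (- n%:R)) _ lh.
  have F0 : (fun x : R => \int[mu]_(t in [set` Interval (BRight (- n%:R)) (BRight x)]) h t) = cst 0.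
    apply/funext => x; have [nx|xn] := ltP (- n%:R) x; first exact: h0.
    by rewrite set_itv_ge ?Rintegral_set0// bnd_simp -leNgt.
  rewrite F0; have /[swap]/[apply] : forall y : R, mu.-integrable [set` Interval (BRight (- n%:R)) (BRight y)] (EFin \o h).
    by move=> y; exact: integrableS ih.
  apply: ae_impl => x /= H nx; have [|_ <-] := H; first by rewrite lte_fin.
  by rewrite derive1_cst.
have /ae_foralln := H; apply: ae_impl => x Hx.
apply: (Hx (Num.bound `|x|)); rewrite ltrNl.
by rewrite (le_lt_trans _ (archi_boundP _))// -normrN ler_norm.
Qed.

Definition affine_map (a b : R) (x : measurableTypeR R) : measurableTypeR R :=
  a * x + b.

Lemma measurable_affine a b : measurable_fun setT (affine_map a b).
Proof. by apply: measurable_funD => //; exact: mulrl_measurable. Qed.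

Section Affine.
Variables (a b : R).
Hypothesis a0 : a != 0.
Let phi := affine_map a b.

Let k : {nonneg R} := NngNum (normr_ge0 a).
Let mphi : {measure set (measurableTypeR R) -> \bar R} :=
  mscale k (measure_function_pushforward__canonical__measure_function_Measure
    mu (measurable_affine a b)).

(** The scaled image measure [mphi] agrees with Lebesgue measure on the intervals ]c, d], which
    determine it. For a < 0 the preimage of such an interval is closed on the left instead. *)
Lemma lebesgue_measure_affine (A : set R) : measurable A ->
  mu A = (`|a|%:E * mu (phi @^-1` A))%E.
Proof.
move=> mA; change (mu A = mphi A).
apply: (@lebesgue_measure_unique R mphi) => // _ [[c d]] _ <-.
rewrite /mphi /= /mscale /= /pushforward -/phi.
have [a_gt0|a_lt0] : 0 < a \/ a < 0 by apply/orP; rewrite orbC -neq_lt.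
  rewrite (_ : phi @^-1` _ = `](c - b) / a, (d - b) / a]%classic); last first.
    apply/seteqP; split=> x; rewrite /phi /affine_map /= !in_itv /= ltr_pdivrMr// ler_pdivlMr//;
    by rewrite ltrBlDr lerBrDr mulrC.
  rewrite !lebesgue_measure_itv /= !lte_fin ltr_pM2r ?invr_gt0// ltrD2r.
  case: ifPn => _; last by rewrite mule0.
  by rewrite -!EFinD -EFinM gtr0_norm//; congr (_%:E); field.
rewrite (_ : phi @^-1` _ = `[(d - b) / a, (c - b) / a[%classic); last first.
  apply/seteqP; split=> x; rewrite /phi /affine_map /= !in_itv /= ltr_ndivlMr// ler_ndivrMr//;
  by rewrite ltrBlDr lerBrDr mulrC andbC.
rewrite !lebesgue_measure_itv /= !lte_fin ltr_nM2r ?invr_lt0// ltrD2r.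
case: ifPn => _; last by rewrite mule0.
by rewrite -!EFinD -EFinM ltr0_norm//; congr (_%:E); field.
Qed.

Lemma ge0_integral_affine (f : R -> \bar R) : measurable_fun setT f ->
  (forall x, 0 <= f x)%E ->
  (\int[mu]_x f x = `|a|%:E * \int[mu]_x f (a * x + b)%R)%E.
Proof.
move=> mf f0.
transitivity (\int[mphi]_x f x)%E.
  by apply: eq_measure_integral => A mA _; exact: lebesgue_measure_affine.
rewrite ge0_integral_mscale//= ge0_integral_pushforward//.
by exact: measurable_affine.
Qed.

Lemma integrable_affine (f : R -> \bar R) : mu.-integrable setT f ->
  mu.-integrable setT (fun x => f (a * x + b)).
Proof.
move=> /integrableP[mf fi]; apply/integrableP; split.
  exact: (measurableT_comp mf (measurable_affine a b)).
move: fi; rewrite ge0_integral_affine//; last exact: measurableT_comp.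
have : (0 <= \int[mu]_x `|f (a * x + b)%R|)%E by exact: integral_ge0.
move: (\int[mu]_x _)%E => I.
case: I => [r _ _|_|//]; first by rewrite ltry.
by rewrite gt0_muley// lte_fin normr_gt0.
Qed.

Lemma Rintegral_affine (f : R -> R) : mu.-integrable setT (EFin \o f) ->
  \int[mu]_x f x = `|a| * \int[mu]_x f (a * x + b).
Proof.
move=> fi; rewrite /Rintegral.
have fi' := integrable_affine fi.
have ai : (`|a|%:E \is a fin_num)%E by [].
rewrite -[`|a| in RHS]/(fine `|a|%:E) -fineM//; last exact: integrable_fin_num.
congr fine.
have mp := measurable_funepos (measurable_int mu fi).
have mn := measurable_funeneg (measurable_int mu fi).
have Hp := ge0_integral_affine mp (funepos_ge0 _).
have Hn := ge0_integral_affine mn (funeneg_ge0 _).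
transitivity (\int[mu]_x (EFin \o f)^\+%E x - \int[mu]_x (EFin \o f)^\-%E x)%E.
  exact: integralE.
transitivity (`|a|%:E * (\int[mu]_x (EFin \o f)^\+%E (a * x + b)%R -
    \int[mu]_x (EFin \o f)^\-%E (a * x + b)%R))%E; last first.
  pose g (x : measurableTypeR R) := (f (a * x + b))%:E.
  rewrite -[X in _ = (_ * X)%E]/(\int[mu]_x g x)%E (integralE mu setT g).
  by congr (_ * (_ - _))%E; apply: eq_integral => x _; rewrite ?funeposE ?funenegE.
rewrite Hp Hn; apply/esym; apply: muleBr => //.
apply: fin_num_adde_defl.
rewrite fin_numN; apply: integrable_fin_num => //.
exact: (integrable_affine (integrable_funeneg measurableT fi)).
Qed.

Lemma ae_affine (P : R -> Prop) : {ae mu, forall x, P x} ->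
  {ae mu, forall x, P (a * x + b)}.
Proof.
move=> [N [mN N0 PN]]; exists (phi @^-1` N); split.
- by rewrite -[_ @^-1` _]setTI; exact: (measurable_affine a b).
- move: N0; rewrite lebesgue_measure_affine// => /eqP; rewrite mule_eq0 => /orP[|/eqP//].
  by rewrite eqe normr_eq0 (negbTE a0).
- by move=> x /= Px; apply: PN.
Qed.

End Affine.

Lemma measurable_inv_sqr (f : R -> R) : (forall x, 0 <= f x) ->
  measurable_fun setT f -> measurable_fun setT (fun x => (f x)^-1).
Proof.
move=> f0 mf; rewrite (_ : (fun x => _) = (fun x => f x `^ (-1))).
  exact: (measurableT_comp (measurable_powR _) mf).
by apply/funext => x; rewrite powR_inv1.
Qed.

End RealLebesgue.

(** * Completeness of L^2 *)

Section L2Complete.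
Variable R : realType.
Local Notation mu := (@lebesgue_measure R).

Lemma limn_einf_le (u : (\bar R)^nat) (e : \bar R) n0 :
  (forall n, (n0 <= n)%N -> (u n <= e)%E) -> (limn_einf u <= e)%E.
Proof.
move=> ue; rewrite limn_einf_lim; apply: lime_le; first exact: is_cvg_einfs.
apply: nearW => n; rewrite (le_trans _ (ue (maxn n n0) (leq_maxr _ _)))//.
by apply: ereal_inf_lbound; exists (maxn n n0) => //=; exact: leq_maxl.
Qed.

(* The geometric weights turn square summability of the increments into
   absolute summability. *)
Lemma cvg_weighted_increments (v : R^nat) :
  (\sum_(0 <= k <oo) (4 ^+ k * (v k.+1 - v k) ^+ 2)%:E < +oo)%E -> cvgn v.
Proof.
set S := (\sum_(0 <= k <oo) _)%E => Soo.
have t0 k : (0 <= (4 ^+ k * (v k.+1 - v k) ^+ 2)%:E)%E.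
  by rewrite lee_fin mulr_ge0 ?sqr_ge0 ?exprn_ge0.
have S0 : (0 <= S)%E by apply: nneseries_ge0 => k _ _; exact: t0.
have Sfin : S \is a fin_num by rewrite ge0_fin_numE.
pose B := Num.sqrt (fine S).
have kB k : `|v k.+1 - v k| <= B * 2^-1 ^+ k.
  have : ((4 ^+ k * (v k.+1 - v k) ^+ 2)%:E <= S)%E.
    apply: (@le_trans _ _ (\sum_(0 <= i < k.+1) (4 ^+ i * (v i.+1 - v i) ^+ 2)%:E)%E).
      by rewrite big_nat_recr//= leeDr// sume_ge0.
    by apply: nneseries_lim_ge => i _ _; exact: t0.
  rewrite -(fineK Sfin) lee_fin => H.
  rewrite -(ler_pXn2r (_ : 0 < 2)%N)// ?nnegrE ?mulr_ge0 ?sqrtr_ge0 ?exprn_ge0//.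
  rewrite real_normK ?num_real// exprMn sqr_sqrtr ?fine_ge0//.
  rewrite -exprM mulnC exprM exprVn (_ : 2 ^+ 2 = 4 :> R); last by ring.
  by rewrite exprVn ler_pdivlMr ?exprn_gt0// mulrC.
have /normed_cvg : cvgn [normed series (fun k => v k.+1 - v k)].
  apply: (@series_le_cvg _ _ (geometric B 2^-1)).
  - by move=> n; exact: normr_ge0.
  - by move=> n; rewrite mulr_ge0 ?sqrtr_ge0 ?exprn_ge0.
  - by move=> n; exact: kB.
  - by apply: is_cvg_geometric_series; rewrite ger0_norm// invf_lt1// ltr1n.
move=> cs; have -> : v = (fun n => v 0%N + series (fun k => v k.+1 - v k) n).
  apply/funext => n; rewrite /series /= telescope_sumr// ?leq0n//.
  by rewrite addrC subrK.
by apply: is_cvgD => //; exact: is_cvg_cst.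
Qed.

(** Riesz-Fischer. The weighted sum G of the squared increments has integral at most the sum of 4^k
    8^-k, so it is finite almost everywhere and gives a pointwise limit; Fatou's lemma turns the
    Cauchy property into convergence in norm. *)
Lemma L2_complete_real (v : nat -> R -> R) :
  (forall k, v k \in Lfun mu 2%:E) ->
  (forall k, (\int[mu]_x ((v k.+1 x - v k x) ^+ 2)%:E <= ((8 ^+ k)^-1)%:E)%E) ->
  (forall e, 0 < e -> exists n0, forall m n, (n0 <= m)%N -> (n0 <= n)%N ->
     (\int[mu]_x ((v m x - v n x) ^+ 2)%:E <= e%:E)%E) ->
  exists2 w, w \in Lfun mu 2%:E &
  forall e, 0 < e -> exists n0, forall n, (n0 <= n)%N ->
     (\int[mu]_x ((v n x - w x) ^+ 2)%:E <= e%:E)%E.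
Proof.
move=> vL v8 vC.
have mv k : measurable_fun setT (v k) by case/Lfun2P : (vL k).
have mvB k (u : R -> R) : measurable_fun setT u ->
    measurable_fun setT (fun x => ((v k x - u x) ^+ 2)%:E).
  move=> mu_; apply/measurable_EFinP; apply: measurable_funX.
  exact: measurable_funB.
pose t k x := (4 ^+ k * (v k.+1 x - v k x) ^+ 2)%:E.
have t0 k x : (0 <= t k x)%E by rewrite lee_fin mulr_ge0 ?sqr_ge0 ?exprn_ge0.
have mt k : measurable_fun setT (t k).
  apply/measurable_EFinP; apply: measurable_funM => //.
  by apply/measurable_EFinP; exact: mvB.
pose G x := (\sum_(0 <= k <oo) t k x)%E.
have mG : measurable_fun setT G.
  by apply: ge0_emeasurable_sum => // k x _ _; exact: t0.
have G0 x : (0 <= G x)%E by apply: nneseries_ge0 => k _ _; exact: t0.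
have Gae : {ae mu, forall x, (G x < +oo)%E}.
  have Gint : mu.-integrable setT G.
    apply/integrableP; split => //.
    under eq_integral do rewrite gee0_abs//.
    rewrite integral_nneseries//.
    apply: (@le_lt_trans _ _ (\sum_(0 <= k <oo) (2^-1 ^+ k)%:E)%E).
      apply: lee_nneseries => [k _ _|k _].
        by apply: integral_ge0 => x _; exact: t0.
      rewrite /t; under eq_integral do rewrite EFinM.
      rewrite ge0_integralZl_EFin//; do ?[exact: mvB|by rewrite exprn_ge0|by move=> x _; rewrite lee_fin sqr_ge0].
      rewrite (le_trans (lee_wpmul2l _ (v8 k)))//.
      rewrite -EFinM lee_fin exprVn (_ : 8 = 4 * 2 :> R); last by ring.
      by rewrite exprMn invfM mulrA divff ?mul1r// expf_neq0.
    have := @is_cvg_geometric_series R 1 2^-1.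
    rewrite ger0_norm// invf_lt1// ltr1n => /(_ isT) cg.
    rewrite (_ : (fun n => _) = (fun n => (series (geometric 1 2^-1) n)%:E)); last first.
      apply/funext => n; rewrite /series /= -sumEFin.
      by apply: eq_bigr => i _; rewrite mul1r.
    by rewrite EFin_lim// ltry.
  have := integrable_ae measurableT Gint; apply: ae_impl => x /(_ I).
  by rewrite ge0_fin_numE.
have Gcvg x : (G x < +oo)%E -> cvgn (v ^~ x).
  by move=> Gx; exact: cvg_weighted_increments.
(* With the value 0 where G is infinite, the sequence converges at every point, which makes the
   limit measurable. *)
pose v' k x := if (G x < +oo)%E then v k x else 0.
pose w x := if (G x < +oo)%E then limn (v ^~ x) else 0.
have mif (u : R -> R) : measurable_fun setT u ->
    measurable_fun setT (fun x => if (G x < +oo)%E then u x else 0).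
  move=> mu_; apply: measurable_fun_ifT => //.
  by apply: measurable_fun_lte => //.
have mw : measurable_fun setT w.
  apply: (@measurable_fun_cvg _ _ _ _ v').
    by move=> k; exact: mif.
  move=> x _; rewrite /v' /w; case: ifPn => Gx; last exact: cvg_cst.
  exact: Gcvg.
have key n (e : R) n0 : (forall k, (n0 <= k)%N ->
    (\int[mu]_x ((v n x - v k x) ^+ 2)%:E <= e%:E)%E) ->
    (\int[mu]_x ((v n x - w x) ^+ 2)%:E <= e%:E)%E.
  move=> H; pose f k x := ((v n x - v k x) ^+ 2)%:E.
  have f0 k x : (0 <= f k x)%E by rewrite lee_fin sqr_ge0.
  have mf k : measurable_fun setT (f k) by exact: mvB.
  apply: (@le_trans _ _ (\int[mu]_x limn_einf (f ^~ x))%E).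
    apply: ae_ge0_le_integral => //.
    - by move=> x _; rewrite lee_fin sqr_ge0.
    - exact: mvB.
    - move=> x _; rewrite limn_einf_lim; apply: lime_ge; first exact: is_cvg_einfs.
      by apply: nearW => k; apply: le_ereal_inf_tmp => _ [i /= _ <-].
    - apply: (@emeasurable_fun_cvg _ _ _ _ (fun k x => einfs (f ^~ x) k)).
        by move=> k; exact: measurable_fun_einfs.
      by move=> x _; rewrite limn_einf_lim; exact: is_cvg_einfs.
    - move: Gae; apply: ae_impl => x Gx _.
      have cv : (fun k => f k x) @ \oo --> ((v n x - w x) ^+ 2)%:E.
        have cw : v ^~ x @ \oo --> w x by rewrite /w Gx; exact: Gcvg.
        have c2 : (fun k => v n x - v k x) @ \oo --> v n x - w x.
          exact: cvgB (cvg_cst _) cw.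
        have c3 : (fun k => (v n x - v k x) * (v n x - v k x)) @ \oo -->
          (v n x - w x) * (v n x - w x) by exact: (cvgM c2 c2).
        apply/fine_cvgP; split; first exact: nearW.
        rewrite expr2 (_ : fine \o _ = (fun k => (v n x - v k x) * (v n x - v k x)))//.
      by rewrite (cvg_limn_einf_sup cv).1.
  apply: (le_trans (fatou mu measurableT mf (fun k x _ => f0 k x))).
  exact: (@limn_einf_le _ _ n0).
have wcv e : 0 < e -> exists n0, forall n, (n0 <= n)%N ->
    (\int[mu]_x ((v n x - w x) ^+ 2)%:E <= e%:E)%E.
  move=> /vC[n0 Hn0]; exists n0 => n n0n; apply: (key n e n0) => k n0k.
  exact: Hn0.
exists w => //.
have [n0 /(_ n0 (leqnn _)) H] := wcv 1 ltr01.
have vw : mu.-integrable setT (fun x => ((v n0 x - w x) ^+ 2)%:E).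
  apply/integrableP; split; first exact: mvB.
  under eq_integral do rewrite gee0_abs ?lee_fin ?sqr_ge0//.
  by rewrite (le_lt_trans H)// ltry.
have v2 : mu.-integrable setT (fun x => (v n0 x ^+ 2)%:E) by case/Lfun2P : (vL n0).
apply: (@Lfun2_dom _ w (fun x => 2 * v n0 x ^+ 2 + 2 * (v n0 x - w x) ^+ 2)) => //.
  rewrite (_ : _ \o _ = (fun x => 2%:E * (v n0 x ^+ 2)%:E) \+
      (fun x => 2%:E * ((v n0 x - w x) ^+ 2)%:E))%E//.
  by apply: integrableD => //; exact: integrableZl.
(* Four times this square is 2 v^2 + 2 (v - w)^2 - w^2. *)
by move=> x; have := sqr_ge0 (v n0 x - 2^-1 * w x); nra.
Qed.

End L2Complete.

(** * Complex-valued functions *)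

Section ComplexModulus.
Variable R : realType.
Implicit Types z w : R[i].

Lemma sqr_normc z : Normc.normc z ^+ 2 = complex.Re z ^+ 2 + complex.Im z ^+ 2.
Proof. by case: z => x y /=; rewrite sqr_sqrtr// addr_ge0 ?sqr_ge0. Qed.

Lemma normc_ge0 z : 0 <= Normc.normc z.
Proof. by case: z => x y; exact: sqrtr_ge0. Qed.

Lemma normcJ z : Normc.normc z^* = Normc.normc z.
Proof. by case: z => x y /=; rewrite sqrrN. Qed.

Lemma mulcJ z : z * z^* = (Normc.normc z ^+ 2)%:C.
Proof.
by rewrite sqr_normc; case: z => x y /=; congr (_ +i* _); ring.
Qed.

Lemma normr_Re_le z : `|complex.Re z| <= Normc.normc z.
Proof.
rewrite -(ler_pXn2r (_ : 0 < 2)%N)// ?nnegrE ?normc_ge0//.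
by rewrite real_normK ?num_real// sqr_normc lerDl sqr_ge0.
Qed.

Lemma normr_Im_le z : `|complex.Im z| <= Normc.normc z.
Proof.
rewrite -(ler_pXn2r (_ : 0 < 2)%N)// ?nnegrE ?normc_ge0//.
by rewrite real_normK ?num_real// sqr_normc lerDr sqr_ge0.
Qed.

Lemma normc_le z : Normc.normc z <= `|complex.Re z| + `|complex.Im z|.
Proof.
rewrite -(ler_pXn2r (_ : 0 < 2)%N)// ?nnegrE ?normc_ge0 ?addr_ge0//.
rewrite sqrrD !real_normK ?num_real// sqr_normc.
by rewrite addrAC lerDl mulrn_wge0// mulr_ge0.
Qed.

Lemma normc_real (x : R) : Normc.normc x%:C = `|x|.
Proof. by rewrite /= expr0n addr0 sqrtr_sqr. Qed.

Lemma Re_mul z w : complex.Re (z * w) =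
  complex.Re z * complex.Re w - complex.Im z * complex.Im w.
Proof. by case: z; case: w. Qed.

Lemma Im_mul z w : complex.Im (z * w) =
  complex.Re z * complex.Im w + complex.Im z * complex.Re w.
Proof. by case: z; case: w. Qed.

Lemma Re_add z w : complex.Re (z + w) = complex.Re z + complex.Re w.
Proof. by case: z; case: w. Qed.

Lemma Im_add z w : complex.Im (z + w) = complex.Im z + complex.Im w.
Proof. by case: z; case: w. Qed.

Lemma Re_conj z : complex.Re z^* = complex.Re z. Proof. by case: z. Qed.
Lemma Im_conj z : complex.Im z^* = - complex.Im z. Proof. by case: z. Qed.

Lemma eq_ReIm z w : complex.Re z = complex.Re w ->
  complex.Im z = complex.Im w -> z = w.
Proof. by case: z => ? ?; case: w => ? ? /= -> ->. Qed.

Lemma Re_inv z : complex.Re z^-1 = complex.Re z * (Normc.normc z ^+ 2)^-1.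
Proof. by rewrite sqr_normc; case: z. Qed.

Lemma Im_inv z : complex.Im z^-1 = - complex.Im z * (Normc.normc z ^+ 2)^-1.
Proof. by rewrite sqr_normc; case: z => a b /=; rewrite mulNr. Qed.

End ComplexModulus.

Section ComplexFunctions.
Variable R : realType.
Local Notation mu := (@lebesgue_measure R).
Implicit Types u v : R -> R[i].

Definition cmeas u := measurable_fun setT (fun x => complex.Re (u x)) /\
  measurable_fun setT (fun x => complex.Im (u x)).

Definition cintegrable u :=
  mu.-integrable setT (fun x => (complex.Re (u x))%:E) /\
  mu.-integrable setT (fun x => (complex.Im (u x))%:E).

Definition cL2 u := (fun x => complex.Re (u x)) \in Lfun mu 2%:E /\
  (fun x => complex.Im (u x)) \in Lfun mu 2%:E.

Local Notation cI u := (cintegral mu setT u).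

Lemma cmeas_cst (c : R[i]) : cmeas (fun=> c).
Proof. by split; exact: measurable_cst. Qed.

Lemma cmeasD u v : cmeas u -> cmeas v -> cmeas (fun x => u x + v x).
Proof.
move=> [u1 u2] [v1 v2]; split.
  by under eq_fun do rewrite Re_add; exact: measurable_funD.
by under eq_fun do rewrite Im_add; exact: measurable_funD.
Qed.

Lemma cmeasM u v : cmeas u -> cmeas v -> cmeas (fun x => u x * v x).
Proof.
move=> [u1 u2] [v1 v2]; split.
  under eq_fun do rewrite Re_mul.
  by apply: measurable_funB; exact: measurable_funM.
under eq_fun do rewrite Im_mul.
by apply: measurable_funD; exact: measurable_funM.
Qed.

Lemma cmeas_conj u : cmeas u -> cmeas (fun x => (u x)^*).
Proof.
move=> [u1 u2]; split; first by under eq_fun do rewrite Re_conj.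
by under eq_fun do rewrite Im_conj; exact: measurable_funN.
Qed.

Lemma cmeas_sqr u : cmeas u ->
  measurable_fun setT (fun x => Normc.normc (u x) ^+ 2).
Proof.
move=> [u1 u2]; under eq_fun do rewrite sqr_normc.
by apply: measurable_funD; exact: measurable_funX.
Qed.

Lemma cmeas_norm u : cmeas u -> measurable_fun setT (fun x => Normc.normc (u x)).
Proof.
move=> /cmeas_sqr mu_; rewrite (_ : (fun x => _) = (fun x => (Normc.normc (u x) ^+ 2) `^ 2^-1)).
  exact: (measurableT_comp (measurable_powR _) mu_).
by apply/funext => x; rewrite powR12_sqrt ?sqr_ge0// sqrtr_sqr ger0_norm// normc_ge0.
Qed.

Lemma cmeasV u : cmeas u -> cmeas (fun x => (u x)^-1).
Proof.
move=> cu; have [u1 u2] := cu.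
have mi : measurable_fun setT (fun x => (Normc.normc (u x) ^+ 2)^-1).
  by apply: measurable_inv_sqr => [x|]; [exact: sqr_ge0|exact: cmeas_sqr].
split.
  by under eq_fun do rewrite Re_inv; exact: measurable_funM.
by under eq_fun do rewrite Im_inv; apply: measurable_funM => //; exact: measurable_funN.
Qed.

Lemma cmeas_real (f : R -> R) : measurable_fun setT f ->
  cmeas (fun x => (f x)%:C).
Proof. by move=> mf; split => //; exact: measurable_cst. Qed.

Lemma cmeas_if (b : R -> bool) u v : measurable_fun setT b ->
  cmeas u -> cmeas v -> cmeas (fun x => if b x then u x else v x).
Proof.
move=> mb [u1 u2] [v1 v2]; split.
  rewrite (_ : (fun x => _) = (fun x => if b x then complex.Re (u x) else complex.Re (v x))).
    exact: measurable_fun_ifT.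
  by apply/funext => x; case: ifP.
rewrite (_ : (fun x => _) = (fun x => if b x then complex.Im (u x) else complex.Im (v x))).
  exact: measurable_fun_ifT.
by apply/funext => x; case: ifP.
Qed.

Lemma cmeas_affine a b u : cmeas u -> cmeas (fun x => u (a * x + b)).
Proof.
by move=> [u1 u2]; split; [exact: (measurableT_comp u1 (measurable_affine a b))|
  exact: (measurableT_comp u2 (measurable_affine a b))].
Qed.

Lemma cintegrable_meas u : cintegrable u -> cmeas u.
Proof.
by move=> [u1 u2]; split; apply/measurable_EFinP;
  [exact: measurable_int u1|exact: measurable_int u2].
Qed.

Lemma cintegrable_dom u (g : R -> R) : cmeas u ->
  mu.-integrable setT (EFin \o g) -> (forall x, Normc.normc (u x) <= g x) ->
  cintegrable u.
Proof.
move=> [u1 u2] ig ug; split; apply: (le_integrable _ _ _ ig) => //.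
- exact/measurable_EFinP.
- move=> x _ /=; rewrite lee_fin (le_trans (normr_Re_le _))//.
  by rewrite (le_trans (ug x))// ler_norm.
- exact/measurable_EFinP.
- move=> x _ /=; rewrite lee_fin (le_trans (normr_Im_le _))//.
  by rewrite (le_trans (ug x))// ler_norm.
Qed.

Lemma cintegrable_norm u : cintegrable u ->
  mu.-integrable setT (fun x => (Normc.normc (u x))%:E).
Proof.
move=> iu; have [u1 u2] := iu.
apply: (@le_integrable _ _ _ mu setT measurableT _
  (fun x => (`|complex.Re (u x)| + `|complex.Im (u x)|)%:E)).
- by apply/measurable_EFinP; apply: cmeas_norm; exact: cintegrable_meas.
- move=> x _ /=; rewrite lee_fin ger0_norm ?normc_ge0// ger0_norm ?addr_ge0//.
  exact: normc_le.
- rewrite (_ : (fun x => _) = (fun x => `|(complex.Re (u x))%:E|) \+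
    (fun x => `|(complex.Im (u x))%:E|))%E//.
  by apply: integrableD => //; exact: integrable_abse.
Qed.

Lemma cintegrable_mulb u v (C : R) : cintegrable u -> cmeas v ->
  (forall x, Normc.normc (v x) <= C) -> cintegrable (fun x => u x * v x).
Proof.
move=> iu mv vC; apply: (@cintegrable_dom _ (fun x => C * Normc.normc (u x))).
- by apply: cmeasM => //; exact: cintegrable_meas.
- rewrite (_ : _ \o _ = (fun x => C%:E * (Normc.normc (u x))%:E))%E//.
  by apply: integrableZl => //; exact: cintegrable_norm.
- by move=> x; rewrite Normc.normcM mulrC ler_wpM2r// normc_ge0.
Qed.

Lemma cintegrable_lin (a : R[i]) u v : cintegrable u -> cintegrable v ->
  cintegrable (fun x => a * u x + v x).
Proof.
move=> iu iv.
apply: (@cintegrable_dom _ (fun x => Normc.normc a * Normc.normc (u x) + Normc.normc (v x))).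
- apply: cmeasD; last exact: cintegrable_meas.
  by apply: cmeasM; [exact: cmeas_cst|exact: cintegrable_meas].
- rewrite (_ : _ \o _ = (fun x => (Normc.normc a)%:E * (Normc.normc (u x))%:E) \+
    (fun x => (Normc.normc (v x))%:E))%E//.
  apply: integrableD => //; last exact: cintegrable_norm.
  by apply: integrableZl => //; exact: cintegrable_norm.
- by move=> x; rewrite (le_trans (le_normcD _ _))// Normc.normcM.
Qed.

Lemma cintegral_lin (a : R[i]) u v : cintegrable u -> cintegrable v ->
  cI (fun x => a * u x + v x) = a * cI u + cI v.
Proof.
have Zl (c : R) (f : R -> R) : mu.-integrable setT (fun x => (f x)%:E) ->
    mu.-integrable setT (EFin \o (fun x => c * f x)).
  by move=> fi; rewrite (_ : _ \o _ = (fun x => c%:E * (f x)%:E))%E//; exact: integrableZl.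
move=> [u1 u2] [v1 v2]; apply: eq_ReIm; rewrite ?Re_add ?Im_add ?Re_mul ?Im_mul /=.
  under eq_Rintegral do rewrite Re_add Re_mul.
  rewrite RintegralD//; last first.
    rewrite (_ : _ \o _ = (fun x => (complex.Re a)%:E * (complex.Re (u x))%:E) \-
      (fun x => (complex.Im a)%:E * (complex.Im (u x))%:E))%E//.
    by apply: integrableB => //; exact: integrableZl.
  rewrite RintegralB//; [|exact: Zl|exact: Zl].
  by rewrite !RintegralZl.
under eq_Rintegral do rewrite Im_add Im_mul.
rewrite RintegralD//; last first.
  rewrite (_ : _ \o _ = (fun x => (complex.Re a)%:E * (complex.Im (u x))%:E) \+
    (fun x => (complex.Im a)%:E * (complex.Re (u x))%:E))%E//.
  by apply: integrableD => //; exact: integrableZl.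
rewrite RintegralD//; [|exact: Zl|exact: Zl].
by rewrite !RintegralZl.
Qed.

Lemma cintegral_conj u : cintegrable u -> cI (fun x => (u x)^*) = (cI u)^*.
Proof.
move=> [u1 u2]; apply: eq_ReIm; rewrite ?Re_conj ?Im_conj /=.
  by under eq_Rintegral do rewrite Re_conj.
under eq_Rintegral do rewrite Im_conj -mulN1r.
by rewrite RintegralZl// mulN1r.
Qed.

Lemma cintegral0 : cI (fun=> 0) = 0.
Proof.
by apply: eq_ReIm; rewrite /= /Rintegral integral0_eq.
Qed.

Lemma cintegralZ (a : R[i]) u : cintegrable u ->
  cI (fun x => a * u x) = a * cI u.
Proof.
move=> iu; have i0 : cintegrable (fun=> 0).
  by split; exact: integrable0.
have := cintegral_lin a iu i0; rewrite cintegral0 addr0 => <-.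
by congr cintegral; apply/funext => x; rewrite addr0.
Qed.

Lemma eq_cintegral_ae u v : cmeas u -> cmeas v ->
  {ae mu, forall x, u x = v x} -> cI u = cI v.
Proof.
move=> [u1 u2] [v1 v2] uv.
have E (f : R[i] -> R) : {ae mu, forall x, setT x -> (f (u x))%:E = (f (v x))%:E}.
  by move: uv; apply: ae_impl => x -> _.
apply: eq_ReIm; rewrite /= /Rintegral; congr fine.
  apply: ae_eq_integral; [by []|exact/measurable_EFinP|exact/measurable_EFinP|].
  exact: (E (@complex.Re R)).
apply: ae_eq_integral; [by []|exact/measurable_EFinP|exact/measurable_EFinP|].
exact: (E (@complex.Im R)).
Qed.

Lemma cintegrable_affine a b u : a != 0 -> cintegrable u ->
  cintegrable (fun x => u (a * x + b)).
Proof.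
move=> a0 [u1 u2]; split; [exact: (integrable_affine b a0 u1)|].
exact: (integrable_affine b a0 u2).
Qed.

Lemma cintegral_affine a b u : a != 0 -> cintegrable u ->
  cI u = (`|a|)%:C * cI (fun x => u (a * x + b)).
Proof.
move=> a0 [u1 u2]; apply: eq_ReIm; rewrite ?Re_mul ?Im_mul /= !mul0r ?subr0 ?addr0.
  exact: (Rintegral_affine b a0 u1).
exact: (Rintegral_affine b a0 u2).
Qed.

Lemma cL2P u : cL2 u <-> cmeas u /\
  mu.-integrable setT (fun x => (Normc.normc (u x) ^+ 2)%:E).
Proof.
split=> [[/Lfun2P[m1 i1] /Lfun2P[m2 i2]]|[[m1 m2] iu]].
  split => //; under eq_fun do rewrite sqr_normc EFinD.
  exact: integrableD.
split; apply: (Lfun2_dom _ iu) => // x; rewrite sqr_normc ?lerDl ?lerDr;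
  exact: sqr_ge0.
Qed.

Lemma cL2_meas u : cL2 u -> cmeas u. Proof. by move=> /cL2P[]. Qed.

Lemma cL2_dom u (g : R -> R) : cmeas u -> mu.-integrable setT (EFin \o g) ->
  (forall x, Normc.normc (u x) ^+ 2 <= g x) -> cL2 u.
Proof.
move=> mu_ ig ug; apply/cL2P; split => //.
apply: (le_integrable _ _ _ ig) => //.
  by apply/measurable_EFinP; exact: cmeas_sqr.
move=> x _ /=; rewrite lee_fin ger0_norm ?sqr_ge0//.
by rewrite (le_trans (ug x))// ler_norm.
Qed.

Lemma cL2_lin (a : R[i]) u v : cL2 u -> cL2 v -> cL2 (fun x => a * u x + v x).
Proof.
move=> /cL2P[m1 i1] /cL2P[m2 i2].
apply: (@cL2_dom _ (fun x => 2 * Normc.normc a ^+ 2 * Normc.normc (u x) ^+ 2 + 2 * Normc.normc (v x) ^+ 2)).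
- by apply: cmeasD => //; apply: cmeasM => //; exact: cmeas_cst.
- rewrite (_ : _ \o _ = (fun x => (2 * Normc.normc a ^+ 2)%:E * (Normc.normc (u x) ^+ 2)%:E) \+
    (fun x => 2%:E * (Normc.normc (v x) ^+ 2)%:E))%E//.
  by apply: integrableD => //; exact: integrableZl.
- move=> x; have := le_normcD (a * u x) (v x); rewrite Normc.normcM.
  move: (normc_ge0 (a * u x + v x)).
  move: (Normc.normc (a * u x + v x)) (Normc.normc a) (Normc.normc (u x)) (Normc.normc (v x)) => n p q r n0 H.
  have : n ^+ 2 <= (p * q + r) ^+ 2 by rewrite ler_pXn2r// nnegrE (le_trans n0).
  by have := sqr_ge0 (p * q - r); nra.
Qed.

Lemma cL2_mulb u v (C : R) : cL2 u -> cmeas v ->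
  (forall x, Normc.normc (v x) <= C) -> cL2 (fun x => v x * u x).
Proof.
move=> /cL2P[m1 i1] mv vC.
apply: (@cL2_dom _ (fun x => C ^+ 2 * Normc.normc (u x) ^+ 2)).
- exact: cmeasM.
- rewrite (_ : _ \o _ = (fun x => (C ^+ 2)%:E * (Normc.normc (u x) ^+ 2)%:E))%E//.
  exact: integrableZl.
- move=> x; rewrite Normc.normcM exprMn ler_wpM2r ?sqr_ge0//.
  by rewrite ler_pXn2r ?nnegrE ?normc_ge0// (le_trans (normc_ge0 _) (vC x)).
Qed.

Lemma cL2_affine a b u : a != 0 -> cL2 u -> cL2 (fun x => u (a * x + b)).
Proof.
move=> a0 /cL2P[m1 i1]; apply/cL2P; split; first exact: cmeas_affine.
exact: (integrable_affine b a0 i1).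
Qed.

Lemma cL2_integrable u v : cL2 u -> cL2 v -> cintegrable (fun x => u x * (v x)^*).
Proof.
move=> /cL2P[m1 i1] /cL2P[m2 i2].
apply: (@cintegrable_dom _ (fun x => Normc.normc (u x) ^+ 2 + Normc.normc (v x) ^+ 2)).
- by apply: cmeasM => //; exact: cmeas_conj.
- by rewrite (_ : _ \o _ = (fun x => (Normc.normc (u x) ^+ 2)%:E) \+
    (fun x => (Normc.normc (v x) ^+ 2)%:E))%E//; exact: integrableD.
- move=> x; rewrite Normc.normcM normcJ.
  by move: (Normc.normc _) (Normc.normc _) => a b; have := sqr_ge0 (a - b); have := sqr_ge0 (a + b); nra.
Qed.

Lemma cL2_0 : cL2 (fun=> 0).
Proof.
apply/cL2P; split; first exact: cmeas_cst.
by under eq_fun do rewrite Normc.normc0 expr0n; exact: integrable0.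
Qed.

Lemma cintegral_sqr u : cL2 u -> cI (fun x => u x * (u x)^*) =
  (fine (\int[mu]_x (Normc.normc (u x) ^+ 2)%:E)%E)%:C.
Proof.
move=> _; apply: eq_ReIm => /=.
  by rewrite /Rintegral; congr fine; apply: eq_integral => x _; rewrite mulcJ.
by rewrite /Rintegral integral0_eq// => x _; rewrite mulcJ.
Qed.

End ComplexFunctions.

(** * The space L^2(R)^p *)

Section L2Space.
Variables (R : realType) (p : nat).
Local Notation mu := (@lebesgue_measure R).
Local Notation cI u := (cintegral mu setT u).

Definition L2mem : {pred (R -> 'I_p -> R[i])} := fun f => `[< L2 f >].

Lemma L2mem_submod : submod_closed L2mem.
Proof.
split; first by apply/asboolP => j; exact: cL2_0.
by move=> a f g /asboolP Lf /asboolP Lg; apply/asboolP => j; exact: cL2_lin.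
Qed.

HB.instance Definition _ := GRing.isSubmodClosed.Build _ _ L2mem L2mem_submod.

(** Bundling makes the square integrable functions a module over [R[i]], to which the results on
    inner products apply. No quotient is taken: by [nrm_aeeq], almost everywhere equality is
    [nrm (f - g) = 0]. *)
Record l2vect := L2Vect { l2fun :> R -> 'I_p -> R[i]; _ : l2fun \in L2mem }.
HB.instance Definition _ := [isSub for l2fun].
HB.instance Definition _ := [Choice of l2vect by <:].
HB.instance Definition _ := [SubChoice_isSubLmodule of l2vect by <:].

Definition mkl2 (f : vect R p) (Lf : L2 f) : l2vect := L2Vect (introT (asboolP _) Lf).

Lemma l2P (f : l2vect) : L2 f.
Proof. by case: f => f Lf; exact/asboolP. Qed.

Lemma l2_linE (a : R[i]) (f g : l2vect) x j : l2fun (a *: f + g) x j = a * f x j + g x j.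
Proof. by []. Qed.

Lemma l2_subE (f g : l2vect) x j : l2fun (f - g) x j = f x j - g x j.
Proof. by []. Qed.

Definition l2dot (f g : l2vect) : R[i] := dot f g.

Lemma l2_inner : inner_product l2dot.
Proof.
split.
- move=> a f g h; rewrite /l2dot /dot mulr_sumr -big_split /=.
  apply: eq_bigr => j _; rewrite -cintegral_lin; [|exact: cL2_integrable (l2P _ _) (l2P _ _)..].
  by congr cintegral; apply/funext => x; rewrite mulrA -mulrDl.
- move=> f g; rewrite /l2dot /dot rmorph_sum; apply: eq_bigr => j _.
  transitivity ((cI (fun x => f x j * (g x j)^*))^*); last by [].
  rewrite -cintegral_conj; last exact: cL2_integrable (l2P _ _) (l2P _ _).
  by congr cintegral; apply/funext => x; rewrite rmorphM /= conjcK mulrC.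
- move=> f; rewrite /l2dot /dot raddf_sum sumr_ge0// => j _.
  rewrite cintegral_sqr; last exact: l2P.
  by rewrite fine_ge0// integral_ge0// => x _; rewrite lee_fin sqr_ge0.
Qed.

Local Notation nrm := (nrm l2dot).

Lemma sqnorm_l2 (f : l2vect) : sqnorm f = (nrm f ^+ 2)%:E.
Proof.
rewrite (sqr_nrm l2_inner) /l2dot /dot raddf_sum -sumEFin; apply: eq_bigr => j _.
rewrite cintegral_sqr; last exact: l2P.
have /cL2P[_ i2] := l2P f j.
by rewrite /= fineK//; exact: integrable_fin_num.
Qed.

Lemma sqr_nrm_l2 (f : l2vect) : nrm f ^+ 2 =
  \sum_(j < p) fine (\int[mu]_x (Normc.normc (f x j) ^+ 2)%:E)%E.
Proof.
rewrite (sqr_nrm l2_inner) /l2dot /dot raddf_sum; apply: eq_bigr => j _.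
by rewrite cintegral_sqr; last exact: l2P.
Qed.

Lemma nrm_aeeq (f g : l2vect) : nrm (f - g) = 0 <-> aeeq f g.
Proof.
have e j : mu.-integrable setT (fun x => (Normc.normc (l2fun (f - g) x j) ^+ 2)%:E).
  by have /cL2P[] := l2P (f - g) j.
have ge0 j : (0 <= \int[mu]_x (Normc.normc (l2fun (f - g) x j) ^+ 2)%:E)%E.
  by apply: integral_ge0 => x _; rewrite lee_fin sqr_ge0.
split=> [fg0 j|fg].
  have /eqP : nrm (f - g) ^+ 2 = 0 by rewrite fg0 expr0n.
  rewrite sqr_nrm_l2 psumr_eq0; last by move=> i _; exact: fine_ge0.
  move=> /allP/(_ j (mem_index_enum _))/= /eqP H.
  have I0 : (\int[mu]_x `|(Normc.normc (l2fun (f - g) x j) ^+ 2)%:E| = 0)%E.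
    under eq_integral do rewrite gee0_abs ?lee_fin ?sqr_ge0//.
    by rewrite -[LHS]fineK ?H//; exact: integrable_fin_num.
  have := (ae_eq_integral_abs mu measurableT (measurable_int _ (e j))).1 I0.
  apply: ae_impl => x /(_ I) /= [] /eqP; rewrite expf_eq0 /= => /eqP /Normc.eq0_normc.
  by move=> E; apply/eqP; rewrite -subr_eq0; apply/eqP; exact: E.
apply/eqP; rewrite -sqrf_eq0 sqr_nrm_l2 big1// => j _.
rewrite (_ : (\int[mu]_x _)%E = 0%E)//.
transitivity (\int[mu]_x (cst 0 x : \bar R))%E; last by rewrite integral0.
apply: ae_eq_integral => //; first exact: measurable_int (e j).
have E : {ae mu, forall x, setT x -> (Normc.normc (l2fun (f - g) x j) ^+ 2)%:E = cst 0%E x}.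
  by have := fg j; apply: ae_impl => x E _; rewrite l2_subE E subrr Normc.normc0 expr0n.
exact: E.
Qed.

Lemma eq_l2dot_ae (f f' g g' : l2vect) : aeeq f f' -> aeeq g g' ->
  l2dot f g = l2dot f' g'.
Proof.
move=> /nrm_aeeq /(nrm_subP l2_inner) E1 /nrm_aeeq /(nrm_subP l2_inner) E2.
by rewrite E1 (ip_conj l2_inner) E2 -(ip_conj l2_inner).
Qed.

Lemma l2_complete : complete_for_nrm l2dot.
Proof.
move=> u uC.
have [N NP] : exists N : nat -> nat, forall k m n, (N k <= m)%N -> (N k <= n)%N ->
    nrm (u m - u n) < (8 ^+ k)^-1.
  have H k : 0 < (8 ^+ k)^-1 :> R by rewrite invr_gt0 exprn_gt0.
  by have [N NP] := choice (fun k => uC _ (H k)); exists N.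
(* The sum makes [s] nondecreasing with [s k] beyond [N k]; the summand k makes it unbounded. *)
pose s k := (k + \sum_(i < k.+1) N i)%N.
have Ns k : (N k <= s k)%N by rewrite /s big_ord_recr /= addnA leq_addl.
have sS k : (s k <= s k.+1)%N.
  by apply: leq_add => //; rewrite [in leqRHS]big_ord_recr leq_addr.
have ks k : (k <= s k)%N by exact: leq_addr.
pose v k := u (s k).
have compE (c : R[i] -> R) : (c = @complex.Re R \/ c = @complex.Im R) ->
    forall (f : l2vect) j, (\int[mu]_x (c (f x j) ^+ 2)%:E <= (nrm f ^+ 2)%:E)%E.
  move=> cE f j; rewrite -sqnorm_l2 /sqnorm (bigD1 j)//=.
  have : (\int[mu]_x (c (f x j) ^+ 2)%:E <= \int[mu]_x (Normc.normc (f x j) ^+ 2)%:E)%E.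
    have /cL2P[[m1 m2] /measurable_int m3] := l2P f j.
    apply: ge0_le_integral => //.
    - by move=> x _; rewrite lee_fin sqr_ge0.
    - by apply/measurable_EFinP; apply: measurable_funX; case: cE => ->.
    - by move=> x _; rewrite lee_fin sqr_normc; case: cE => ->; rewrite ?lerDl ?lerDr sqr_ge0.
  move/le_trans; apply; rewrite leeDl// sume_ge0// => i _.
  by apply: integral_ge0 => x _; rewrite lee_fin sqr_ge0.
have lim (c : R[i] -> R) (cE : c = @complex.Re R \/ c = @complex.Im R) j :
    exists2 w, w \in Lfun mu 2%:E & forall e, 0 < e -> exists n0, forall n, (n0 <= n)%N ->
      (\int[mu]_x ((c (v n x j) - w x) ^+ 2)%:E <= e%:E)%E.
  have cB (f g : l2vect) x : c (f x j) - c (g x j) = c (l2fun (f - g) x j).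
    by rewrite l2_subE; case: cE => ->; case: (f x j) => ? ?; case: (g x j).
  apply: (@L2_complete_real R (fun k x => c (v k x j))).
  - by move=> k; have := l2P (v k) j; case: cE => -> [].
  - move=> k; under eq_integral do rewrite cB.
    rewrite (le_trans (compE _ cE _ _))// lee_fin.
    have := NP k (s k.+1) (s k) (leq_trans (Ns _) (sS _)) (Ns _).
    move/ltW => H; rewrite (le_trans (lerXn2r 2 _ _ H)) ?nnegrE ?nrm_ge0 ?invr_ge0 ?exprn_ge0//.
    by rewrite expr2 ler_piMr ?invr_ge0 ?exprn_ge0// invf_le1 ?exprn_gt0// exprn_ege1// ler1n.
  - move=> e e0; have [n0 Hn0] := uC (Num.sqrt e) (etrans (sqrtr_gt0 _) e0).
    exists n0 => m n /leq_trans Hm /leq_trans Hn; under eq_integral do rewrite cB.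
    rewrite (le_trans (compE _ cE _ _))// lee_fin.
    have H : nrm (v m - v n) <= Num.sqrt e 
      by apply/ltW/Hn0; [exact: Hm (ks m)|exact: Hn (ks n)].
    by rewrite -[leRHS](sqr_sqrtr (ltW e0)) lerXn2r ?nnegrE ?nrm_ge0 ?sqrtr_ge0.
have [wr wr2 wrP] : exists2 wr : 'I_p -> R -> R, (forall j, wr j \in Lfun mu 2%:E) &
    forall j e, 0 < e -> exists n0, forall n, (n0 <= n)%N ->
      (\int[mu]_x ((complex.Re (v n x j) - wr j x) ^+ 2)%:E <= e%:E)%E.
  have [w wP] := choice (fun j => let: ex_intro2 w a b := lim _ (or_introl erefl) j
    in ex_intro _ w (conj a b)).
  by exists w => j; case: (wP j).
have [wi wi2 wiP] : exists2 wi : 'I_p -> R -> R, (forall j, wi j \in Lfun mu 2%:E) &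
    forall j e, 0 < e -> exists n0, forall n, (n0 <= n)%N ->
      (\int[mu]_x ((complex.Im (v n x j) - wi j x) ^+ 2)%:E <= e%:E)%E.
  have [w wP] := choice (fun j => let: ex_intro2 w a b := lim _ (or_intror erefl) j
    in ex_intro _ w (conj a b)).
  by exists w => j; case: (wP j).
have Ll : L2 (fun x j => wr j x +i* wi j x) by move=> j; split; [exact: wr2|exact: wi2].
pose l := mkl2 Ll; exists l.
have vl e : 0 < e -> exists n0, forall n, (n0 <= n)%N -> nrm (v n - l) < e.
  (* The 2 p components contribute at most 2 p d < e^2; p + 1 keeps the divisor nonzero when p =
     0. *)
  move=> e0; pose d := e ^+ 2 / (4 * p.+1%:R).
  have d0 : 0 < d by rewrite divr_gt0 ?exprn_gt0// mulr_gt0.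
  have [nr nrP] := choice (fun j => wrP j d d0).
  have [ni niP] := choice (fun j => wiP j d d0).
  exists (\sum_(j < p) (nr j + ni j))%N => n Hn.
  have Hj j : (nr j + ni j <= n)%N.
    by rewrite (leq_trans _ Hn)// (bigD1 j)//= leq_addr.
  rewrite -(ltr_pXn2r (_ : 0 < 2)%N)// ?nnegrE ?nrm_ge0 ?ltW//.
  apply: (@le_lt_trans _ _ (\sum_(j < p) (d + d))).
    rewrite sqr_nrm_l2; apply: ler_sum => j _.
    have /cL2P[[m1 m2] i3] := l2P (v n - l) j.
    rewrite -lee_fin fineK; last exact: integrable_fin_num.
    under eq_integral do rewrite sqr_normc EFinD.
    rewrite ge0_integralD//; first last.
    - by apply/measurable_EFinP; exact: measurable_funX.
    - by move=> x _; rewrite lee_fin sqr_ge0.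
    - by apply/measurable_EFinP; exact: measurable_funX.
    - by move=> x _; rewrite lee_fin sqr_ge0.
    rewrite EFinD leeD//.
    - under eq_integral do rewrite l2_subE Re_add raddfN /=.
      by apply: nrP; rewrite (leq_trans _ (Hj j))// leq_addr.
    - under eq_integral do rewrite l2_subE Im_add raddfN /=.
      by apply: niP; rewrite (leq_trans _ (Hj j))// leq_addl.
  rewrite sumr_const card_ord -mulr2n -mulrnA -mulr_natr /d.
  rewrite mulrAC ltr_pdivrMr ?mulr_gt0// ltr_pM2l ?exprn_gt0//.
  have : 0 <= p%:R :> R by [].
  by rewrite natrM -[p.+1]addn1 natrD; lra.
move=> e e0; have [|n0 Hn0] := vl (e / 2); first by rewrite divr_gt0.
have [|n1 Hn1] := uC (e / 2); first by rewrite divr_gt0.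
exists n1 => n Hn; pose k := maxn n0 n1.
rewrite (le_lt_trans (nrm_dist l2_inner _ (v k) _))// [e]splitr ltrD//.
  by apply: Hn1 => //; rewrite (leq_trans _ (ks k))// leq_maxr.
by apply: Hn0; rewrite leq_maxl.
Qed.

End L2Space.

Section Conjugation.
Variable R : realType.
Implicit Types x y : R[i].

(* Inside products the notation [z^*] is read as [Num.conj z]. *)
Lemma conjCE x : Num.conj x = conjc x. Proof. by []. Qed.
Lemma conjcM x y : conjc (x * y) = conjc x * conjc y. Proof. exact: rmorphM. Qed.
Lemma conjcB x y : conjc (x - y) = conjc x - conjc y. Proof. exact: rmorphB. Qed.
Lemma conjcR (a : R) : conjc a%:C = a%:C :> R[i].
Proof. by rewrite /= oppr0. Qed.
Lemma RtoCM (a b : R) : (a * b)%:C = a%:C * b%:C :> R[i]. Proof. exact: rmorphM. Qed.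

End Conjugation.

(** * Step functions and their transforms *)

Section Circle.
Variable R : realType.
Implicit Types x y : R.

Lemma ecircD x y : ecirc (x + y) = ecirc x * ecirc y.
Proof.
rewrite /ecirc mulrDr cosD sinD; apply: eq_ReIm; rewrite ?Re_mul ?Im_mul /=; ring.
Qed.

Lemma ecirc0 : ecirc (0 : R) = 1.
Proof. by rewrite /ecirc mulr0 cos0 sin0 oppr0. Qed.

Lemma ecircN x : ecirc (- x) = (ecirc x)^*.
Proof. by rewrite /ecirc mulrN cosN sinN. Qed.

Lemma normc_ecirc x : Normc.normc (ecirc x) = 1.
Proof. by rewrite /= sqrrN cos2Dsin2 sqrtr1. Qed.

Lemma ecirc_neq0 x : ecirc x != 0.
Proof.
apply/eqP => x0; have := normc_ecirc x.
by rewrite x0 Normc.normc0 => /eqP; rewrite eq_sym oner_eq0.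
Qed.

Lemma ecirc1 : ecirc (1 : R) = 1.
Proof. by rewrite /ecirc mulr1 mulrC mulr_natr cos2pi sin2pi oppr0. Qed.

Lemma cmeas_ecirc : cmeas (@ecirc R).
Proof.
have m : measurable_fun setT (fun x : R => 2 * pi * x) by exact: mulrl_measurable.
split; rewrite /ecirc /=.
  apply: (measurableT_comp _ m); apply: continuous_measurable_fun.
  exact: continuous_cos.
apply: measurable_funN; apply: (measurableT_comp _ m).
by apply: continuous_measurable_fun; exact: continuous_sin.
Qed.

Lemma cmeas_ecircZ (a : R) : cmeas (fun x => ecirc (a * x)).
Proof.
have := cmeas_affine a 0 cmeas_ecirc.
by under [in X in X -> _]eq_fun do rewrite addr0.
Qed.

Lemma normr_sin_le x : `|sin x| <= `|x|.
Proof.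
wlog x0 : x / 0 <= x.
  move=> H; have [x0|x0] := leP 0 x; first exact: H.
  by have := H (- x); rewrite sinN !normrN; apply; rewrite oppr_ge0 ltW.
rewrite -(subr0 (sin x)) -sin0.
have [c _ ->] : exists2 c, c \in `[0, x] & sin x - sin 0 = cos c * (x - 0).
  apply: MVT_segment => //.
  by apply: continuous_subspaceT; exact: continuous_sin.
by rewrite subr0 normrM ler_piMl// cos_max.
Qed.

Lemma cos_ge x : 1 - x ^+ 2 / 2 <= cos x.
Proof.
have E : cos x = 1 - 2 * sin (x / 2) ^+ 2.
  rewrite {1}(_ : x = (x / 2) *+ 2); last by rewrite -mulr_natr divfK.
  by rewrite cos_mulr2n cos2sin2 mulr2n; ring.
have := normr_sin_le (x / 2).
rewrite -(ler_pXn2r (_ : 0 < 2)%N)// ?nnegrE// !real_normK ?num_real//.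
by rewrite E expr_div_n; lra.
Qed.

Lemma normc_ecirc_sub1 x : Normc.normc (ecirc x - 1) <= 2 * pi * `|x|.
Proof.
rewrite -(ler_pXn2r (_ : 0 < 2)%N)// ?nnegrE ?normc_ge0 ?mulr_ge0 ?pi_ge0//.
rewrite sqr_normc /= subr0 sqrrN exprMn real_normK ?num_real//.
have := cos_ge (2 * pi * x); have := cos2Dsin2 (2 * pi * x).
by rewrite exprMn; move: (cos _) (sin _) => c s; nra.
Qed.

Lemma normc_ecirc_sub x y : Normc.normc (ecirc x - ecirc y) <= 2 * pi * `|x - y|.
Proof.
rewrite -{1}(subrK y x) ecircD -[X in _ - X]mul1r -mulrBl Normc.normcM.
by rewrite normc_ecirc mulr1 normc_ecirc_sub1.
Qed.

End Circle.

(** * The kernel (1 - cos(2 pi t x)) / x^2 *)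

Section FejerKernel.
Variable R : realType.
Local Notation mu := (@lebesgue_measure R).

(** Up to a constant, the squared modulus of the Fourier transform of the indicator of an interval
    of length |t|. Its value at x = 0 is 0 by the convention on division. *)
Definition fejer (t x : R) : R := (1 - cos (2 * pi * (t * x))) / x ^+ 2.

Lemma fejer_ge0 t x : 0 <= fejer t x.
Proof. by rewrite divr_ge0 ?sqr_ge0// subr_ge0 cos_le1. Qed.

Lemma measurable_fejer t : measurable_fun setT (fejer t).
Proof.
apply: measurable_funM.
  apply: measurable_funB => //; have [+ _] := cmeas_ecircZ t.
  exact.
by apply: measurable_inv_sqr => [x|]; [exact: sqr_ge0|exact: exprn_measurable].
Qed.

Lemma integrable_oneDsqrV : mu.-integrable setT (fun x => ((1 + x ^+ 2)^-1)%:E).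
Proof.
have mo : measurable_fun setT (fun x : R => ((1 + x ^+ 2)^-1)%:E).
  apply/measurable_EFinP; apply: measurable_inv_sqr => [x|].
    by rewrite addr_ge0// sqr_ge0.
  by apply: measurable_funD => //; exact: exprn_measurable.
have ge0 x : 0 <= (1 + x ^+ 2)^-1 :> R by rewrite invr_ge0 addr_ge0// sqr_ge0.
have p : (\int[mu]_(x in `[0%R, +oo[) ((1 + x ^+ 2)^-1)%:E < +oo)%E.
  have := @integral0y_oneDsqr R; rewrite /oneDsqr => ->; exact: ltry.
apply/integrableP; split => //.
under eq_integral do rewrite gee0_abs ?lee_fin//.
rewrite ge0_symfun_integralT//.
- by rewrite -set_itvcy lte_mul_pinfty// ?integral_ge0// => x _; rewrite lee_fin.
- exact: continuous_oneDsqrV.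
- by move=> x /=; rewrite sqrrN.
Qed.

Lemma fejer_integrable t : mu.-integrable setT (EFin \o fejer t).
Proof.
(* The numerator is at most 2, which controls large x, and at most 2 (pi t x)^2, which controls
   small x. *)
apply: (@le_integrable _ _ _ mu setT measurableT _
  (fun x => (4 * (1 + (pi * t) ^+ 2))%:E * ((1 + x ^+ 2)^-1)%:E)%E).
- by apply/measurable_EFinP; exact: measurable_fejer.
- move=> x _; rewrite /= lee_fin ger0_norm ?fejer_ge0// ger0_norm; last first.
    by rewrite mulr_ge0 ?invr_ge0 ?mulr_ge0 ?addr_ge0 ?sqr_ge0.
  have [->|x0] := eqVneq x 0.
    by rewrite /fejer expr0n /= invr0 mulr0 addr0 invr1 mulr1 mulr_ge0// addr_ge0// sqr_ge0.
  have x2 : 0 < x ^+ 2 by rewrite lt0r sqrf_eq0 x0 sqr_ge0.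
  rewrite /fejer ler_pdivrMr// [leRHS]mulrAC ler_pdivlMr; last by rewrite ltr_wpDr ?sqr_ge0.
  have := cos_ge (2 * pi * (t * x)); have := cos_geN1 (2 * pi * (t * x)).
  have -> : (2 * pi * (t * x)) ^+ 2 = 4 * ((pi * t) ^+ 2 * x ^+ 2) by ring.
  have := sqr_ge0 (pi * t).
  by move: (cos _) ((pi * t) ^+ 2) (x ^+ 2) x2 => c a y y0 a0 H1 H2; nra.
- by apply: integrableZl => //; exact: integrable_oneDsqrV.
Qed.

Definition fejer_int : R := \int[mu]_x fejer 1 x.

Lemma fejer_int_gt0 : 0 < fejer_int.
Proof.
have fin := integrable_fin_num measurableT (fejer_integrable 1).
rewrite /fejer_int /Rintegral fine_gt0// ltey_eq fin andbT.
(* On [1/4, 3/4] the cosine is at most 0 and x^2 <= 1, so the kernel is at least 1 there. *)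
have e : (0 < mu `[(1/4)%R, (3/4)%R])%E.
  rewrite lebesgue_measure_itv /= lte_fin ifT; last by lra.
  by rewrite -EFinD lte_fin; lra.
rewrite (lt_le_trans e)//.
rewrite -[leLHS]mul1e -integral_cst//.
apply: (@le_trans _ _ (\int[mu]_(x in `[(1/4)%R, (3/4)%R]) (fejer 1 x)%:E)%E); last first.
  apply: ge0_subset_integral => //.
    by apply/measurable_EFinP; exact: measurable_fejer.
  by move=> x _; rewrite lee_fin fejer_ge0.
apply: ge0_le_integral => //.
- apply: measurable_funTS; apply/measurable_EFinP; exact: measurable_fejer.
- move=> x /=; rewrite in_itv /= => /andP[x1 x2]; rewrite lee_fin.
  have x0 : 0 < x by lra.
  rewrite /fejer ler_pdivlMr ?exprn_gt0// mul1r.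
  have : cos (2 * pi * (1 * x)) <= 0.
    have -> : 2 * pi * (1 * x) = (2 * pi * x - pi) + pi by ring.
    rewrite cosDpi oppr_le0; apply: cos_ge0_pihalf.
    by have := @pi_gt0 R => ?; apply/andP; split; nra.
  have : x ^+ 2 <= 1 by nra.
  by rewrite !mul1r; lra.
Qed.

Lemma integral_fejer t : \int[mu]_x fejer t x = `|t| * fejer_int.
Proof.
have [->|t0] := eqVneq t 0.
  rewrite normr0 mul0r /Rintegral (_ : (\int[mu]_x _)%E = 0%E)//.
  by apply: integral0_eq => x _; rewrite /fejer mul0r mulr0 cos0 subrr mul0r.
rewrite /fejer_int (Rintegral_affine 0 t0 (fejer_integrable 1)) mulrA.
have -> : (fun x => fejer 1 (t * x + 0)) = (fun x => (t ^+ 2)^-1 * fejer t x).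
  apply/funext => x; rewrite /fejer addr0 mul1r exprMn invfM; ring.
rewrite RintegralZl//; last exact: fejer_integrable.
by rewrite -expr2 real_normK ?num_real// mulrA divff ?mul1r// sqrf_eq0.
Qed.

End FejerKernel.

(** * Indicators of intervals and their transforms *)

Section Families.
Variables (R : realType) (p : nat).
Local Notation mu := (@lebesgue_measure R).
Local Notation cI u := (cintegral mu setT u).
Local Notation l2vect := (l2vect R p).

(* (j, (a, d)) stands for the interval ]a, a + |d|] in the j-th copy of R. *)
Local Notation idx := ('I_p * (R * R))%type.

Definition itv_ind (a b x : R) : R[i] := (if (a < x) && (x <= b) then 1 else 0).

(** This is i times the Fourier transform of [itv_ind a b], the square root being 2 pi. In the
    proofs this normalisation enters only through [integral_fejer], which gives both families the
    same Gram matrix. *)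
Definition itv_hat (a b x : R) : R[i] :=
  (Num.sqrt (2 * fejer_int R))^-1%:C * ((ecirc (a * x) - ecirc (b * x)) * (x^-1)%:C).

Definition at_comp (j : 'I_p) (u : R -> R[i]) : vect R p :=
  fun x i => if i == j then u x else 0.

Lemma L2_at_comp j u : cL2 u -> L2 (at_comp j u).
Proof. by move=> u2 i; rewrite /at_comp; case: (i == j) => //; exact: cL2_0. Qed.

Lemma conj_itv_ind a b x : (itv_ind a b x)^* = itv_ind a b x.
Proof. by rewrite /itv_ind; case: ifP; rewrite ?conjc1 ?conjc0. Qed.

Lemma itv_ind_mul a b c d x :
  itv_ind a b x * itv_ind c d x = itv_ind (Num.max a c) (Num.min b d) x.
Proof.
rewrite /itv_ind gt_max le_min.
by case: (a < x); case: (c < x); case: (x <= b); case: (x <= d);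
  rewrite /= ?mulr0 ?mul0r ?mulr1.
Qed.

Lemma itv_indE a b : itv_ind a b = (fun x => (\1_`]a, b] x)%:C).
Proof.
apply/funext => x; rewrite /itv_ind indicE mem_setE in_itv /=.
by case: ifP.
Qed.

Lemma cL2_itv_ind a b : cL2 (itv_ind a b).
Proof.
rewrite itv_indE; apply/cL2P; split.
  by apply: cmeas_real; exact: measurable_indic.
rewrite (_ : (fun x => _) = (fun x => (\1_`]a, b] x)%:E)); last first.
  apply/funext => x; rewrite normc_real indicE.
  by case: (x \in _); rewrite ?normr1 ?normr0 ?expr1n ?expr0n.
exact: integrable_indic_itv.
Qed.

Lemma re_ecirc (x : R) : complex.Re (ecirc x) = cos (2 * pi * x).
Proof. by []. Qed.

Lemma im_ecirc (x : R) : complex.Im (ecirc x) = - sin (2 * pi * x).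
Proof. by []. Qed.

Lemma cmeas_itv_hat a b : cmeas (itv_hat a b).
Proof.
apply: cmeasM; first exact: cmeas_cst.
apply: cmeasM.
  have := cmeasD (cmeas_ecircZ a) (cmeasM (cmeas_cst (-1)) (cmeas_ecircZ b)).
  by under [in X in X -> _]eq_fun do rewrite mulN1r.
apply: cmeas_real.
rewrite (_ : @GRing.inv R = (fun x => x * (x ^+ 2)^-1)).
  apply: measurable_funM => //; apply: measurable_inv_sqr => [x|].
    exact: sqr_ge0.
  exact: exprn_measurable.
apply/funext => x; have [->|x0] := eqVneq x 0; first by rewrite invr0 mul0r.
by rewrite expr2 invfM mulrA divff// mul1r.
Qed.

Lemma itv_hat_prod a b c d x :
  itv_hat a b x * (itv_hat c d x)^* =
  ((2 * fejer_int R)^-1 * (x ^+ 2)^-1)%:C *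
  (ecirc ((a - c) * x) - ecirc ((a - d) * x) - ecirc ((b - c) * x) + ecirc ((b - d) * x)).
Proof.
rewrite /itv_hat.
have k2 : (Num.sqrt (2 * fejer_int R))^-1 * (Num.sqrt (2 * fejer_int R))^-1 =
    (2 * fejer_int R)^-1.
  by rewrite -invfM -expr2 sqr_sqrtr// mulr_ge0// ltW// fejer_int_gt0.
have x2 : (x ^+ 2)^-1 = x^-1 * x^-1 by rewrite expr2 invfM.
rewrite conjCE -k2 x2 !mulrBl !ecircD !ecircN !RtoCM !(conjcM, conjcB) !conjcR.
ring.
Qed.

Lemma cL2_itv_hat a b : cL2 (itv_hat a b).
Proof.
apply: (@cL2_dom _ _ (fun x => (2 * fejer_int R)^-1 * 2 * fejer (a - b) x)).
- exact: cmeas_itv_hat.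
- rewrite (_ : _ \o _ = (fun x => ((2 * fejer_int R)^-1 * 2)%:E * (fejer (a - b) x)%:E))%E//.
  by apply: integrableZl => //; exact: fejer_integrable.
- move=> x; rewrite -[leLHS]/(complex.Re (Normc.normc (itv_hat a b x) ^+ 2)%:C) -mulcJ.
  rewrite itv_hat_prod !subrr !mul0r ecirc0 -(opprB a b) mulNr ecircN Re_mul /=.
  by rewrite mul0r subr0 /fejer le_eqVlt; apply/orP; left; apply/eqP; ring.
Qed.

Definition step_fam (i : idx) : l2vect :=
  mkl2 (L2_at_comp i.1 (cL2_itv_ind i.2.1 (i.2.1 + `|i.2.2|))).

Definition hat_fam (i : idx) : l2vect :=
  mkl2 (L2_at_comp i.1 (cL2_itv_hat i.2.1 (i.2.1 + `|i.2.2|))).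

Lemma l2dot_at_comp (f : l2vect) (g : l2vect) j u :
  l2fun g = at_comp j u -> cL2 u ->
  l2dot f g = cI (fun x => f x j * (u x)^*).
Proof.
move=> gE u2; rewrite /l2dot /dot (bigD1 j)//= big1 ?addr0.
  by congr cintegral; apply/funext => x; rewrite gE /at_comp eqxx.
move=> i ij; rewrite -[RHS](@cintegral0 R); congr cintegral; apply/funext => x.
have -> : g x i = 0 by rewrite gE /at_comp (negbTE ij).
by rewrite conjCE conjc0 mulr0.
Qed.

Lemma Rintegral_indic_itv (a b : R) :
  \int[mu]_x \1_`]a, b] x = Num.max 0 (b - a).
Proof.
have E : (\int[mu]_x (\1_`]a, b] x)%:E = mu `]a, b])%E by rewrite integral_indic// setIT.
rewrite /Rintegral E lebesgue_measure_itv /= lte_fin.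
have [ab|ba] := ltP a b; first by rewrite /= max_r// subr_ge0 ltW.
by rewrite max_l// subr_le0.
Qed.

(** The length of the overlap, written through the distances between endpoints because the
    transforms produce integrals of [fejer], which are proportional to exactly these distances. *)
Lemma cintegral_itv_ind_prod a b c d : a <= b -> c <= d ->
  cI (fun x => itv_ind a b x * (itv_ind c d x)^*) =
  ((`|a - d| + `|b - c| - `|a - c| - `|b - d|) / 2)%:C.
Proof.
move=> ab cd.
have -> : (fun x => itv_ind a b x * (itv_ind c d x)^*) =
    itv_ind (Num.max a c) (Num.min b d).
  by apply/funext => x; rewrite conjCE conj_itv_ind itv_ind_mul.
rewrite itv_indE; apply: eq_ReIm; last by rewrite /= /Rintegral integral0_eq.
rewrite /= Rintegral_indic_itv.
case: (leP b d) => bd; case: (leP a c) => ac.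
- rewrite (ler0_norm (_ : a - d <= 0)) ?(ler0_norm (_ : a - c <= 0)) ?(ler0_norm (_ : b - d <= 0));
    [|lra..].
  by have [H|H] := leP 0 (b - c); [rewrite ger0_norm//|rewrite ltr0_norm//]; lra.
- rewrite (ler0_norm (_ : a - d <= 0)) ?(gtr0_norm (_ : 0 < a - c)) ?(ler0_norm (_ : b - d <= 0));
    [|lra..].
  by rewrite max_r ?(ger0_norm (_ : 0 <= b - c)); lra.
- rewrite (ler0_norm (_ : a - d <= 0)) ?(ler0_norm (_ : a - c <= 0)) ?(gtr0_norm (_ : 0 < b - d));
    [|lra..].
  by rewrite max_r ?(ger0_norm (_ : 0 <= b - c)); lra.
- rewrite (ger0_norm (_ : 0 <= b - c)) ?(gtr0_norm (_ : 0 < a - c)) ?(gtr0_norm (_ : 0 < b - d));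
    [|lra..].
  by have [H|H] := leP 0 (d - a); [rewrite (ler0_norm (_ : a - d <= 0))|rewrite (gtr0_norm (_ : 0 < a - d))]; lra.
Qed.

Lemma Rintegral_odd (h : R -> R) : mu.-integrable setT (EFin \o h) ->
  (forall x, h (- x) = - h x) -> \int[mu]_x h x = 0.
Proof.
move=> ih hN; have := Rintegral_affine 0 (_ : -1 != 0 :> R) ih.
rewrite oppr_eq0 oner_eq0 => /(_ isT).
rewrite normrN1 mul1r.
under [X in _ = X -> _]eq_Rintegral do rewrite addr0 mulN1r hN -mulN1r.
by rewrite RintegralZl// mulN1r; lra.
Qed.

Lemma cintegral_itv_hat_prod a b c d :
  cI (fun x => itv_hat a b x * (itv_hat c d x)^*) =
  ((`|a - d| + `|b - c| - `|a - c| - `|b - d|) / 2)%:C.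
Proof.
have [iR iI] := cL2_integrable (cL2_itv_hat a b) (cL2_itv_hat c d).
(* The imaginary part of the product is odd in x and integrates to 0; the real part is a combination
   of four kernels [fejer]. *)
apply: eq_ReIm; last first.
  apply: (@Rintegral_odd (fun x => complex.Im (itv_hat a b x * (itv_hat c d x)^*))) => [//|x]; rewrite !itv_hat_prod !Im_mul /=.
  rewrite sqrrN !mulrN !sinN; ring.
transitivity ((2 * fejer_int R)^-1 * ((\int[mu]_x fejer (a - d) x + \int[mu]_x fejer (b - c) x)
   - (\int[mu]_x fejer (a - c) x + \int[mu]_x fejer (b - d) x))); last first.
  rewrite !integral_fejer /=; have := fejer_int_gt0 R.
  by move=> H; field; rewrite gt_eqF.
have fD s t : mu.-integrable setT (EFin \o (fun x => fejer s x + fejer t x)).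
  rewrite (_ : _ \o _ = (EFin \o fejer s) \+ (EFin \o fejer t))%E//.
  by apply: integrableD => //; exact: fejer_integrable.
rewrite -RintegralD//; [|exact: fejer_integrable..].
rewrite -RintegralD//; [|exact: fejer_integrable..].
rewrite -RintegralB// -RintegralZl//; last first.
  rewrite (_ : _ \o _ = (EFin \o (fun x => (fejer (a - d) x + fejer (b - c) x)%R)) \-
     (EFin \o (fun x => (fejer (a - c) x + fejer (b - d) x)%R)))%E//.
  exact: integrableB.
apply: eq_Rintegral => x _; rewrite itv_hat_prod Re_mul /= mul0r subr0 /fejer.
ring.
Qed.

Lemma step_hat_gram i k : l2dot (step_fam i) (step_fam k) = l2dot (hat_fam i) (hat_fam k).
Proof.
rewrite (l2dot_at_comp _ (erefl (l2fun (step_fam k)))); last exact: cL2_itv_ind.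
rewrite (l2dot_at_comp _ (erefl (l2fun (hat_fam k)))); last exact: cL2_itv_hat.
rewrite /step_fam /hat_fam /= /at_comp; have [_|ik] := eqVneq k.1 i.1.
  by rewrite cintegral_itv_ind_prod ?lerDl// cintegral_itv_hat_prod.
by congr cintegral; apply/funext => x; rewrite !mul0r.
Qed.

Lemma step_total : total_family (@l2dot R p) step_fam.
Proof.
move=> f f0; rewrite -[f]subr0; apply/nrm_aeeq => j.
have [m1 m2] := cL2_meas (l2P f j).
(* Cutting off to ]-n, n] makes the square integrable f integrable, as [ae_eq0_of_itv] requires. *)
have key (n : nat) : {ae mu, forall x, - n%:R < x <= n%:R -> f x j = 0}.
  have fi : cintegrable (fun x => f x j * (itv_ind (- n%:R) n%:R x)^*).
    by apply: cL2_integrable; [exact: l2P|exact: cL2_itv_ind].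
  have int0 a b : cI (fun x => f x j * (itv_ind a b x)^*) = 0.
    have [ab|ba] := leP a b.
      have := f0 (j, (a, b - a)).
      rewrite (l2dot_at_comp _ (erefl (l2fun (step_fam _)))); last exact: cL2_itv_ind.
      by rewrite /= ger0_norm ?subr_ge0// addrC subrK.
    rewrite -[RHS](@cintegral0 R); congr cintegral; apply/funext => x.
    rewrite /itv_ind; case: ifP; last by rewrite conjCE conjc0 mulr0.
    by move=> /andP[] /lt_le_trans /[apply]; rewrite ltNge ltW.
  have HRe : {ae mu, forall x, complex.Re (f x j * (itv_ind (- n%:R) n%:R x)^*) = 0}.
    apply: ae_eq0_of_itv; first by case: fi.
    move=> a b ab; have /(congr1 (@complex.Re R)) /= := int0 (Num.max a (- n%:R)) (Num.min b n%:R).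
    move=> H0; rewrite -[RHS]H0 Rintegral_mkcond; apply: eq_Rintegral => x _.
    rewrite patchE mem_setE in_itv /= -itv_ind_mul /itv_ind.
    by case: ifP => _; rewrite ?mul1r// mul0r conjCE conjc0 mulr0.
  have HIm : {ae mu, forall x, complex.Im (f x j * (itv_ind (- n%:R) n%:R x)^*) = 0}.
    apply: ae_eq0_of_itv; first by case: fi.
    move=> a b ab; have /(congr1 (@complex.Im R)) /= := int0 (Num.max a (- n%:R)) (Num.min b n%:R).
    move=> H0; rewrite -[RHS]H0 Rintegral_mkcond; apply: eq_Rintegral => x _.
    rewrite patchE mem_setE in_itv /= -itv_ind_mul /itv_ind.
    by case: ifP => _; rewrite ?mul1r// mul0r conjCE conjc0 mulr0.
  have := ae_conj HRe HIm; apply: ae_impl => x [] E1 E2 Hx.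
  have := eq_ReIm (E1 : _ = complex.Re 0) (E2 : _ = complex.Im 0).
  by rewrite /itv_ind Hx conjCE conjc1 mulr1.
have /ae_foralln := key; apply: ae_impl => x Hx.
have := archi_boundP (normr_ge0 x); set n := Num.bound _ => xn.
apply: (Hx n); rewrite (le_trans (ler_norm x) (ltW xn)) andbT ltrNl.
by rewrite (le_lt_trans _ xn)// -normrN ler_norm.
Qed.

End Families.

(** * Uniqueness for Fourier coefficients *)

Section StepPolynomials.
Variable R : realType.

Lemma bernoulli_ineq (x : R) n : -1 <= x -> 1 + n%:R * x <= (1 + x) ^+ n.
Proof.
move=> x1; elim: n => [|n IH]; first by rewrite expr0 mul0r addr0.
rewrite exprS (le_trans _ (ler_wpM2l _ IH)) ?subr_ge0//; last by lra.
by rewrite -natr1; have : 0 <= n%:R :> R by []; have := sqr_ge0 x; nra.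
Qed.

Lemma cvg_natM_geometric (r : R) : 0 <= r < 1 ->
  (fun n => n%:R * r ^+ n) @ \oo --> (0 : R).
Proof.
move=> /andP[r0 r1].
have [->|rn0] := eqVneq r 0.
  have -> : (fun n => n%:R * 0 ^+ n) = cst (0 : R).
    by apply/funext => -[|n] /=; rewrite ?mul0r// expr0n mulr0.
  exact: cvg_cst.
have r_gt0 : 0 < r by rewrite lt0r rn0.
(* Half of the decay is spent on n: by Bernoulli's inequality n q^n is bounded, and the remaining
   factor q^n tends to 0. *)
pose q := Num.sqrt r.
have q0 : 0 < q by rewrite sqrtr_gt0.
have q1 : q < 1 by rewrite -sqrtr1 ltr_sqrt.
have qr : q * q = r by rewrite -expr2 sqr_sqrtr.
have iq : 0 < q^-1 - 1 by rewrite subr_gt0 invf_gt1.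
have b n : n%:R * q ^+ n <= (q^-1 - 1)^-1.
  have := @bernoulli_ineq (q^-1 - 1) n; rewrite [1 + (_ - 1)]addrC subrK => H.
  have {}H : 1 + n%:R * (q^-1 - 1) <= q^-1 ^+ n by apply: H; lra.
  rewrite -[leRHS]mul1r ler_pdivlMr//.
  have := ler_wpM2r (exprn_ge0 n (ltW q0)) H.
  rewrite -exprMn mulVf ?gt_eqF// expr1n mulrDl mul1r.
  by have := exprn_ge0 n (ltW q0); lra.
apply: (@squeeze_cvgr _ _ _ _ (cst 0) (fun n => (q^-1 - 1)^-1 * q ^+ n)).
- apply: nearW => n; rewrite mulr_ge0 ?exprn_ge0//=.
  by rewrite -qr exprMn mulrA ler_wpM2r ?exprn_ge0// ltW.
- exact: cvg_cst.
- rewrite -[X in _ --> X](mulr0 (q^-1 - 1)^-1); apply: cvgM; first exact: cvg_cst.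
  by apply: cvg_expr; rewrite ger0_norm// ltW.
Qed.

(* The exponents are tuned so that the limit is 0 also at s = 1/2. *)
Definition step_poly n (s : R) := (1 - s ^+ n) ^+ (n * 2 ^ n).

Lemma step_poly_ge0 n s : 0 <= s <= 1 -> 0 <= step_poly n s.
Proof. by move=> /andP[s0 s1]; rewrite exprn_ge0// subr_ge0 exprn_ile1. Qed.

Lemma step_poly_le1 n s : 0 <= s <= 1 -> step_poly n s <= 1.
Proof.
move=> /andP[s0 s1]; rewrite exprn_ile1// ?subr_ge0 ?exprn_ile1//.
by rewrite gerBl exprn_ge0.
Qed.

(** Bernoulli's inequality twice, with K = n 2^n. If s < 1/2 then (1 - s^n)^K >= 1 - n (2 s)^n. If s
    >= 1/2 then (1 - s^n)^K (1 + s^n)^K <= 1, while (1 + s^n)^K >= 1 + n (2 s)^n >= n + 1. *)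
Lemma cvg_step_poly s : 0 <= s <= 1 ->
  (fun n => step_poly n s) @ \oo --> (if s < 2^-1 then 1 else 0 : R).
Proof.
move=> s01; have /andP[s0 s1] := s01; case: ltP => s2.
  apply: (@squeeze_cvgr _ _ _ _ (fun n => 1 - n%:R * (2 * s) ^+ n) (cst 1)).
  - apply: nearW => n; rewrite step_poly_le1// andbT.
    have := @bernoulli_ineq (- s ^+ n) (n * 2 ^ n).
    rewrite lerN2 exprn_ile1// => /(_ isT); apply: le_trans.
    by rewrite exprMn natrM natrX mulrN mulrA.
  - rewrite -[X in _ --> X]subr0; apply: cvgB; first exact: cvg_cst.
    by apply: cvg_natM_geometric; apply/andP; split; lra.
  - exact: cvg_cst.
apply: (@squeeze_cvgr _ _ _ _ (cst 0) (fun n => n.+1%:R^-1)).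
- apply: nearW => n; rewrite step_poly_ge0//=.
  rewrite -[leRHS]mul1r ler_pdivlMr//.
  have t0 : 0 <= s ^+ n by rewrite exprn_ge0.
  have t1 : s ^+ n <= 1 by rewrite exprn_ile1.
  have H : n.+1%:R <= (1 + s ^+ n) ^+ (n * 2 ^ n).
    apply: le_trans (bernoulli_ineq _ _); last by lra.
    rewrite -natr1 addrC lerD2l natrM natrX -mulrA -exprMn -[leLHS]mulr1.
    by rewrite ler_wpM2l// exprn_ege1//; lra.
  have := ler_wpM2l (step_poly_ge0 n s01) H.
  move/le_trans; apply; rewrite -exprMn exprn_ile1//.
    by rewrite mulr_ge0 ?subr_ge0// addr_ge0.
  by nra.
- exact: cvg_cst.
- by have := @cvg_harmonic R.
Qed.

End StepPolynomials.

Section RealDCT.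
Variable R : realType.
Local Notation mu := (@lebesgue_measure R).

Lemma cvg_Rintegral_mul (g : R -> R) (f_ : nat -> R -> R) (f : R -> R) :
  mu.-integrable setT (EFin \o g) ->
  (forall n, measurable_fun setT (f_ n)) ->
  (forall n x, `|f_ n x| <= 1) ->
  (forall x, (fun n => f_ n x) @ \oo --> f x) ->
  (fun n => \int[mu]_x (g x * f_ n x)) @ \oo --> \int[mu]_x (g x * f x).
Proof.
move=> ig mf_ f1 fcv.
have mg : measurable_fun setT g by apply/measurable_EFinP; exact: measurable_int ig.
have mf : measurable_fun setT f.
  by apply: (@measurable_fun_cvg _ _ _ _ f_) => // x _; exact: fcv.
have [||||| i1 _ cv] := @dominated_convergence _ _ _ mu setT measurableT
  (fun n x => (g x * f_ n x)%:E) (fun x => (g x * f x)%:E) (fun x => `|(g x)%:E|)%E.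
- by move=> n; apply/measurable_EFinP; exact: (measurable_funM mg (mf_ n)).
- by apply/measurable_EFinP; exact: (measurable_funM mg mf).
- apply: aeW => x _; apply/fine_cvgP; split; first exact: nearW.
  by apply: cvgM; [exact: cvg_cst|exact: fcv].
- exact: integrable_abse.
- apply: aeW => x n _ /=; rewrite lee_fin normrM.
  by rewrite ler_piMr.
- apply: fine_cvg; rewrite fineK//; exact: integrable_fin_num.
Qed.

Lemma cvg_sum_ord p (F : 'I_p -> nat -> R) (l : 'I_p -> R) :
  (forall j, F j @ \oo --> l j) ->
  (fun n => \sum_(j < p) F j n) @ \oo --> \sum_(j < p) l j.
Proof.
move=> Fl; elim: (index_enum _) => [|j s IH].
  rewrite big_nil (_ : (fun n => _) = cst 0); first exact: cvg_cst.
  by apply/funext => n; rewrite big_nil.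
rewrite big_cons (_ : (fun n => _) = (fun n => F j n + \sum_(i <- s) F i n)).
  by apply: cvgD => //; exact: Fl.
by apply/funext => n; rewrite big_cons.
Qed.

End RealDCT.

Section FourierUniqueness.
Variables (R : realType) (p : nat) (h : 'I_p -> R -> R[i]).
Local Notation mu := (@lebesgue_measure R).
Local Notation cI u := (cintegral mu setT u).
Hypothesis hi : forall j, cintegrable (h j).

Definition annihilated (f : R -> 'I_p -> R[i]) : Prop :=
  \sum_(j < p) cI (fun x => h j x * f x j) = 0.

(** By dominated convergence, the test functions killed by [h] are closed under bounded pointwise
    limits. This leads from trigonometric polynomials to indicators. *)
Lemma annihilated_lim (f_ : nat -> R -> 'I_p -> R) (f : R -> 'I_p -> R) :
  (forall n j, measurable_fun setT (f_ n ^~ j)) ->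
  (forall n x j, `|f_ n x j| <= 1) ->
  (forall x j, (fun n => f_ n x j) @ \oo --> f x j) ->
  (forall n, annihilated (fun x j => (f_ n x j)%:C)) ->
  annihilated (fun x j => (f x j)%:C).
Proof.
move=> mf f1 fcv An.
have cvs (g : 'I_p -> R -> R) : (forall j, mu.-integrable setT (EFin \o g j)) ->
    (forall n, \sum_(j < p) \int[mu]_x (g j x * f_ n x j) = 0) ->
    \sum_(j < p) \int[mu]_x (g j x * f x j) = 0.
  move=> ig g0; apply/esym.
  have cv : (fun n => \sum_(j < p) \int[mu]_x (g j x * f_ n x j)) @ \oo -->
      \sum_(j < p) \int[mu]_x (g j x * f x j).
    apply: (@cvg_sum_ord R p (fun j n => \int[mu]_x (g j x * f_ n x j))) => j.
    by apply: (@cvg_Rintegral_mul R (g j) (fun n x => f_ n x j) (fun x => f x j)) => //; exact: ig.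
  have cv0 : (fun n => \sum_(j < p) \int[mu]_x (g j x * f_ n x j)) @ \oo --> (0 : R).
    by rewrite (_ : (fun n => _) = cst 0); [exact: cvg_cst|apply/funext => n; exact: g0].
  exact: (cvg_unique _ cv0 cv).
have Re_sum (F : 'I_p -> R[i]) : complex.Re (\sum_j F j) = \sum_j complex.Re (F j).
  by rewrite raddf_sum.
have Im_sum (F : 'I_p -> R[i]) : complex.Im (\sum_j F j) = \sum_j complex.Im (F j).
  by rewrite raddf_sum.
apply: eq_ReIm; rewrite ?Re_sum ?Im_sum /=.
- transitivity (\sum_(j < p) \int[mu]_x (complex.Re (h j x) * f x j)).
    apply: eq_bigr => j _; apply: eq_Rintegral => x _.
    by rewrite Re_mul /= mulr0 subr0.
  apply: cvs => [j|n]; first by case: (hi j).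
  have /(congr1 (@complex.Re R)) := An n; rewrite Re_sum /= => {2}<-.
  apply: eq_bigr => j _; apply: eq_Rintegral => x _.
  by rewrite Re_mul /= mulr0 subr0.
- transitivity (\sum_(j < p) \int[mu]_x (complex.Im (h j x) * f x j)).
    apply: eq_bigr => j _; apply: eq_Rintegral => x _.
    by rewrite Im_mul /= mulr0 add0r.
  apply: cvs => [j|n]; first by case: (hi j).
  have /(congr1 (@complex.Im R)) := An n; rewrite Im_sum /= => {2}<-.
  apply: eq_bigr => j _; apply: eq_Rintegral => x _.
  by rewrite Im_mul /= mulr0 add0r.
Qed.

Section TrigPoly.
Variable w : R -> 'I_p -> R[i].
Hypothesis w1 : forall x j, Normc.normc (w x j) = 1.
Hypothesis mw : forall j, cmeas (w ^~ j).

Lemma unit_neq0 x j : w x j != 0.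
Proof. by apply/eqP => w0; have := w1 x j; rewrite w0 Normc.normc0 => /eqP; rewrite eq_sym oner_eq0. Qed.

Definition trig_poly (f : R -> 'I_p -> R[i]) : Prop :=
  exists s : seq (R[i] * int), forall x j, f x j = \sum_(c <- s) c.1 * w x j ^ c.2.

Lemma trig_poly_cst a : trig_poly (fun _ _ => a).
Proof. by exists [:: (a, 0)] => x j; rewrite big_seq1 expr0z mulr1. Qed.

Lemma trig_poly_monomial a l : trig_poly (fun x j => a * w x j ^ l).
Proof. by exists [:: (a, l)] => x j; rewrite big_seq1. Qed.

Lemma trig_polyD f g : trig_poly f -> trig_poly g ->
  trig_poly (fun x j => f x j + g x j).
Proof.
by move=> [s sE] [t tE]; exists (s ++ t) => x j; rewrite big_cat sE tE.
Qed.

Lemma trig_polyM f g : trig_poly f -> trig_poly g ->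
  trig_poly (fun x j => f x j * g x j).
Proof.
move=> [s sE] [t tE].
exists [seq (a.1 * b.1, a.2 + b.2) | a <- s, b <- t] => x j.
rewrite big_flatten /= big_map sE tE mulr_suml; apply: eq_bigr => a _.
rewrite big_map mulr_sumr; apply: eq_bigr => b _ /=.
by rewrite expfzDr ?unit_neq0//; ring.
Qed.

Lemma trig_polyX f n : trig_poly f -> trig_poly (fun x j => f x j ^+ n).
Proof.
move=> tf; elim: n => [|n IH]; first exact: trig_poly_cst.
have := trig_polyM tf IH; rewrite /trig_poly => -[s sE]; exists s => x j.
by rewrite exprS.
Qed.

Lemma cmeas_exp (u : R -> R[i]) n : cmeas u -> cmeas (fun x => u x ^+ n).
Proof.
move=> mu_; elim: n => [|n IH]; first exact: cmeas_cst.
by under eq_fun do rewrite exprS; exact: cmeasM.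
Qed.

Lemma normc_exp (z : R[i]) n : Normc.normc (z ^+ n) = Normc.normc z ^+ n.
Proof. by elim: n => [|n IH]; [rewrite Normc.normc1|rewrite !exprS Normc.normcM IH]. Qed.

Lemma cmeas_monomial l j : cmeas (fun x => w x j ^ l).
Proof.
case: l => n; first exact: cmeas_exp.
by apply: cmeasV; exact: cmeas_exp.
Qed.

Lemma normc_monomial l x j : Normc.normc (w x j ^ l) = 1.
Proof.
by case: l => n; rewrite /exprz ?Normc.normcV normc_exp w1 expr1n ?invr1.
Qed.

Lemma trig_poly_annihilated f : (forall l : int, annihilated (fun x j => w x j ^ l)) ->
  trig_poly f -> annihilated f.
Proof.
move=> aw [s sE].
have im l j : cintegrable (fun x => h j x * w x j ^ l).
  apply: (cintegrable_mulb (C := 1)) => //; first exact: cmeas_monomial.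
  by move=> x; rewrite normc_monomial.
have key j : cintegrable (fun x => h j x * \sum_(c <- s) c.1 * w x j ^ c.2) /\
   cI (fun x => h j x * \sum_(c <- s) c.1 * w x j ^ c.2) =
   \sum_(c <- s) c.1 * cI (fun x => h j x * w x j ^ c.2).
  elim: s {sE} => [|c s [IH1 IH2]].
    under eq_fun do rewrite big_nil mulr0; rewrite big_nil cintegral0; split => //.
    by split; exact: integrable0.
  have E : (fun x => h j x * \sum_(d <- c :: s) d.1 * w x j ^ d.2) =
      (fun x => c.1 * (h j x * w x j ^ c.2) + h j x * \sum_(d <- s) d.1 * w x j ^ d.2).
    by apply/funext => x; rewrite big_cons mulrDr mulrCA.
  rewrite E big_cons -IH2 cintegral_lin//; split => //.
  exact: cintegrable_lin.
rewrite /annihilated.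
transitivity (\sum_(j < p) \sum_(c <- s) c.1 * cI (fun x => h j x * w x j ^ c.2)).
  apply: eq_bigr => j _; case: (key j) => _ <-.
  by congr cintegral; apply/funext => x; rewrite sE.
rewrite exchange_big /= big1// => c _; rewrite -mulr_sumr.
by have := aw c.2; rewrite /annihilated => ->; rewrite mulr0.
Qed.

End TrigPoly.

(** Two limits enlarge the test functions: for fixed n, the polynomials [step_poly] in a
    trigonometric polynomial tend to the indicator of an arc; as L n grows, these arcs tend to the
    indicator of an interval in one copy, because the other copies are centred elsewhere on the
    circle. *)
Lemma fourier_unique (zeta : 'I_p -> R[i]) (L : nat -> R) :
  (forall j, Normc.normc (zeta j) = 1) -> injective zeta ->
  (forall n, 0 < L n) -> (forall A, exists n0, forall n, (n0 <= n)%N -> A <= L n) ->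
  (forall n (l : int), annihilated (fun x j => (ecirc (x / L n) * zeta j) ^ l)) ->
  forall j, {ae mu, forall x, h j x = 0}.
Proof.
move=> z1 zinj L0 Loo aw j0.
pose w n x j := ecirc (x / L n) * zeta j.
have w1 n x j : Normc.normc (w n x j) = 1.
  by rewrite /w Normc.normcM normc_ecirc mul1r z1.
have mw n j : cmeas (w n ^~ j).
  apply: cmeasM; last exact: cmeas_cst.
  have := @cmeas_ecircZ R (L n)^-1.
  by under [in X in X -> _]eq_fun do rewrite mulrC.
have main (c d : R) : 0 < d ->
    annihilated (fun x j => (if (j == j0) && (`|x - c| < d) then 1 else 0 : R)%:C).
  move=> d0.
  (* [s n x j < 1/2] says that w is within angle 2 pi d / L n of its value at
     (c, j0); as L n grows these sets converge to ]c - d, c + d[ x {j0}. *)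
  pose al n := conjc (zeta j0 * ecirc (c / L n)).
  pose s n x j : R := 2^-1 + (cos (2 * pi * (d / L n)) - complex.Re (al n * w n x j)) / 4.
  have al1 n : Normc.normc (al n) = 1.
    by rewrite /al normcJ Normc.normcM normc_ecirc z1 mul1r.
  have Re1 n x j : `|complex.Re (al n * w n x j)| <= 1.
    by rewrite (le_trans (normr_Re_le _))// Normc.normcM w1 al1 mul1r.
  have s01 n x j : 0 <= s n x j <= 1.
    have := Re1 n x j; rewrite ler_norml => /andP[H1 H2].
    have H3 := cos_geN1 (2 * pi * (d / L n)); have H4 := cos_le1 (2 * pi * (d / L n)).
    by rewrite /s; move: (complex.Re _) (cos _) H1 H2 H3 H4 => a b *; lra.
  have ms n j : measurable_fun setT (fun x => s n x j).
    apply: measurable_funD => //; apply: measurable_funM => //.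
    apply: measurable_funB => //.
    by have [] := cmeasM (cmeas_cst (al n)) (mw n j).
  (* On the unit circle Re(al w) = (al w + conj(al) w^-1) / 2, a trigonometric polynomial in w. *)
  have ts n : trig_poly (w n) (fun x j => (s n x j)%:C).
    have -> : (fun x j => (s n x j)%:C) = (fun x j => (2^-1 + cos (2 * pi * (d / L n)) / 4)%:C +
        ((- (8^-1)%:C * al n) * w n x j ^ 1 + (- (8^-1)%:C * conjc (al n)) * w n x j ^ (-1))).
      apply/funext => x; apply/funext => j; rewrite expr1z exprN1.
      have -> : (w n x j)^-1 = conjc (w n x j).
        have := mulcJ (w n x j); rewrite w1 expr1n => E.
        by apply: (mulfI (unit_neq0 (w1 n) x j)); rewrite mulfV ?(unit_neq0 (w1 n))// E.
      rewrite /s; move: (cos _) (al n) (w n x j) => C [a1 a2] [b1 b2].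
      apply: eq_ReIm; rewrite ?Re_add ?Im_add ?Re_mul ?Im_mul /=; lra.
    apply: trig_polyD; first exact: trig_poly_cst.
    by apply: trig_polyD; exact: trig_poly_monomial.
  have tq n k : trig_poly (w n) (fun x j => (step_poly k (s n x j))%:C).
    have -> : (fun x j => (step_poly k (s n x j))%:C) =
        (fun x j => (1 + (-1) * (s n x j)%:C ^+ k) ^+ (k * 2 ^ k)).
      apply/funext => x; apply/funext => j.
      by rewrite /step_poly rmorphXn rmorphB rmorphXn rmorph1 mulN1r.
    apply: trig_polyX => //; apply: trig_polyD; first exact: trig_poly_cst.
    by apply: trig_polyM => //; [exact: trig_poly_cst|exact: trig_polyX].
  have an n : annihilated (fun x j => (if s n x j < 2^-1 then 1 else 0 : R)%:C).
    apply: (@annihilated_lim (fun k x j => step_poly k (s n x j))).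
    - move=> k j; apply: measurable_funX; apply: measurable_funB => //.
      exact: measurable_funX.
    - move=> k x j; rewrite ger0_norm ?step_poly_le1// step_poly_ge0//.
    - by move=> x j; exact: cvg_step_poly.
    - by move=> k; apply: (trig_poly_annihilated (w1 n)) => //; exact: aw.
  apply: (@annihilated_lim (fun n x j => if s n x j < 2^-1 then 1 else 0)) => //.
  - move=> n j; apply: measurable_fun_ifT => //.
    by apply: measurable_fun_ltr => //; exact: ms.
  - by move=> n x j; case: ifP; rewrite ?normr1 ?normr0.
  move=> x j.
  suff [n0 Hn0] : exists n0 : nat, forall n, (n0 <= n)%N ->
      (s n x j < 2^-1) = (j == j0) && (`|x - c| < d).
    apply: cvg_near_cst; exists n0 => // n /= /Hn0 ->.
    by [].
  have sE n i : (s n x i < 2^-1) = (cos (2 * pi * (d / L n)) < complex.Re (al n * w n x i)).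
    by rewrite /s; move: (complex.Re _) (cos _) => a b; apply/idP/idP; lra.
  have aE n i : al n * w n x i = conjc (zeta j0) * zeta i * ecirc ((x - c) / L n).
    rewrite /al /w conjcM -ecircN mulrBl ecircD; ring.
  have [->|jj0] := eqVneq j j0.
    (* This size of L n keeps both angles in [0, pi], where the cosine is strictly decreasing. *)
    have [n0 Hn0] := Loo (2 * (`|x - c| + d)); exists n0 => n /Hn0 Hn.
    rewrite sE aE [conjc _ * _]mulrC mulcJ z1 expr1n mul1r re_ecirc.
    have -> : cos (2 * pi * ((x - c) / L n)) = cos (2 * pi * (`|x - c| / L n)).
      rewrite -[LHS]cos_norm !normrM (ger0_norm (pi_ge0 R)) (gtr0_norm (_ : 0 < 2))//.
      by rewrite (gtr0_norm (_ : 0 < (L n)^-1)) ?invr_gt0.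
    have Lp := L0 n; have xc0 := normr_ge0 (x - c).
    have inI (y : R) : 0 <= y -> 2 * y <= L n -> 2 * pi * (y / L n) \in `[0, pi].
      move=> y0 yL; rewrite in_itv /=; apply/andP; split.
        by rewrite !mulr_ge0 ?pi_ge0// invr_ge0 ltW.
      rewrite mulrA ler_pdivrMr// mulrAC mulrC ler_wpM2l ?pi_ge0//.
    rewrite ltr_cos; [|apply: inI; lra|apply: inI; lra].
    by rewrite ltr_pM2l ?mulr_gt0 ?pi_gt0// ltr_pM2r ?invr_gt0.
  set eta := conjc (zeta j0) * zeta j in aE.
  have eta1 : Normc.normc eta = 1 by rewrite /eta Normc.normcM normcJ !z1 mulr1.
  have reta : complex.Re eta < 1.
    rewrite lt_neqAle (le_trans (ler_norm _))//; last by rewrite (le_trans (normr_Re_le _))// eta1.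
    rewrite andbT; apply/eqP => r1.
    have i0 : complex.Im eta = 0.
      have := sqr_normc eta; rewrite eta1 r1 expr1n => /eqP.
      by rewrite -subr_eq0 opprD addrA subrr sub0r oppr_eq0 sqrf_eq0 => /eqP.
    have e1 : eta = 1 by apply: eq_ReIm.
    move/eqP: jj0; apply; apply: zinj.
    have : zeta j0 * eta = zeta j by rewrite /eta mulrA mulcJ z1 expr1n mul1r.
    by rewrite e1 mulr1.
  (* In another copy the real part tends to Re eta < 1, while the cosine tends to 1. The errors are
     at most 2 pi |x - c| / L and 2 pi d / L, so from this L on their sum is below the gap. *)
  have [n0 Hn0] := Loo (2 * pi * (`|x - c| + d) / (1 - complex.Re eta)).
  exists n0 => n /Hn0 Hn; rewrite sE aE -/eta /=.
  apply/negbTE; rewrite -leNgt.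
  have H1 : complex.Re (eta * ecirc ((x - c) / L n)) <= complex.Re eta + 2 * pi * (`|x - c| / L n).
    have -> : eta * ecirc ((x - c) / L n) = eta + eta * (ecirc ((x - c) / L n) - 1) by ring.
    rewrite Re_add lerD2l (le_trans (ler_norm _))// (le_trans (normr_Re_le _))//.
    rewrite Normc.normcM eta1 mul1r (le_trans (normc_ecirc_sub1 _))//.
    by rewrite normrM (gtr0_norm (_ : 0 < (L n)^-1)) ?invr_gt0.
  have H2 : 1 - 2 * pi * (d / L n) <= cos (2 * pi * (d / L n)).
    have H := le_trans (ler_norm _) (normr_Re_le (1 - ecirc (d / L n))).
    have E : Normc.normc (1 - ecirc (d / L n)) = Normc.normc (ecirc (d / L n) - 1).
      by rewrite -opprB normcN.
    rewrite E in H; have := le_trans H (normc_ecirc_sub1 _).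
    rewrite Re_add raddfN /= (gtr0_norm (_ : 0 < d / L n)) ?divr_gt0//; lra.
  apply: le_trans H1 _; apply: le_trans H2.
  have H3 : 2 * pi * (`|x - c| + d) / L n <= 1 - complex.Re eta.
    by rewrite ler_pdivrMr ?L0// [leRHS]mulrC -ler_pdivrMr ?subr_gt0.
  by move: H3; rewrite mulrDr mulrDl -!mulrA; lra.
have itv0 (a b : R) : a < b ->
    cI (fun x => h j0 x * (if a < x < b then 1 else 0 : R)%:C) = 0.
  move=> ab; have /main : 0 < (b - a) / 2 by rewrite divr_gt0// subr_gt0.
  move=> /(_ ((a + b) / 2)); rewrite /annihilated (bigD1 j0)//= [X in _ + X]big1 ?addr0.
    move=> <-; congr cintegral; apply/funext => x; rewrite eqxx /=.
    rewrite (_ : (`|x - (a + b) / 2| < (b - a) / 2) = (a < x < b))//.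
    by rewrite ltr_norml; apply/idP/idP => /andP[? ?]; apply/andP; split; lra.
  move=> j jj0; rewrite -[RHS](@cintegral0 R); congr cintegral; apply/funext => x.
  by rewrite (negbTE jj0) /= mulr0.
have [iR iI] := hi j0.
have part (g : R -> R) : mu.-integrable setT (EFin \o g) ->
    (forall a b : R, a < b -> \int[mu]_x (g x * (if a < x < b then 1 else 0)) = 0) ->
    {ae mu, forall x, g x = 0}.
  move=> ig g0; apply: ae_eq0_of_itv => // a b ab.
  rewrite -Rintegral_itv_bndo_bndc; last first.
    exact: (integrableS measurableT _ _ ig).
  rewrite -[RHS](g0 a b ab) Rintegral_mkcond; apply: eq_Rintegral => x _.
  by rewrite patchE mem_setE in_itv /=; case: ifP; rewrite ?mulr1 ?mulr0.
have aR : {ae mu, forall x, complex.Re (h j0 x) = 0}.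
  apply: part => // a b ab; have /(congr1 (@complex.Re R)) /= := itv0 a b ab.
  by move=> E; rewrite -[RHS]E; apply: eq_Rintegral => x _; rewrite Re_mul /= mulr0 subr0.
have aI : {ae mu, forall x, complex.Im (h j0 x) = 0}.
  apply: part => // a b ab; have /(congr1 (@complex.Im R)) /= := itv0 a b ab.
  by move=> E; rewrite -[RHS]E; apply: eq_Rintegral => x _; rewrite Im_mul /= mulr0 add0r.
by have := ae_conj aR aI; apply: ae_impl => x [? ?]; exact: eq_ReIm.
Qed.

End FourierUniqueness.

(** Expanding the squared norm of the defect leaves only values of D at images under W, which may be
    replaced by values at the arguments; these cancel. *)
Lemma isometry_linear (R : realType) (V : lmodType R[i]) (D : V -> V -> R[i])
    (W : V -> V) : inner_product D -> (forall f g, D (W f) (W g) = D f g) ->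
  forall c f g, nrm D (W (c *: f + g) - (c *: W f + W g)) = 0.
Proof.
move=> HD HW c f g; rewrite /nrm.
rewrite (ipBl HD) !(ipBr HD) !(ipDl HD) !(ipDr HD) !(ipZl HD) !(ipZr HD) !HW.
rewrite !(ipDl HD) !(ipDr HD) !(ipZl HD) !(ipZr HD).
rewrite [X in complex.Re X](_ : _ = 0) ?sqrtr0//; ring.
Qed.

(** * The Fourier transform *)

Section EcircPowers.
Variable R : realType.

Lemma ecirc_exprz (x : R) (l : int) : ecirc x ^ l = ecirc (l%:~R * x).
Proof.
have H n : ecirc x ^+ n = ecirc (n%:R * x).
  elim: n => [|n IH]; first by rewrite mul0r ecirc0.
  by rewrite exprS IH -ecircD -natr1 mulrDl mul1r addrC.
case: l => n; first exact: H.
rewrite /exprz H NegzE mulrNz mulNr ecircN.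
have := mulcJ (ecirc (n.+1%:R * x)); rewrite normc_ecirc expr1n => E.
by apply: (mulfI (ecirc_neq0 (n.+1%:R * x))); rewrite mulfV ?ecirc_neq0.
Qed.

Lemma ecirc_neq1 (x : R) : 0 < `|x| <= 1 / 2 -> ecirc x != 1.
Proof.
move=> /andP[x0 x1]; apply/eqP => /(congr1 (@complex.Re R)) /=.
rewrite -[in LHS]cos_norm !normrM (ger0_norm (pi_ge0 R)) (gtr0_norm (_ : 0 < 2))//.
rewrite -[RHS](cos0 R) => /cos_inj; have p0 := pi_gt0 R.
have in1 : 2 * pi * `|x| \in `[0, pi] by rewrite in_itv /=; apply/andP; split; nra.
have in2 : 0 \in `[0, @pi R] by rewrite in_itv /= lexx ltW.
by move=> /(_ in1 in2) /eqP; rewrite !mulf_eq0 !pnatr_eq0 /= gt_eqF//= normr_eq0 -normr_eq0 gt_eqF.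
Qed.

End EcircPowers.

Lemma ae_neq0 (R : realType) : {ae @lebesgue_measure R, forall x, x != 0}.
Proof.
exists [set 0]; split => //; first exact: lebesgue_measure_set1.
by move=> x /= /negP; rewrite negbK => /eqP.
Qed.

Section HatTotal.
Variables (R : realType) (p : nat).
Local Notation mu := (@lebesgue_measure R).
Local Notation cI u := (cintegral mu setT u).

Lemma itv_hat_shift (s d x : R) : itv_hat s (s + d) x = ecirc (s * x) * itv_hat 0 d x.
Proof. by rewrite /itv_hat [(s + d) * x]mulrDl ecircD mul0r ecirc0; ring. Qed.

(** Translating an interval modulates its transform. For a fixed length d, orthogonality to all
    translates therefore kills the Fourier integrals of f times the conjugate transform of ]0, d],
    and [fourier_unique] applies with a single copy. That transform has no zero for 0 < |x| <= 1 /
    (2 d), and d tends to 0. *)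
Lemma hat_total : total_family (@l2dot R p) (@hat_fam R p).
Proof.
move=> f f0; rewrite -[f]subr0; apply/nrm_aeeq => j.
have key (n : nat) : {ae mu, forall x, 0 < `|x| <= n.+1%:R / 2 -> f x j = 0}.
  pose d : R := n.+1%:R^-1.
  have d0 : 0 < d by rewrite invr_gt0.
  pose h (i : 'I_1) x := f x j * (itv_hat 0 d x)^*.
  have hi i : cintegrable (h i) by apply: cL2_integrable; [exact: l2P|exact: cL2_itv_hat].
  have h0 : forall i, {ae mu, forall x, h i x = 0}.
    apply: (@fourier_unique R 1 h hi (fun=> 1) (fun n => n.+1%:R)).
    - by move=> i; rewrite Normc.normc1.
    - by move=> i k _; rewrite !ord1.
    - by move=> m; rewrite ltr0n.
    - move=> A; exists (Num.bound `|A|) => m Hm.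
      rewrite (le_trans (ler_norm A))// (le_trans (ltW (archi_boundP (normr_ge0 A))))//.
      by rewrite ler_nat ltnW.
    - move=> m l; rewrite /annihilated big_ord1.
      pose s : R := - l%:~R / m.+1%:R.
      have := f0 (j, (s, d)).
      rewrite (l2dot_at_comp _ (erefl (l2fun (hat_fam _)))); last exact: cL2_itv_hat.
      move=> E; rewrite -[RHS]E; congr cintegral; apply/funext => x.
      rewrite /h /= (ger0_norm (ltW d0)) itv_hat_shift mulr1 ecirc_exprz !conjCE (conjcM (ecirc _)) -ecircN.
      rewrite (_ : - (s * x) = l%:~R * (x / m.+1%:R)); first by ring.
      by rewrite /s; ring.
  have := h0 ord0; apply: ae_impl => x /eqP; rewrite /h conjCE mulf_eq0 => /orP[/eqP//|].
  rewrite conjc_eq0 => hat0 /andP[x0 x1]; move: hat0.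
  rewrite /itv_hat mul0r ecirc0 !mulf_eq0.
  have xn0 : x != 0 by rewrite -normr_gt0.
  have -> : ((Num.sqrt (2 * fejer_int R))^-1%:C == 0) = false.
    rewrite eq_complex /= eqxx andbT invr_eq0 sqrtr_eq0 leNgt mulr_gt0//.
    exact: fejer_int_gt0.
  have -> : ((x^-1)%:C == 0) = false by rewrite eq_complex /= eqxx andbT invr_eq0 (negbTE xn0).
  rewrite orbF /= subr_eq0 eq_sym (negbTE (ecirc_neq1 _))//.
  rewrite normrM (gtr0_norm d0) mulr_gt0//= /d mulrC ler_pdivrMr//.
  by rewrite mulrC div1r.
have /ae_foralln H := key; have := ae_conj (ae_neq0 R) H.
apply: ae_impl => x [x0 Hx].
apply: (Hx (Num.bound (2 * `|x|))); rewrite normr_gt0 x0 /=.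
have := archi_boundP (mulr_ge0 (ler0n R 2) (normr_ge0 x)).
by rewrite ler_pdivlMr// mulrC => /ltW /le_trans; apply; rewrite ler_nat.
Qed.

Lemma fourier_unitary : exists W W' : l2vect R p -> l2vect R p,
  [/\ forall f g, l2dot (W f) (W g) = l2dot f g,
      forall g, nrm (@l2dot R p) (W (W' g) - g) = 0 &
      forall i, nrm (@l2dot R p) (W (step_fam i) - hat_fam i) = 0].
Proof.
apply: unitary_of_families.
- exact: l2_inner.
- exact: l2_complete.
- exact: step_total.
- exact: hat_total.
- exact: step_hat_gram.
Qed.

End HatTotal.

(** * The generators of the representation, their transforms and adjoints *)

Section Operators.
Variables (R : realType) (N p : nat) (z : 'I_p -> R[i]).
Local Notation mu := (@lebesgue_measure R).
Local Notation cI u := (cintegral mu setT u).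
Local Notation vect := (vect R p).
Hypothesis N0 : (0 < N)%N.
Hypothesis z1 : forall j, Normc.normc (z j) = 1.

Definition dil (a : R) (s : 'I_p -> 'I_p) (f : vect) : vect :=
  fun x j => (Num.sqrt a)%:C * f (a * x) (s j).

Definition hatT (f : vect) : vect := fun x j => ecirc x * z j * f x j.
Definition hatTV (f : vect) : vect := fun x j => (ecirc x * z j)^-1 * f x j.
Definition hatU : vect -> vect := dil N%:R (@ordS p).
Definition hatUV : vect -> vect := dil N%:R^-1 (@ord_pred p).

Lemma repUE (f : vect) : repU N f = dil N%:R^-1 (@ordS p) f.
Proof.
by apply/funext => x; apply/funext => j; rewrite /repU /dil sqrtrV// [x / _]mulrC.
Qed.

Lemma repUVE (f : vect) : repUV N f = dil N%:R (@ord_pred p) f.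
Proof. by apply/funext => x; apply/funext => j; rewrite /repUV /dil [x * _]mulrC. Qed.

Lemma z_neq0 j : z j != 0.
Proof. by apply/eqP => E; have := z1 j; rewrite E Normc.normc0 => /eqP; rewrite eq_sym oner_eq0. Qed.

Lemma conj_unitV (w : R[i]) : Normc.normc w = 1 -> w^-1 = conjc w.
Proof.
move=> w1; have w0 : w != 0.
  by apply/eqP => E; move: w1; rewrite E Normc.normc0 => /eqP; rewrite eq_sym oner_eq0.
by apply: (mulfI w0); rewrite mulfV// mulcJ w1 expr1n.
Qed.

Lemma L2_dil a s (f : vect) : a != 0 -> L2 f -> L2 (dil a s f).
Proof.
move=> a0 Lf j; apply: (cL2_mulb (C := Normc.normc (Num.sqrt a)%:C)) => //.
have := cL2_affine 0 a0 (Lf (s j)).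
by under [in X in X -> _]eq_fun do rewrite addr0.
Qed.

Lemma L2_mulb (m f : vect) (C : R) : (forall j, cmeas (m ^~ j)) ->
  (forall x j, Normc.normc (m x j) <= C) -> L2 f -> L2 (fun x j => m x j * f x j).
Proof. by move=> mm mC Lf j; exact: (cL2_mulb (Lf j) (mm j)). Qed.

Lemma L2_translate (c : 'I_p -> R[i]) (t : R) (f : vect) : L2 f ->
  L2 (fun x j => c j * f (x + t) j).
Proof.
move=> Lf j; apply: (cL2_mulb (C := Normc.normc (c j))) => //.
have := cL2_affine t (oner_neq0 R) (Lf j).
by under [in X in X -> _]eq_fun do rewrite mul1r.
Qed.

Lemma L2_repT (f : vect) : L2 f -> L2 (repT z f).
Proof. by move=> Lf; exact: L2_translate. Qed.

Lemma L2_repTV (f : vect) : L2 f -> L2 (repTV z f).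
Proof. by move=> Lf; exact: (L2_translate (fun j => (z j)^-1)). Qed.

Lemma N_neq0 : N%:R != 0 :> R. Proof. by rewrite pnatr_eq0 -lt0n. Qed.

Lemma L2_repU (f : vect) : L2 f -> L2 (repU N f).
Proof. by move=> Lf; rewrite repUE; apply: L2_dil => //; rewrite invr_eq0 N_neq0. Qed.

Lemma L2_repUV (f : vect) : L2 f -> L2 (repUV N f).
Proof. by move=> Lf; rewrite repUVE; apply: L2_dil => //; exact: N_neq0. Qed.

Lemma cmeas_hat j : cmeas (fun x => ecirc x * z j).
Proof. by apply: cmeasM; [exact: cmeas_ecirc|exact: cmeas_cst]. Qed.

Lemma normc_hat x j : Normc.normc (ecirc x * z j) = 1.
Proof. by rewrite Normc.normcM normc_ecirc z1 mul1r. Qed.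

Lemma L2_hatT (f : vect) : L2 f -> L2 (hatT f).
Proof.
by apply: (L2_mulb (C := 1)); [exact: cmeas_hat|move=> x j; rewrite normc_hat].
Qed.

Lemma L2_hatTV (f : vect) : L2 f -> L2 (hatTV f).
Proof.
apply: (L2_mulb (C := 1)); first by move=> j; apply: cmeasV; exact: cmeas_hat.
by move=> x j; rewrite Normc.normcV normc_hat invr1.
Qed.

Lemma L2_hatU (f : vect) : L2 f -> L2 (hatU f).
Proof. by apply: L2_dil; exact: N_neq0. Qed.

Lemma L2_hatUV (f : vect) : L2 f -> L2 (hatUV f).
Proof. by apply: L2_dil; rewrite invr_eq0 N_neq0. Qed.

Lemma dot_dil a (s t : 'I_p -> 'I_p) (f g : vect) : 0 < a ->
  cancel s t -> cancel t s -> L2 f -> L2 g ->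
  dot (dil a s f) g = dot f (dil a^-1 t g).
Proof.
move=> a0 st ts Lf Lg; rewrite /dot.
rewrite [RHS](reindex s) /=; last by exists t => i _.
apply: eq_bigr => j _.
have an0 : a != 0 by rewrite gt_eqF.
have i1 : cintegrable (fun x => f x (s j) * (dil a^-1 t g x (s j))^*).
  by apply: cL2_integrable; [exact: Lf|apply: L2_dil => //; rewrite invr_eq0].
rewrite [RHS](cintegral_affine 0 an0 i1) -cintegralZ; last exact: (cintegrable_affine 0 an0 i1).
congr cintegral; apply/funext => x; rewrite addr0 /dil st mulKf// sqrtrV ?ltW//.
rewrite !conjCE conjcM conjcR gtr0_norm//.
have E : a%:C = (Num.sqrt a)%:C * (Num.sqrt a)%:C :> R[i].
  by rewrite -RtoCM -expr2 sqr_sqrtr// ltW.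
have E2 : (Num.sqrt a)%:C * ((Num.sqrt a)^-1)%:C = 1 :> R[i].
  by rewrite -RtoCM mulfV ?sqrtr_eq0 -?ltNge.
rewrite E; set q := (Num.sqrt a)%:C in E2 *; set q' := (_^-1)%:C in E2 *.
transitivity ((q * q') * (q * f (a * x) (s j) * conjc (g x j))); last by ring.
by rewrite E2 mul1r.
Qed.

Lemma dot_repU (f g : vect) : L2 f -> L2 g -> dot (repU N f) g = dot f (repUV N g).
Proof.
move=> Lf Lg; have Ni : 0 < N%:R^-1 :> R by rewrite invr_gt0 ltr0n.
by have := dot_dil Ni (@ordSK p) (@ord_predK p) Lf Lg; rewrite invrK -repUE -repUVE.
Qed.

Lemma dot_hatU (f g : vect) : L2 f -> L2 g -> dot (hatU f) g = dot f (hatUV g).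
Proof.
by move=> Lf Lg; rewrite /hatU (dot_dil _ (@ordSK p) (@ord_predK p))// ltr0n.
Qed.

Lemma dot_repT (f g : vect) : L2 f -> L2 g -> dot (repT z f) g = dot f (repTV z g).
Proof.
move=> Lf Lg; apply: eq_bigr => j _.
have i1 : cintegrable (fun x => repT z f x j * (g x j)^*).
  by apply: cL2_integrable; [exact: L2_repT|exact: Lg].
rewrite (cintegral_affine 1 (oner_neq0 R) i1) normr1 mul1r.
congr cintegral; apply/funext => x; rewrite /repT /repTV mul1r addrK.
by rewrite !conjCE conjcM (conj_unitV (z1 j)) conjcK; ring.
Qed.

Lemma dot_mul (m f g : vect) :
  dot (fun x j => m x j * f x j) g = dot f (fun x j => conjc (m x j) * g x j).
Proof.
apply: eq_bigr => j _; congr cintegral; apply/funext => x.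
by rewrite !conjCE conjcM conjcK; ring.
Qed.

Lemma dot_hatT (f g : vect) : dot (hatT f) g = dot f (hatTV g).
Proof.
rewrite dot_mul; congr dot; apply/funext => x; apply/funext => j.
by rewrite /hatTV conj_unitV// normc_hat.
Qed.

End Operators.

Lemma l2vect_eq (R : realType) (p : nat) (f g : l2vect R p) :
  (forall x j, f x j = g x j) -> f = g.
Proof.
by move=> fg; apply: val_inj; apply/funext => x; apply/funext => j; exact: fg.
Qed.

Lemma itv_hat_dil (R : realType) (c a b x : R) :
  itv_hat a b (c * x) = (c^-1)%:C * itv_hat (c * a) (c * b) x.
Proof.
have E t : t * (c * x) = c * t * x by ring.
by rewrite /itv_hat !E invfM RtoCM; ring.
Qed.

Lemma l2vect_eqZ (R : realType) (p : nat) (c : R[i]) (f g : l2vect R p) :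
  (forall x j, f x j = c * g x j) -> f = c *: g.
Proof. by move=> fg; apply: l2vect_eq => x j; rewrite fg. Qed.

Section AeEq.
Variables (R : realType) (p : nat).
Implicit Types f g h : vect R p.

Lemma aeeq_refl f : aeeq f f. Proof. by move=> j; exact: aeW. Qed.

Lemma aeeq_sym f g : aeeq f g -> aeeq g f.
Proof. by move=> fg j; apply: ae_impl (fg j) => x ->. Qed.

Lemma aeeq_trans f g h : aeeq f g -> aeeq g h -> aeeq f h.
Proof. by move=> fg gh j; apply: ae_impl (ae_conj (fg j) (gh j)) => x [-> ->]. Qed.

Lemma aeeq_mul (m : vect R p) f g : aeeq f g ->
  aeeq (fun x j => m x j * f x j) (fun x j => m x j * g x j).
Proof. by move=> fg j; apply: ae_impl (fg j) => x ->. Qed.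

Lemma aeeq_dil a s f g : a != 0 -> aeeq f g -> aeeq (dil a s f) (dil a s g).
Proof.
move=> a0 fg j; have := ae_affine 0 a0 (fg (s j)).
by apply: ae_impl => x; rewrite /dil addr0 => ->.
Qed.

End AeEq.

Section Fourier.
Variables (R : realType) (N p : nat) (z : 'I_p -> R[i]).
Local Notation mu := (@lebesgue_measure R).
Local Notation cI u := (cintegral mu setT u).
Local Notation vect := (vect R p).
Local Notation l2vect := (l2vect R p).
Local Notation nrm := (nrm (@l2dot R p)).
Hypothesis N0 : (0 < N)%N.
Hypothesis z1 : forall j, Normc.normc (z j) = 1.
Variables (W W' : l2vect -> l2vect).
Hypothesis WW : forall f g, l2dot (W f) (W g) = l2dot f g.
Hypothesis WWV : forall g, nrm (W (W' g) - g) = 0.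
Hypothesis Wstep : forall i, nrm (W (step_fam i) - hat_fam i) = 0.

Lemma W_lin c f g : aeeq (W (c *: f + g)) (fun x j => c * W f x j + W g x j).
Proof. exact/(nrm_aeeq _ (c *: W f + W g))/isometry_linear/WW/l2_inner. Qed.

Lemma nrm_W f : nrm (W f) = nrm f. Proof. by rewrite /nrm WW. Qed.

Lemma W_nrmB f g : nrm (W f - W g) = nrm (f - g).
Proof.
rewrite -(nrm_W (f - g)); apply: (nrm_subr0 (@l2_inner R p)); apply/nrm_aeeq => j.
have := W_lin (-1) g f j; rewrite scaleN1r addrC; apply: ae_impl => x ->.
by rewrite l2_subE mulN1r addrC.
Qed.

Lemma W_ext (f g : l2vect) : aeeq f g -> aeeq (W f) (W g).
Proof. by move=> /nrm_aeeq fg; apply/nrm_aeeq; rewrite W_nrmB. Qed.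

Lemma W_inj (f g : l2vect) : aeeq (W f) (W g) -> aeeq f g.
Proof. by move=> /nrm_aeeq fg; apply/nrm_aeeq; rewrite -W_nrmB. Qed.

Lemma WVK g : aeeq (W (W' g)) g.
Proof. exact/nrm_aeeq/WWV. Qed.

Lemma W_scaled (c : R[i]) f g h i : f = c *: step_fam i -> g = c *: hat_fam i ->
  h = W f -> nrm (h - g) = 0.
Proof.
move=> -> -> ->; apply/nrm_aeeq; apply: aeeq_trans (_ : aeeq (W (c *: step_fam i + 0)) _).
  by rewrite addr0; exact: aeeq_refl.
have W0 : aeeq (W 0) (fun _ _ => 0).
  have := W_lin (-1) 0 0; rewrite scaler0 addr0 => H j; have := H j.
  by apply: ae_impl => x ->; rewrite mulN1r addNr.
apply: aeeq_trans (W_lin _ _ _) _ => j; have /nrm_aeeq/(_ j) := Wstep i.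
by move=> /ae_conj/(_ (W0 j)); apply: ae_impl => x [-> ->]; rewrite addr0.
Qed.

Lemma W_T f : aeeq (W (mkl2 (L2_repT z (l2P f)))) (hatT z (W f)).
Proof.
pose T (g : l2vect) := mkl2 (L2_repT z (l2P g)).
pose TV (g : l2vect) := mkl2 (L2_repTV z (l2P g)).
pose hT (g : l2vect) := mkl2 (L2_hatT z1 (l2P g)).
pose hTV (g : l2vect) := mkl2 (L2_hatTV z1 (l2P g)).
suff H : nrm (W (T f) - hT (W f)) = 0 by exact/(nrm_aeeq _ (hT (W f))).
apply: (@intertwine _ _ _ _ _ (@hat_fam R p) (@step_fam R p) W T TV hT hTV) => //.
- exact: l2_inner.
- exact: hat_total.
- by move=> g h; apply: dot_repT => //; exact: l2P.
- by move=> g h; exact: dot_hatT.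
(* The adjoint of T moves an interval by -1 within its copy, so it preserves the step family up to
   the scalar 1 / z_j. *)
- move=> [j [a d]]; apply: (W_scaled (c := (z j)^-1) (i := (j, (a - 1, d))) _ _ erefl).
    apply: l2vect_eqZ => x i /=; rewrite /repTV /at_comp /=.
    have [->|] := eqVneq i j; last by rewrite !mulr0.
    by rewrite /itv_ind ltrBlDr [a - 1 + _]addrAC lerBrDr.
  apply: l2vect_eqZ => x i /=; rewrite /hatTV /at_comp /=.
  have [->|] := eqVneq i j; last by rewrite !mulr0.
  rewrite conj_unitV ?normc_hat// (conj_unitV (z1 j)) conjcM -ecircN /itv_hat.
  rewrite [a - 1 + _]addrAC !mulrBl mul1r !ecircD; ring.
Qed.

Lemma W_U f : aeeq (W (mkl2 (L2_repU N0 (l2P f)))) (hatU N (W f)).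
Proof.
pose T (g : l2vect) := mkl2 (L2_repU N0 (l2P g)).
pose TV (g : l2vect) := mkl2 (L2_repUV N0 (l2P g)).
pose hT (g : l2vect) := mkl2 (L2_hatU N0 (l2P g)).
pose hTV (g : l2vect) := mkl2 (L2_hatUV N0 (l2P g)).
suff H : nrm (W (T f) - hT (W f)) = 0 by exact/(nrm_aeeq _ (hT (W f))).
apply: (@intertwine _ _ _ _ _ (@hat_fam R p) (@step_fam R p) W T TV hT hTV) => //.
- exact: l2_inner.
- exact: hat_total.
- by move=> g h; apply: dot_repU => //; exact: l2P.
- by move=> g h; apply: dot_hatU => //; exact: l2P.
- move=> [j [a d]]; have Nn := N_neq0 R N0; have Np : 0 < N%:R :> R by rewrite ltr0n.
  have Ej i : (ord_pred i == j) = (i == ordS j).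
    by rewrite -(inj_eq (can_inj (@ordSK p))) ord_predK.
  have Ed : a / N%:R + `|d / N%:R| = (a + `|d|) / N%:R.
    by rewrite normrM normfV (gtr0_norm Np) mulrDl.
  (* The adjoint of U shrinks an interval of copy j by N and places it in copy j + 1, with the
     scalar sqrt N. *)
  apply: (W_scaled (c := (Num.sqrt N%:R)%:C) (i := (ordS j, (a / N%:R, d / N%:R))) _ _ erefl).
    apply: l2vect_eqZ => x i /=; rewrite /repUV /at_comp /= Ej.
    have [_|] := eqVneq i (ordS j); last by rewrite !mulr0.
    by rewrite /itv_ind Ed ltr_pdivrMr// ler_pdivlMr.
  apply: l2vect_eqZ => x i /=; rewrite /hatUV /dil /at_comp /= Ej.
  have [_|] := eqVneq i (ordS j); last by rewrite !mulr0.
  rewrite Ed itv_hat_dil ?invr_eq0// invrK ![_ / N%:R]mulrC mulrA -RtoCM.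
  congr (_%:C * _); rewrite -[X in _ * X](sqr_sqrtr (ltW Np)) sqrtrV ?ltW// expr2 mulKf//.
  by rewrite sqrtr_eq0 -ltNge.
Qed.

End Fourier.

(** * Cyclic vectors *)

Section Shift.
Variable p : nat.

Lemma shift_subproof (k : int) (j : 'I_p) : (`|((j%:Z + k) %% p%:Z)%Z| < p)%N.
Proof.
have p0 : (0 < p)%N by case: p j => [[]|].
by rewrite -ltz_nat gez0_abs ?modz_ge0 ?ltz_pmod// -lt0n.
Qed.

Definition shift (k : int) (j : 'I_p) : 'I_p := Ordinal (shift_subproof k j).

Lemma shiftE k j : (shift k j)%:Z = ((j%:Z + k) %% p%:Z)%Z.
Proof.
have p0 : (0 < p)%N by case: p j => [[]|].
by rewrite /= gez0_abs// modz_ge0// -lt0n.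
Qed.

Lemma shift_shift k l j : shift k (shift l j) = shift (k + l) j.
Proof.
apply: val_inj; apply/eqP; rewrite -eqz_nat !shiftE modzDml.
by rewrite -addrA [l + k]addrC.
Qed.

Lemma shift0 j : shift 0 j = j.
Proof.
apply: val_inj; apply/eqP; rewrite -eqz_nat shiftE addr0 modz_small//.
by rewrite ltz_nat ltn_ord.
Qed.

Lemma shiftK k : cancel (shift k) (shift (- k)).
Proof. by move=> j; rewrite shift_shift addNr shift0. Qed.

Lemma shift1 j : shift 1 j = ordS j.
Proof. by apply: val_inj; rewrite /= -PoszD addn1 modz_nat absz_nat. Qed.

Lemma shiftN1 j : shift (- 1) j = ord_pred j.
Proof. by rewrite -{1}[j]ord_predK -shift1 shiftK. Qed.

Lemma shift_mulp (M : int) j : shift (p%:Z * M) j = j.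
Proof.
apply: val_inj; apply/eqP; rewrite -eqz_nat shiftE mulrC addrC modzMDl.
by rewrite modz_small// ltz_nat ltn_ord.
Qed.

End Shift.

Section HatRep.
Variables (R : realType) (N p : nat) (z : 'I_p -> R[i]).
Local Notation vect := (vect R p).
Hypothesis N0 : (0 < N)%N.
Hypothesis z1 : forall j, Normc.normc (z j) = 1.

Definition hat_letter (l : bs_letter) : vect -> vect :=
  match l with
  | Lu => @hatU R N p
  | LuV => @hatUV R N p
  | Lt => hatT z
  | LtV => hatTV z
  end.

Definition hatrep (w : seq bs_letter) (f : vect) : vect := foldr hat_letter f w.

Lemma L2_rep_letter l f : L2 f -> L2 (rep_letter N z l f).
Proof.
by case: l; [exact: L2_repU|exact: L2_repUV|exact: L2_repT|exact: L2_repTV].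
Qed.

Lemma L2_rep w f : L2 f -> L2 (rep N z w f).
Proof. by move=> Lf; elim: w => //= l w IH; exact: L2_rep_letter. Qed.

Lemma L2_hat_letter l f : L2 f -> L2 (hat_letter l f).
Proof.
by case: l; [exact: L2_hatU|exact: L2_hatUV|exact: L2_hatT|exact: L2_hatTV].
Qed.

Lemma L2_hatrep w f : L2 f -> L2 (hatrep w f).
Proof. by move=> Lf; elim: w => //= l w IH; exact: L2_hat_letter. Qed.

Lemma aeeq_hat_letter l f g : aeeq f g -> aeeq (hat_letter l f) (hat_letter l g).
Proof.
case: l => fg; try exact: aeeq_mul.
  by apply: aeeq_dil => //; exact: N_neq0.
by apply: aeeq_dil => //; rewrite invr_eq0 N_neq0.
Qed.

Lemma hat_letter_orbit l (x : R) j : exists k c, forall h,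
  hat_letter l h x j = c * h (N%:R ^ k * x) (shift k j).
Proof.
case: l.
- by exists 1, (Num.sqrt N%:R)%:C => h; rewrite expr1z shift1.
- by exists (- 1), (Num.sqrt N%:R^-1)%:C => h; rewrite exprN1 shiftN1.
- by exists 0, (ecirc x * z j) => h; rewrite expr0z mul1r shift0.
- by exists 0, (ecirc x * z j)^-1 => h; rewrite expr0z mul1r shift0.
Qed.

(** A word evaluates h at a single point of the orbit of (x, j). Hence all words give functions
    vanishing at (x, j) as soon as h vanishes on the whole orbit. *)
Lemma hatrep_orbit w x j : exists k c, forall h,
  hatrep w h x j = c * h (N%:R ^ k * x) (shift k j).
Proof.
elim: w x j => [|l w IH] x j /=.
  by exists 0, 1 => h; rewrite expr0z !mul1r shift0.
have [k [c kc]] := hat_letter_orbit l x j.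
have [k' [c' kc']] := IH (N%:R ^ k * x) (shift k j).
exists (k' + k), (c * c') => h; rewrite kc kc' mulrA shift_shift.
by rewrite expfzDr ?N_neq0// -!mulrA.
Qed.

Lemma hat_char_word (l : int) u : exists w, forall h,
  hatrep w h = fun x j => (ecirc x * z j) ^ l * hatrep u h x j.
Proof.
have H l' (c : R -> 'I_p -> R[i]) (n : nat) :
    (forall h, hat_letter l' h = fun x j => c x j * h x j) ->
    forall h, hatrep (nseq n l' ++ u) h = fun x j => c x j ^+ n * hatrep u h x j.
  move=> E h; elim: n => [|n IH] /=; apply/funext => x; apply/funext => j.
    by rewrite expr0 mul1r.
  by rewrite -/(hatrep _ _) IH E exprS mulrA.
case: l => n; first by exists (nseq n Lt ++ u); exact: (H Lt).
exists (nseq n.+1 LtV ++ u) => h; rewrite (H LtV (fun x j => (ecirc x * z j)^-1))//.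
by apply/funext => x; apply/funext => j; rewrite exprVn.
Qed.

(** Combined with [hat_char_word], this conjugates powers of T by dilations and so reaches
    characters of arbitrarily large period. *)
Lemma hat_dil_word (k : int) u : exists w c, c != 0 /\ forall h x j,
  hatrep w h x j = c * hatrep u h (N%:R ^ k * x) (shift k j).
Proof.
have sN : Num.sqrt N%:R != 0 :> R by rewrite sqrtr_eq0 -ltNge ltr0n.
have sNV : Num.sqrt N%:R^-1 != 0 :> R by rewrite sqrtr_eq0 -ltNge invr_gt0 ltr0n.
have H l (k0 : int) (c : R) (n : nat) : c != 0 ->
    (forall h x j, hat_letter l h x j = c%:C * h (N%:R ^ k0 * x) (shift k0 j)) ->
    forall h x j, hatrep (nseq n l ++ u) h x j =
      (c%:C ^+ n) * hatrep u h (N%:R ^ (k0 * n%:Z) * x) (shift (k0 * n%:Z) j).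
  move=> c0 E h; elim: n => [|n IH] x j /=.
    by rewrite mulr0 !expr0z !mul1r shift0.
  rewrite -/(hatrep _ _) E IH exprS shift_shift intS mulrDr mulr1 [k0 + _]addrC mulrA.
  by rewrite expfzDr ?N_neq0// -!mulrA.
have C0 (c : R) : c != 0 -> c%:C != 0 by move=> c0; rewrite eq_complex /= negb_and c0.
case: k => n.
  exists (nseq n Lu ++ u), ((Num.sqrt N%:R)%:C ^+ n); split; first by rewrite expf_neq0// C0.
  move=> h x j; rewrite (H Lu 1 (Num.sqrt N%:R))//.
    by rewrite mul1r.
  by move=> g y i; rewrite expr1z shift1.
exists (nseq n.+1 LuV ++ u), ((Num.sqrt N%:R^-1)%:C ^+ n.+1).
split; first by rewrite expf_neq0// C0.
move=> h x j; rewrite (H LuV (- 1) (Num.sqrt N%:R^-1))//.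
  by rewrite mulN1r NegzE.
by move=> g y i; rewrite exprN1 shiftN1.
Qed.

End HatRep.

Lemma measurable_forall_int (d : measure_display) (T : measurableType d)
    (F : int -> set T) :
  (forall k, measurable (F k)) -> measurable [set x | forall k, F k x].
Proof.
move=> mF; pose G n := if unpickle n is Some k then F k else setT.
rewrite (_ : [set x | _] = \bigcap_n G n).
  by apply: bigcapT_measurable => n; rewrite /G; case: unpickle.
apply/seteqP; split=> x /= Fx; first by move=> n _; rewrite /G; case: unpickle.
by move=> k; have := Fx (pickle k) I; rewrite /G pickleK.
Qed.

Lemma ae_forall_int (d : measure_display) (T : measurableType d) (R : realType)
    (m : {measure set T -> \bar R}) (P : int -> T -> Prop) :
  (forall k, {ae m, forall x, P k x}) -> {ae m, forall x k, P k x}.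
Proof.
move=> aP; pose Q n x := if unpickle n is Some k then P k x else True.
have /ae_foralln : forall n, {ae m, forall x, Q n x}.
  move=> n; rewrite /Q; case: unpickle => [k|]; first exact: aP.
  exact: aeW.
apply: filterS => x Qx k; have := Qx (pickle k).
by rewrite /Q pickleK.
Qed.

Lemma lebesgue_measure_cc_lty (R : realType) (a b : R) :
  (@lebesgue_measure R `[a, b]%classic < +oo)%E.
Proof.
by rewrite lebesgue_measure_itv /=; case: ifP => // _; rewrite -EFinB ltry.
Qed.

Lemma measurable_cmeas_eq0 (R : realType) (u : R -> R[i]) : cmeas u ->
  measurable [set x | u x = 0].
Proof.
move=> [u1 u2].
rewrite (_ : [set x | _] = (setT `&` (fun x => complex.Re (u x)) @^-1` [set 0]) `&`
  (setT `&` (fun x => complex.Im (u x)) @^-1` [set 0])).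
  by apply: measurableI; [apply: u1|apply: u2].
rewrite !setTI; apply/seteqP; split=> x /=; first by move=> ->.
by move=> [a b]; apply: eq_ReIm.
Qed.

(** * The cyclicity criterion *)

Section Cyclicity.
Variables (R : realType) (N p : nat) (z : 'I_p -> R[i]).
Local Notation mu := (@lebesgue_measure R).
Local Notation cI u := (cintegral mu setT u).
Local Notation vect := (vect R p).
Local Notation l2vect := (l2vect R p).
Local Notation nrm := (nrm (@l2dot R p)).
Hypothesis N1 : (1 < N)%N.
Hypothesis z_inj : injective z.
Hypothesis z1 : forall j, Normc.normc (z j) = 1.
Variables (W W' : l2vect -> l2vect).
Hypothesis WW : forall f g, l2dot (W f) (W g) = l2dot f g.
Hypothesis WWV : forall g, nrm (W (W' g) - g) = 0.
Hypothesis Wstep : forall i, nrm (W (step_fam i) - hat_fam i) = 0.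

Let N0 : (0 < N)%N. Proof. exact: ltnW. Qed.

Lemma W_letter l (f : l2vect) :
  aeeq (W (mkl2 (L2_rep_letter z N0 l (l2P f)))) (hat_letter N z l (W f)).
Proof.
case: l.
- have := W_U N0 WW Wstep f; congr aeeq; congr (l2fun (W _)); exact: l2vect_eq.
(* For an inverse letter, the statement on the letter itself is applied to the preimage and the
   inverse is cancelled. *)
- pose g := mkl2 (L2_rep_letter z N0 LuV (l2P f)).
  have E : mkl2 (L2_repU N0 (l2P g)) = f.
    by apply: l2vect_eq => x j /=; rewrite repUVK.
  have := W_U N0 WW Wstep g; rewrite E -/g => H.
  apply: aeeq_sym; apply: aeeq_trans (aeeq_hat_letter z N0 LuV H) _.
  rewrite (_ : hat_letter N z LuV (hatU N (W g)) = W g); first exact: aeeq_refl.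
  apply/funext => x; apply/funext => j; rewrite /= /hatUV /hatU /dil.
  rewrite ord_predK mulVKf ?N_neq0// mulrA -RtoCM -sqrtrM ?invr_ge0//.
  by rewrite mulVf ?N_neq0// sqrtr1 mul1r.
- have := W_T z1 WW Wstep f; congr aeeq; congr (l2fun (W _)); exact: l2vect_eq.
- pose g := mkl2 (L2_rep_letter z N0 LtV (l2P f)).
  have E : mkl2 (L2_repT z (l2P g)) = f.
    apply: l2vect_eq => x j /=; rewrite /repT /repTV subrK mulVKf//.
    exact: z_neq0.
  have := W_T z1 WW Wstep g; rewrite E -/g => H.
  apply: aeeq_sym; apply: aeeq_trans (aeeq_hat_letter z N0 LtV H) _.
  rewrite (_ : hat_letter N z LtV (hatT z (W g)) = W g); first exact: aeeq_refl.
  apply/funext => x; apply/funext => j; rewrite /= /hatTV /hatT mulKf//.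
  by rewrite mulf_neq0 ?ecirc_neq0 ?z_neq0.
Qed.

Definition orb (f : l2vect) (w : seq bs_letter) : l2vect :=
  mkl2 (L2_rep z N0 w (l2P f)).

Lemma W_orb f w : aeeq (W (orb f w)) (hatrep N z w (W f)).
Proof.
elim: w => [|l w IH] /=.
  by rewrite (_ : orb f [::] = f); [exact: aeeq_refl|exact: l2vect_eq].
apply: aeeq_trans (aeeq_hat_letter z N0 l IH).
rewrite (_ : orb f (l :: w) = mkl2 (L2_rep_letter z N0 l (l2P (orb f w)))).
  exact: W_letter.
exact: l2vect_eq.
Qed.

Lemma l2_sumE (I : Type) (s : seq I) (F : I -> l2vect) x j :
  l2fun (\sum_(i <- s) F i) x j = \sum_(i <- s) F i x j.
Proof.
elim: s => [|i s IH]; first by rewrite !big_nil.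
by rewrite !big_cons -IH -[F i]scale1r l2_linE scale1r mul1r.
Qed.

Lemma cyclic_vectorP (f : l2vect) : cyclic_vector N z f <->
  forall g e, 0 < e -> exists s, nrm (g - lincomb (orb f) s) < e.
Proof.
have E (g : l2vect) s :
    sqnorm (fun x j => g x j - \sum_(c <- s) c.1 * rep N z c.2 f x j) =
    (nrm (g - lincomb (orb f) s) ^+ 2)%:E.
  rewrite -sqnorm_l2; congr sqnorm; apply/funext => x; apply/funext => j.
  by rewrite l2_subE /lincomb l2_sumE.
split=> [[_ H] g e e0|H].
  have [s] := H g (l2P g) (e ^+ 2) (exprn_gt0 _ e0).
  rewrite E lte_fin ltr_pXn2r ?nnegrE ?nrm_ge0 ?(ltW e0)// => ?.
  by exists s.
split=> [|g Lg e e0]; first exact: l2P.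
have e0' : 0 < Num.sqrt e by rewrite sqrtr_gt0.
have [s Hs] := H (mkl2 Lg) _ e0'; exists s.
rewrite (E (mkl2 Lg)) lte_fin -[ltRHS](sqr_sqrtr (ltW e0)).
by rewrite ltr_pXn2r ?nnegrE ?nrm_ge0 ?(ltW e0').
Qed.

Definition nonvanishing (h : vect) : Prop := forall j, {ae mu, forall x,
  exists k : int, h (N%:R ^ k * x) (shift k j) <> 0}.

(** The indicator of a bounded piece of the set Z of points whose orbit lies in the zero set of W f
    is orthogonal, by [hatrep_orbit], to the transforms of all words applied to f. By density it is
    null, so Z has measure 0. *)
Lemma nonvanishing_of_cyclic (f : l2vect) : cyclic_vector N z f -> nonvanishing (W f).
Proof.
move=> /cyclic_vectorP H j.
pose Z := [set x | forall k : int, W f (N%:R ^ k * x) (shift k j) = 0].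
have mZ : measurable Z.
  apply: (measurable_forall_int (F := fun k : int =>
    [set x | W f (N%:R ^ k * x) (shift k j) = 0])) => k.
  apply: measurable_cmeas_eq0.
  have := cmeas_affine (N%:R ^ k) 0 (cL2_meas (l2P (W f) (shift k j))).
  by under [in X in X -> _]eq_fun do rewrite addr0.
have key (M : nat) : {ae mu, forall x, `|x| <= M%:R -> ~ Z x}.
  pose D := Z `&` `[- M%:R, M%:R].
  have mD : measurable D by apply: measurableI => //; exact: measurable_itv.
  have D2 : cL2 (fun x => (\1_D x)%:C : R[i]).
    apply/cL2P; split; first by apply: cmeas_real; exact: measurable_indic.
    rewrite (_ : (fun x => _) = (fun x => (\1_D x)%:E)); last first.
      apply/funext => x; rewrite normc_real indicE.
      by case: (x \in _); rewrite ?normr1 ?normr0 ?expr1n ?expr0n.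
    apply/integrableP; split; first by apply/measurable_EFinP; exact: measurable_indic.
    under eq_integral do rewrite gee0_abs ?lee_fin//.
    rewrite integral_indic// setIT.
    apply: le_lt_trans (le_measure mu _ _ (@subIsetr _ Z `[- M%:R, M%:R])) _.
    - exact/mem_set.
    - by rewrite inE; exact: measurable_itv.
    - exact: lebesgue_measure_cc_lty.
  pose g := mkl2 (L2_at_comp j D2).
  have g0 w : l2dot (W' g) (orb f w) = 0.
    rewrite -WW (eq_l2dot_ae (WVK WWV g) (aeeq_refl _)).
    have Lh := L2_hatrep N0 z1 w (l2P (W f)).
    rewrite (eq_l2dot_ae (aeeq_refl _) (W_orb f w : aeeq _ (mkl2 Lh))).
    apply: big1 => i _; rewrite -[RHS](@cintegral0 R); congr cintegral.
    apply/funext => x; rewrite /= /at_comp; case: eqP => [->|_]; last by rewrite mul0r.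
    have [k [c ->]] := hatrep_orbit z N0 w x j.
    rewrite indicE; case: (boolP (x \in D)) => [|_]; last by rewrite mul0r.
    by rewrite inE => -[Zx _]; rewrite Zx mulr0 conjCE conjc0 mulr0.
  have f0 : nrm (W' g) = 0.
    apply/eqP; rewrite eq_le nrm_ge0 andbT leNgt; apply/negP => fpos.
    have [s Hs] := H (W' g) _ fpos.
    have := cauchy_schwarz_Re (@l2_inner R p) (W' g) (W' g - lincomb (orb f) s).
    rewrite (ipBr (@l2_inner R p)) (_ : l2dot (W' g) (lincomb _ _) = 0).
      rewrite subr0 -(sqr_nrm (@l2_inner R p)) expr2 ler_pM2l//.
      by rewrite leNgt Hs.
    rewrite (ip_conj (@l2_inner R p)) (ip_suml (@l2_inner R p)) big1 ?conjc0// => c _.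
    by rewrite (ipZl (@l2_inner R p)) (ip_conj (@l2_inner R p)) g0 conjc0 mulr0.
  have : aeeq g (0 : l2vect).
    apply: aeeq_trans (aeeq_sym (WVK WWV g)) _; apply/nrm_aeeq.
    by rewrite subr0 (nrm_W WW).
  move=> /(_ j); apply: ae_impl => x; rewrite /= /at_comp eqxx indicE => gx xM Zx.
  have xD : x \in D by rewrite inE; split => //=; rewrite in_itv /= -ler_norml.
  by move: gx; rewrite xD => /eqP; rewrite oner_eq0.
have /ae_foralln := key; apply: ae_impl => x Hx.
apply: contrapT => nk; apply: (Hx (Num.bound `|x|)).
  by rewrite ltW// archi_boundP.
by move=> k; apply: contrapT => nz; apply: nk; exists k.
Qed.

(** If g is orthogonal to the orbit, then for each k the product of W g with the conjugate of W f
    taken k steps along the orbit has vanishing Fourier integrals, hence is 0. On almost every orbit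
    some k has W f nonzero, so W g vanishes. *)
Lemma cyclic_of_nonvanishing (f : l2vect) : nonvanishing (W f) -> cyclic_vector N z f.
Proof.
move=> nv; apply/cyclic_vectorP; apply: lincomb_dense.
- exact: l2_inner.
- exact: l2_complete.
move=> g g0; rewrite -(nrm_W WW).
have g0' w : dot (W g) (hatrep N z w (W f)) = 0.
  have Lh := L2_hatrep N0 z1 w (l2P (W f)).
  rewrite -[LHS]/(l2dot (W g) (mkl2 Lh)).
  rewrite -(eq_l2dot_ae (aeeq_refl _) (W_orb f w : aeeq _ (mkl2 Lh))).
  by rewrite WW; exact: g0.
have key j k : {ae mu, forall x, W g x j * conjc (W f (N%:R ^ k * x) (shift k j)) = 0}.
  have [u [c [c0 uE]]] := hat_dil_word z N0 k [::].
  pose h i x := W g x i * (hatrep N z u (W f) x i)^*.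
  have hi i : cintegrable (h i).
    apply: cL2_integrable; first exact: l2P.
    by have := L2_hatrep N0 z1 u (l2P (W f)); apply.
  have h0 : forall i, {ae mu, forall x, h i x = 0}.
    (* Dilating by N^(p n) does not move j, hence yields the scales N^(p n). *)
    apply: (fourier_unique hi z1 z_inj (L := fun n => N%:R ^+ (p * n))).
    - by move=> n; rewrite exprn_gt0// ltr0n.
    - move=> A; exists (Num.bound `|A|) => n An.
      rewrite (le_trans (ler_norm A))// (le_trans (ltW (archi_boundP (normr_ge0 A))))//.
      rewrite -natrX ler_nat (leq_trans An)//.
      rewrite (leq_trans (leq_pmull n (_ : 0 < p)%N))//; first by case: p j => [[]|].
      by rewrite ltnW// ltn_expl.
    - move=> n l; rewrite /annihilated.
      (* A character conjugated by the dilation by N^(p n), whose inverse is supplied by [w3]. The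
         power is -l because the second argument of [dot] is conjugated. *)
      have [w1 [c1 [c10 w1E]]] := hat_dil_word z N0 (p%:Z * n%:Z) u.
      have [w2 w2E] := hat_char_word N z (- l) w1.
      have [w3 [c3 [c30 w3E]]] := hat_dil_word z N0 (p%:Z * - n%:Z) w2.
      have := g0' w3; rewrite /dot.
      pose b := conjc (c1 * c3); have b_neq0 : b != 0 by rewrite conjc_eq0 mulf_neq0.
      have wE x i : (ecirc (x / N%:R ^+ (p * n)) * z i) != 0.
        by rewrite mulf_neq0 ?ecirc_neq0 ?z_neq0.
      have N1' x i : Normc.normc ((ecirc (x / N%:R ^+ (p * n)) * z i) ^ l) = 1.
        have := normc_hat z1 (x / N%:R ^+ (p * n)) i.
        by case: l {w2 w2E w3 w3E} => m E; rewrite /exprz ?Normc.normcV normc_exp E expr1n ?invr1.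
      have E x i : W g x i * (hatrep N z w3 (W f) x i)^* =
          b * (h i x * (ecirc (x / N%:R ^+ (p * n)) * z i) ^ l).
        have EN : N%:R ^ (p%:Z * - n%:Z) = (N%:R ^+ (p * n))^-1 :> R.
          by rewrite mulrN -PoszM -invr_expz.
        rewrite w3E w2E w1E !shift_mulp EN mulrA -PoszM -exprnP mulfV ?expf_neq0 ?N_neq0//.
        rewrite mul1r [_^-1 * x]mulrC.
        rewrite -invr_expz conj_unitV ?N1'// /h /b !conjCE !conjcM !conjcK; ring.
      under eq_bigr => i _ do (rewrite (_ : (fun x => _) = (fun x => b * (h i x *
        (ecirc (x / N%:R ^+ (p * n)) * z i) ^ l))); last by apply/funext => x; exact: E).
      rewrite (eq_bigr (fun i => b * cI (fun x => h i x *
        (ecirc (x / N%:R ^+ (p * n)) * z i) ^ l))).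
        by rewrite -mulr_sumr => /eqP; rewrite mulf_eq0 (negbTE b_neq0) => /eqP.
      move=> i _; rewrite cintegralZ//; apply: (cintegrable_mulb (C := 1)) => //.
        have mw : cmeas (fun x => ecirc (x / N%:R ^+ (p * n)) * z i).
          apply: cmeasM; last exact: cmeas_cst.
          have := @cmeas_ecircZ R (N%:R ^+ (p * n))^-1.
          by under [in X in X -> _]eq_fun do rewrite mulrC.
        by case: (l) => m; [|apply: cmeasV]; exact: cmeas_exp.
      by move=> x; rewrite N1'.
  apply: ae_impl (h0 j) => x; rewrite /h conjCE uE /= conjcM mulrCA => /eqP.
  by rewrite mulf_eq0 conjc_eq0 (negbTE c0) => /eqP.
suff /nrm_aeeq : aeeq (W g) (0 : l2vect) by rewrite subr0.
move=> j.
have : {ae mu, forall x (k : int), W g x j * conjc (W f (N%:R ^ k * x) (shift k j)) = 0}.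
  by apply: ae_forall_int => k; exact: key.
move=> /(ae_conj (nv j)); apply: ae_impl => x [[k /eqP nk] /(_ k) /eqP].
by rewrite mulf_eq0 conjc_eq0 (negbTE nk) orbF => /eqP.
Qed.

End Cyclicity.

(** * Spectral measures on the circle *)

Section Transfer.
Context d1 d2 (X : measurableType d1) (Y : measurableType d2) (R : realType).
Variables (mu : {measure set X -> \bar R}) (m : {measure set Y -> \bar R}).
Variables (I : finType) (y : I -> X -> Y) (rho : I -> X -> R).
Hypothesis my : forall i, measurable_fun setT (y i).
Hypothesis mrho : forall i, measurable_fun setT (rho i).
Hypothesis rho0 : forall i x, 0 <= rho i x.
Hypothesis mE : forall A, measurable A ->
  m A = (\sum_i \int[mu]_(x in y i @^-1` A) (rho i x)%:E)%E.

Import HBNNSimple.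

Let mpre i A : measurable A -> measurable (y i @^-1` A).
Proof. by move=> mA; rewrite -[_ @^-1` _]setTI; exact: my. Qed.

Let mErho i : measurable_fun setT (fun x => (rho i x)%:E).
Proof. exact/measurable_EFinP. Qed.

Let transfer_nnsfun (g : {nnsfun Y >-> R}) :
  (\int[m]_x (g x)%:E = \sum_i \int[mu]_x ((g (y i x))%:E * (rho i x)%:E))%E.
Proof.
have step i : (\int[mu]_x ((g (y i x))%:E * (rho i x)%:E) =
    \sum_(r \in range g) r%:E * \int[mu]_(x in y i @^-1` (g @^-1` [set r])) (rho i x)%:E)%E.
  transitivity (\int[mu]_x (\sum_(r \in range g)
      ((r * \1_(g @^-1` [set r]) (y i x))%:E * (rho i x)%:E)))%E.
    apply: eq_integral => x _; rewrite -ge0_mule_fsuml => [|r]; last exact: nnfun_muleindic_ge0.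
    by rewrite fsumEFin// -(fimfunE g (y i x)).
  have mind r : measurable_fun setT (fun x => \1_(g @^-1` [set r]) (y i x) : R).
    by apply: (measurableT_comp (measurable_indic _)).
  rewrite ge0_integral_fsum//; last 2 first.
    - move=> r; apply: emeasurable_funM => //; apply/measurable_EFinP.
      by apply: measurable_funM => //; exact: measurable_cst.
    - by move=> r x _; rewrite mule_ge0 ?lee_fin// -lee_fin nnfun_muleindic_ge0.
  apply: eq_fsbigr => r; rewrite inE => -[t _ gt].
  under eq_integral do rewrite EFinM -muleA.
  rewrite ge0_integralZl//; last 3 first.
    - by apply: emeasurable_funM => //; exact/measurable_EFinP.
    - by move=> x _; rewrite mule_ge0 ?lee_fin.
    - by rewrite lee_fin -gt.
  congr (_ * _)%E; rewrite [RHS]integral_mkcond; apply: eq_integral => x _.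
  rewrite patchE indicE (_ : (x \in _) = (y i x \in g @^-1` [set r])).
    by case: ifPn; rewrite ?mul1e ?mul0e.
  by apply/idP/idP; rewrite !inE.
have mg r : measurable (g @^-1` [set r]).
  by rewrite -[_ @^-1` _]setTI; apply: measurable_funP => //; exact: measurable_set1.
rewrite integralT_nnsfun sintegralE.
under [RHS]eq_bigr do rewrite step.
under eq_fsbigr => r _.
  rewrite mE//.
  over.
rewrite !fsbig_finite//=.
under [RHS]eq_bigr do rewrite fsbig_finite//=.
rewrite exchange_big /=; rewrite big_seq [RHS]big_seq; apply: eq_bigr => r _.
by rewrite ge0_sume_distrr// => i _; apply: integral_ge0 => x _; rewrite lee_fin.
Qed.

(** By [mE], m is the sum of the images under y_i of the measures with density rho_i. The formula
    holds for simple functions and passes to h by monotone convergence. *)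
Lemma ge0_transfer (h : Y -> \bar R) : measurable_fun setT h ->
  (forall t, 0 <= h t)%E ->
  (\int[m]_t h t = \sum_i \int[mu]_x (h (y i x) * (rho i x)%:E))%E.
Proof.
move=> mh h0; pose g := nnsfun_approx measurableT mh.
have gh t : (g n t)%:E @[n --> \oo] --> h t.
  by apply: (cvg_nnsfun_approx measurableT mh) => // s _; exact: h0.
have ndg t a b : (a <= b)%N -> g a t <= g b t.
  by move=> ab; exact/lefP/nd_nnsfun_approx.
have c1 : (\int[m]_t (g n t)%:E)%E @[n --> \oo] --> (\int[m]_t h t)%E.
  have -> : (\int[m]_t h t = \int[m]_t (limn (fun n => (g n t)%:E)))%E.
    by apply: eq_integral => t _; apply/esym/cvg_lim => //; exact: gh.
  apply: cvg_monotone_convergence => //.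
  - by move=> n; exact/measurable_EFinP.
  - by move=> n t _; rewrite lee_fin.
  - by move=> t _ a b ab; rewrite lee_fin; exact: ndg.
have c2 i : (\int[mu]_x ((g n (y i x))%:E * (rho i x)%:E))%E @[n --> \oo] -->
    (\int[mu]_x (h (y i x) * (rho i x)%:E))%E.
  have -> : (\int[mu]_x (h (y i x) * (rho i x)%:E) =
      \int[mu]_x (limn (fun n => (g n (y i x))%:E * (rho i x)%:E)))%E.
    apply: eq_integral => t _; apply/esym/cvg_lim => //.
    by apply: cvgeZr => //; exact: gh.
  apply: cvg_monotone_convergence => //.
  - move=> n; apply: emeasurable_funM => //; apply/measurable_EFinP.
    exact: (measurableT_comp _ (my i)).
  - by move=> n t _; rewrite mule_ge0 ?lee_fin.
  - move=> t _ a b ab; rewrite lee_wpmul2r ?lee_fin//; exact: ndg.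
have c3 : (\sum_i \int[mu]_x ((g n (y i x))%:E * (rho i x)%:E))%E @[n --> \oo] -->
    (\sum_i \int[mu]_x (h (y i x) * (rho i x)%:E))%E.
  apply: cvg_nnesum => // i _; apply: nearW => n.
  by apply: integral_ge0 => x _; rewrite mule_ge0 ?lee_fin.
apply: (cvg_unique _ c1 (_ : _ --> _)) => //.
by under eq_fun do rewrite transfer_nnsfun.
Qed.

Lemma Rintegral_transfer (u : Y -> R) : measurable_fun setT u ->
  (forall i, mu.-integrable setT (fun x => (u (y i x) * rho i x)%:E)) ->
  Rintegral m setT u = \sum_i Rintegral mu setT (fun x => u (y i x) * rho i x).
Proof.
move=> m_u iu; rewrite /Rintegral [X in fine X]integralE.
have mEu : measurable_fun setT (EFin \o u) by exact/measurable_EFinP.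
rewrite !ge0_transfer//; [|exact: measurable_funeneg|exact: measurable_funepos].
have posE i : (\int[mu]_x ((funepos (EFin \o u)) (y i x) * (rho i x)%:E) =
    \int[mu]_x (funepos (EFin \o (fun x => (u (y i x) * rho i x)%R)) x))%E.
  apply: eq_integral => x _; rewrite !funeposE /= -!EFin_max -EFinM.
  by rewrite maxr_pMl// mul0r.
have negE i : (\int[mu]_x ((funeneg (EFin \o u)) (y i x) * (rho i x)%:E) =
    \int[mu]_x (funeneg (EFin \o (fun x => (u (y i x) * rho i x)%R)) x))%E.
  apply: eq_integral => x _; rewrite !funenegE /= -!EFin_max -EFinM.
  by rewrite maxr_pMl// mul0r mulNr.
under eq_bigr do rewrite posE.
under [X in (_ - X)%E]eq_bigr do rewrite negE.
have fp i : (\int[mu]_x funepos (EFin \o (fun x => (u (y i x) * rho i x)%R)) x)%E \is a fin_num.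
  by apply: integrable_fin_num => //; apply: integrable_funepos => //; exact: iu.
have fn i : (\int[mu]_x funeneg (EFin \o (fun x => (u (y i x) * rho i x)%R)) x)%E \is a fin_num.
  by apply: integrable_fin_num => //; apply: integrable_funeneg => //; exact: iu.
rewrite fineB ?sum_fin_num//; [|by apply/allP => _ /mapP[i _ ->]; exact: fp|by apply/allP => _ /mapP[i _ ->]; exact: fn].
rewrite -!sum_fine// -sumrB; apply: eq_bigr => i _.
by rewrite -fineB// -integralE.
Qed.

End Transfer.

Section Frac.
Variable R : realType.

Definition frac (x : R) : R := x - (Num.floor x)%:~R.

Lemma measurable_frac : measurable_fun setT frac.
Proof.
apply: measurable_funB => //; apply: nondecreasing_measurable => // x y xy.
by rewrite ler_int le_floor.
Qed.

Lemma frac_itv (x : R) : frac x \in `[0, 1[.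
Proof.
rewrite in_itv /= /frac subr_ge0 floor_le_tmp /=.
by rewrite ltrBlDl -intrD1 floorD1_gt.
Qed.

Lemma ecirc_int (k : int) : ecirc (k%:~R : R) = 1.
Proof.
have := ecirc_exprz (1 : R) k; rewrite mulr1 => <-; rewrite ecirc1.
by case: k => n; rewrite /exprz expr1n ?invr1.
Qed.

Lemma ecirc_frac (x : R) : ecirc (frac x) = ecirc x.
Proof.
have H : ecirc (- (Num.floor x)%:~R) = 1 :> R[i] by rewrite -mulrNz ecirc_int.
by rewrite /frac ecircD H mulr1.
Qed.

End Frac.

Section CircleMeasure.
Variables (R : realType) (p : nat) (th : 'I_p -> R).
Local Notation mu := (@lebesgue_measure R).
Local Notation cI u := (cintegral mu setT u).

(** The parameter in [0, 1[ of the point e(x) z_j when th_j is chosen over z_j; see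
    [ecirc_angle]. *)
Definition angle (j : 'I_p) (x : R) : R := frac (x + th j).

Lemma measurable_angle j : measurable_fun setT (angle j).
Proof.
have H : measurable_fun setT (fun x : R => x + th j) by exact: measurable_funD.
have := measurableT_comp (@measurable_frac R) H.
by apply.
Qed.

Lemma measurable_angle_pre j (A : set R) : measurable A -> measurable (angle j @^-1` A).
Proof. by move=> mA; rewrite -[_ @^-1` _]setTI; exact: measurable_angle. Qed.

Lemma ecirc_angle j x : ecirc (angle j x) = ecirc x * ecirc (th j).
Proof. by rewrite /angle ecirc_frac ecircD. Qed.

Section Measure.
Variable F : l2vect R p.

Definition density j x : R := Normc.normc (F x j) ^+ 2.

Lemma density_ge0 j x : 0 <= density j x. Proof. exact: sqr_ge0. Qed.

Lemma integrable_density j : mu.-integrable setT (fun x => (density j x)%:E).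
Proof. by have /cL2P[] := l2P F j. Qed.

Lemma measurable_density j : measurable_fun setT (density j).
Proof. by apply/measurable_EFinP; exact: measurable_int (integrable_density j). Qed.

(* The spectral measure of the vector with transform F: the image of |F|^2 under
   (x, j) |-> x + th j mod 1. *)
Definition circ_meas (A : set (measurableTypeR R)) : \bar R :=
  (\sum_(j < p) \int[mu]_(x in angle j @^-1` A) (density j x)%:E)%E.

Let circ_meas0 : circ_meas set0 = 0%E.
Proof. by rewrite /circ_meas big1// => j _; rewrite preimage_set0 integral_set0. Qed.

Let circ_meas_ge0 A : (0 <= circ_meas A)%E.
Proof.
by apply: sume_ge0 => j _; apply: integral_ge0 => x _; rewrite lee_fin density_ge0.
Qed.

Let circ_meas_sigma_additive : semi_sigma_additive circ_meas.
Proof.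
move=> A mA tA mUA; rewrite /circ_meas.
under eq_fun do rewrite exchange_big /=.
apply: cvg_nnesum => j _.
  by apply: nearW => n; apply: sume_ge0 => i _; apply: integral_ge0 => x _; rewrite lee_fin density_ge0.
rewrite preimage_bigcup ge0_integral_bigcup.
- apply: is_cvg_nneseries => n _ _.
  by apply: integral_ge0 => x _; rewrite lee_fin density_ge0.
- by move=> k; apply: (measurable_angle_pre j (A := A k)); exact: mA.
- by apply: measurable_funTS; apply/measurable_EFinP; exact: measurable_density.
- by move=> x _; rewrite lee_fin density_ge0.
- by move=> a b _ _ [x [Ax Bx]]; apply: tA => //; exists (angle j x).
Qed.

HB.instance Definition _ := isMeasure.Build _ _ _ circ_meas
  circ_meas0 circ_meas_ge0 circ_meas_sigma_additive.

End Measure.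

Lemma cintegral_circle (F : l2vect R p) (m : {measure set (measurableTypeR R) -> \bar R})
    (h : R -> R[i]) :
  (forall A, measurable A -> m A = circ_meas F A) -> cmeas h ->
  (forall j, cintegrable (fun x => h (angle j x) * (density F j x)%:C)) ->
  cintegral m `[0, 1[ h = \sum_(j < p) cI (fun x => h (angle j x) * (density F j x)%:C).
Proof.
move=> mE [h1 h2] ih.
have key (u : R -> R) : measurable_fun setT u ->
    (forall j, mu.-integrable setT (fun x => (u (angle j x) * density F j x)%:E)) ->
    Rintegral m `[0, 1[ u = \sum_j Rintegral mu setT (fun x => u (angle j x) * density F j x).
  (* Restricting u to [0, 1[ changes nothing on the right, since [angle] takes its values there. *)
  move=> m_u iu; pose v := u \_ (`[0, 1[%classic : set R).
  have vE j x : v (angle j x) = u (angle j x).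
    by rewrite /v patchE mem_set//; exact: frac_itv.
  transitivity (Rintegral m setT v).
    by rewrite /Rintegral integral_mkcond restrict_EFin.
  rewrite (@Rintegral_transfer _ _ (measurableTypeR R) (measurableTypeR R) _ mu m _ _ _
    measurable_angle (measurable_density F) (density_ge0 F) mE).
  - by apply: eq_bigr => j _; congr Rintegral; apply/funext => x; rewrite vE.
  - apply/(measurable_restrictT _ _).1 => //.
    exact: measurable_funTS.
  - by move=> j; under eq_fun do rewrite vE; exact: iu.
apply: eq_ReIm.
- rewrite raddf_sum /= key//.
    apply: eq_bigr => j _; congr Rintegral; apply/funext => x.
    by rewrite Re_mul /= mulr0 subr0.
  move=> j; have [i1 _] := ih j; move: i1.
  by under eq_fun do rewrite Re_mul /= mulr0 subr0.
- rewrite raddf_sum /= key//.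
    apply: eq_bigr => j _; congr Rintegral; apply/funext => x.
    by rewrite Im_mul /= mulr0 add0r.
  move=> j; have [_ i1] := ih j; move: i1.
  by under eq_fun do rewrite Im_mul /= mulr0 add0r.
Qed.

End CircleMeasure.

Section Totalize.
Variables (R : realType) (p : nat).
Local Notation vect := (vect R p).
Local Notation l2vect := (l2vect R p).
Local Notation nrm := (nrm (@l2dot R p)).

(** Operators in [pvm] and [functional_calculus] act on bare functions while W acts on [l2vect];
    functions outside L^2 are sent to 0. *)
Definition tol2 (f : vect) : l2vect :=
  if pselect (L2 f) is left Lf then mkl2 Lf else 0.

Lemma tol2E (f : vect) : L2 f -> l2fun (tol2 f) = f.
Proof. by rewrite /tol2; case: pselect. Qed.

Lemma tol2K (f : l2vect) : tol2 f = f.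
Proof. by apply: val_inj; apply: tol2E; exact: l2P. Qed.

Lemma nrm_le_pointwise (F G : l2vect) :
  (forall x j, Normc.normc (F x j) <= Normc.normc (G x j)) -> nrm F <= nrm G.
Proof.
move=> FG; rewrite -(ler_pXn2r (_ : 0 < 2)%N)// ?nnegrE ?nrm_ge0//.
rewrite -lee_fin -!sqnorm_l2; apply: lee_sum => j _.
apply: ge0_le_integral => //.
- by move=> x _; rewrite lee_fin sqr_ge0.
- by have /cL2P[_ /measurable_int] := l2P F j.
- by have /cL2P[_ /measurable_int] := l2P G j.
- by move=> x _; rewrite lee_fin lerXn2r ?nnegrE ?normc_ge0.
Qed.

Lemma nrm_repT (z : 'I_p -> R[i]) (f : l2vect) : (forall j, Normc.normc (z j) = 1) ->
  nrm (mkl2 (L2_repT z (l2P f))) = nrm f.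
Proof.
move=> z1; congr (Num.sqrt (complex.Re _)); rewrite /l2dot dot_repT//; try exact: l2P.
congr dot; apply/funext => x; apply/funext => j /=.
by rewrite /repTV /repT addrK mulKf// z_neq0.
Qed.

End Totalize.

Lemma cintegrable_ae (R : realType) (u v : R -> R[i]) : cintegrable u -> cmeas v ->
  {ae @lebesgue_measure R, forall x, v x = u x} -> cintegrable v.
Proof.
move=> [i1 i2] [m1 m2] uv.
have H (c : R[i] -> R) : measurable_fun setT (fun x => c (v x)) ->
    lebesgue_measure.-integrable setT (fun x => (c (u x))%:E) ->
    lebesgue_measure.-integrable setT (fun x => (c (v x))%:E).
  move=> mc ic; apply/integrableP; split; first exact/measurable_EFinP.
  have /integrableP[mu_ ] := ic; apply: le_lt_trans.
  rewrite le_eqVlt; apply/orP; left; apply/eqP; apply: ae_eq_integral => //.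
  - by apply: measurableT_comp => //; exact/measurable_EFinP.
  - exact: measurableT_comp.
  - by apply: ae_impl uv => x -> _.
by split; exact: H.
Qed.

Section SineSign.
Variable R : realType.

(** The left-hand side compares y with the endpoints by their distance to the midpoint of the arc:
    negative inside the arc, positive outside. The factorisation lets this sign be read off from two
    sines. *)
Lemma cos_arcE (a b y : R) :
  cos (pi * (b - a)) - cos (2 * pi * (y - (a + b) / 2)) =
  2 * (sin (pi * (y - a)) * sin (pi * (y - b))).
Proof.
have -> : pi * (b - a) = pi * (y - a) - pi * (y - b) by ring.
have -> : 2 * pi * (y - (a + b) / 2) = pi * (y - a) + pi * (y - b) by field.
by rewrite cosB cosD; ring.
Qed.

Lemma sin_pi_gt0 (y : R) : 0 < y < 1 -> 0 < sin (pi * y).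
Proof.
move=> /andP[y0 y1]; have p0 := pi_gt0 R; apply: sin_gt0_pi.
by apply/andP; split; nra.
Qed.

Lemma sin_pi_lt0 (y : R) : -1 < y < 0 -> sin (pi * y) < 0.
Proof.
move=> /andP[y0 y1]; rewrite -oppr_gt0 -sinN -mulrN sin_pi_gt0//.
by apply/andP; split; lra.
Qed.

End SineSign.

Lemma sqr_normc_sub_unit (R : realType) (u v : R[i]) :
  Normc.normc u = 1 -> Normc.normc v = 1 ->
  Normc.normc (u - v) ^+ 2 = 2 - 2 * complex.Re (conjc v * u).
Proof.
move=> /(congr1 (fun t => t ^+ 2)); rewrite sqr_normc expr1n => u1.
move=> /(congr1 (fun t => t ^+ 2)); rewrite sqr_normc expr1n => v1.
rewrite sqr_normc Re_mul; move: u v u1 v1 => [a b] [c d] /=; lra.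
Qed.

Lemma RtoCD (R : realType) (x y : R) : (x + y)%:C = x%:C + y%:C :> R[i].
Proof. by rewrite rmorphD. Qed.

Section Truncate.
Variables (R : realType) (p : nat) (z : 'I_p -> R[i]) (th : 'I_p -> R).
Local Notation mu := (@lebesgue_measure R).
Hypothesis thz : forall j, ecirc (th j) = z j.
Variables (m : R[i] -> R[i]) (C : R).

(** The symbol m is bounded by C only almost everywhere, while [L2_mulb] asks for a bound at every
    point; by [truncate_ae] the change is invisible. *)
Definition truncate (w : R[i]) : R[i] := if Normc.normc (m w) <= C then m w else 0.

Let wE x j : ecirc x * z j = ecirc (1 * x + th j).
Proof. by rewrite mul1r ecircD thz. Qed.

Hypothesis C0 : 0 <= C.

Lemma truncate_le w : Normc.normc (truncate w) <= C.
Proof. by rewrite /truncate; case: ifP => //; rewrite Normc.normc0. Qed.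

Hypothesis mm : cmeas (fun x => m (ecirc x)).

Lemma cmeas_truncate_hat j : cmeas (fun x => truncate (ecirc x * z j)).
Proof.
have mm' : cmeas (fun x => truncate (ecirc x)).
  apply: cmeas_if => //.
  by apply: measurable_fun_ler => //; exact: cmeas_norm.
by under eq_fun do rewrite wE; exact: (cmeas_affine 1 (th j) mm').
Qed.

Hypothesis mC : {ae mu, forall x, Normc.normc (m (ecirc x)) <= C}.

Lemma truncate_ae j : {ae mu, forall x, m (ecirc x * z j) = truncate (ecirc x * z j)}.
Proof.
have := ae_affine (th j) (oner_neq0 R) mC; apply: ae_impl => x.
by rewrite wE /truncate => ->.
Qed.

(** Links the weak definition of m(T) to multiplication by m(w) on the transform side, once the
    scalar spectral measures are known to be [circ_meas]. *)
Lemma cintegral_multiplier (F : l2vect R p)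
    (nu : {measure set (measurableTypeR R) -> \bar R}) :
  (forall A, measurable A -> nu A = circ_meas th F A) ->
  cintegral nu `[0, 1[ (fun x => m (ecirc x)) =
  dot (fun x j => truncate (ecirc x * z j) * F x j) F.
Proof.
move=> nuE.
have mden j : cmeas (fun x => (density F j x)%:C).
  by apply: cmeas_real; exact: measurable_density.
have imE j : cintegrable (fun x => truncate (ecirc x * z j) * (density F j x)%:C).
  apply: (cintegrable_dom (g := fun x => C * density F j x)).
  - by apply: cmeasM => //; exact: cmeas_truncate_hat.
  - apply: (@eq_integrable _ _ _ mu setT measurableT (fun x => C%:E * (density F j x)%:E)%E) => //.
    by apply: integrableZl => //; exact: integrable_density.
  - move=> x; rewrite Normc.normcM normc_real ger0_norm ?density_ge0//.
    by rewrite ler_wpM2r ?density_ge0// truncate_le.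
have imm j : cmeas (fun x => m (ecirc (angle th j x)) * (density F j x)%:C).
  apply: cmeasM => //.
  under eq_fun do rewrite ecirc_angle thz wE.
  exact: (cmeas_affine 1 (th j) mm).
rewrite (@cintegral_circle _ _ th F) => //; last first.
  move=> j; apply: (cintegrable_ae (imE j) (imm j)).
  by apply: ae_impl (truncate_ae j) => x; rewrite ecirc_angle thz => ->.
apply: eq_bigr => j _; apply: eq_cintegral_ae.
- exact: imm.
- apply: cmeasM; first by apply: cmeasM; [exact: cmeas_truncate_hat|exact: cL2_meas (l2P F j)].
  exact/cmeas_conj/cL2_meas/l2P.
apply: ae_impl (truncate_ae j) => x /=; rewrite ecirc_angle thz => ->.
by rewrite /density -mulcJ mulrA.
Qed.

End Truncate.

(** * Uniqueness of the spectral measure of T *)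

Section PvmUnique.
Variables (R : realType) (p : nat) (z : 'I_p -> R[i]) (th : 'I_p -> R).
Local Notation mu := (@lebesgue_measure R).
Local Notation cI u := (cintegral mu setT u).
Local Notation vect := (vect R p).
Local Notation l2vect := (l2vect R p).
Local Notation D := (@l2dot R p).
Local Notation nrm := (nrm (@l2dot R p)).
Local Notation HD := (@l2_inner R p).
Hypothesis z1 : forall j, Normc.normc (z j) = 1.
Hypothesis thz : forall j, ecirc (th j) = z j.
Variables (W W' : l2vect -> l2vect).
Hypothesis WW : forall f g, l2dot (W f) (W g) = l2dot f g.
Hypothesis WWV : forall g, nrm (W (W' g) - g) = 0.
Hypothesis Wstep : forall i, nrm (W (step_fam i) - hat_fam i) = 0.
Variable E : pvm R p.

Definition pproj (A : set (measurableTypeR R)) (f : l2vect) : l2vect := tol2 (pvm_proj E A f).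
Local Notation P := pproj.

Lemma pprojE (A : set (measurableTypeR R)) (mA : measurable A) f :
  l2fun (P A f) = pvm_proj E A f.
Proof.
by apply: tol2E; have [+ _ _] := pvm_bounded E mA; apply; exact: l2P.
Qed.

#[local] Opaque pproj.

Section Proj.
Variable A : set (measurableTypeR R).
Hypothesis mA : measurable A.

Lemma pproj_adj f g : D (P A f) g = D f (P A g).
Proof. by rewrite /l2dot !(pprojE mA) (pvm_adj E mA (l2P f) (l2P g)). Qed.

Lemma pproj_idem f : nrm (P A (P A f) - P A f) = 0.
Proof. by apply/nrm_aeeq; rewrite !(pprojE mA); exact: (pvm_idem E mA (l2P f)). Qed.

Lemma pproj_lin c f g h : D (P A (c *: f + g)) h = c * D (P A f) h + D (P A g) h.
Proof.
rewrite -(ip_linear HD); apply: eq_l2dot_ae (aeeq_refl _).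
rewrite (pprojE mA); have [_ H _] := pvm_bounded E mA.
have := H c f g (l2P f) (l2P g).
by rewrite -!(pprojE mA); apply.
Qed.

Lemma pproj_sqr f : D (P A f) f = (nrm (P A f) ^+ 2)%:C.
Proof.
rewrite -(ip_nrm HD) -[RHS]pproj_adj.
by have /(nrm_subP HD) -> := pproj_idem f.
Qed.

Lemma pvm_meas_sqr (f : l2vect) : pvm_meas E f A = (nrm (P A f) ^+ 2)%:E.
Proof.
rewrite (pvm_measE E mA (l2P f)) -(pprojE mA).
by rewrite -[dot _ _]/(D (P A f) f) pproj_sqr.
Qed.

Lemma pproj_le f : nrm (P A f) ^+ 2 <= nrm f ^+ 2.
Proof.
have := cauchy_schwarz_Re HD (P A f) f; rewrite pproj_sqr /=.
have := nrm_ge0 D (P A f); have := nrm_ge0 D f.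
set s := nrm (P A f); set t := nrm f => t0 s0 st.
have [->|s_neq0] := eqVneq s 0; first by rewrite expr0n sqr_ge0.
have : s <= t by rewrite -(ler_pM2l (_ : 0 < s)) ?lt0r ?s_neq0// -expr2.
by move=> ?; rewrite ler_pXn2r// nnegrE.
Qed.

Lemma pproj_ext f g : nrm (f - g) = 0 -> nrm (P A f - P A g) = 0.
Proof.
move=> /(nrm_subP HD) fg; apply/(nrm_subP HD) => h.
by rewrite !pproj_adj fg.
Qed.

End Proj.

Lemma pproj_itv01 f : nrm (P `[0, 1[ f - f) = 0.
Proof.
have m01 : measurable (`[0, 1[%classic : set (measurableTypeR R)) by exact: measurable_itv.
apply/nrm_aeeq; rewrite (pprojE m01); exact: (pvm_id E (l2P f)).
Qed.

Section Disjoint.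
Variables A B : set (measurableTypeR R).
Hypotheses (mA : measurable A) (mB : measurable B) (AB : A `&` B = set0).

Lemma sqr_nrm_pprojU f : nrm (P (A `|` B) f) ^+ 2 = nrm (P A f) ^+ 2 + nrm (P B f) ^+ 2.
Proof.
have mAB : measurable (A `|` B) by exact: measurableU.
have : pvm_meas E f (A `|` B) = (pvm_meas E f A + pvm_meas E f B)%E by exact: measureU.
by rewrite (pvm_meas_sqr mA) (pvm_meas_sqr mB) (pvm_meas_sqr mAB) -EFinD => -[].
Qed.

(** Additivity is built into the scalar measures <E f, f>; polarization lifts it to the
    projections. *)
Lemma pprojU f : nrm (P (A `|` B) f - (P A f + P B f)) = 0.
Proof.
have mAB : measurable (A `|` B) by exact: measurableU.
apply: (polarization HD (A := P (A `|` B)) (B := fun f => P A f + P B f)).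
- exact: pproj_lin.
- by move=> c g h k; rewrite !(ipDl HD) (pproj_lin mA) (pproj_lin mB) mulrDr addrACA.
- move=> g; apply: etrans (pproj_sqr mAB g) _; rewrite sqr_nrm_pprojU RtoCD.
  apply: esym; apply: etrans (ipDl HD _ _ _) _.
  by congr (_ + _); [exact: (pproj_sqr mA)|exact: (pproj_sqr mB)].
Qed.

(** The projection of the union cannot increase the norm of P B f, yet by additivity it gives |P A
    (P B f)|^2 + |P B f|^2. *)
Lemma pproj_disjoint f : nrm (P A (P B f)) = 0.
Proof.
have mAB : measurable (A `|` B) by exact: measurableU.
have := pproj_le mAB (P B f); rewrite [X in X <= _](sqr_nrm_pprojU (P B f)).
rewrite (nrm_subr0 HD (pproj_idem mB f)) -lerBrDr subrr => H.
by apply/eqP; rewrite -sqrf_eq0 eq_le H sqr_ge0.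
Qed.

End Disjoint.

Hypothesis HE : spectral_integral E (@ecirc R) (repT z).

Let Tl (f : l2vect) := mkl2 (L2_repT z (l2P f)).

(** As T is isometric, the left side is 2 |g|^2 - 2 int r dm with r(x) = Re(conj(e(x0)) e(x)), where
    g = P B f. The scalar measure m of g lives on B, and there |e(x) - e(x0)| <= 2 pi d means r >= 1
    - (2 pi d)^2 / 2. *)
Lemma arc_bound (B : set R) (x0 d : R) f : measurable B -> B `<=` `[0, 1[ ->
  (forall x, B x -> `|x - x0| <= d) ->
  nrm (Tl (P B f) - ecirc x0 *: P B f) ^+ 2 <= (2 * pi * d) ^+ 2 * nrm (P B f) ^+ 2.
Proof.
move=> mB B01 Bd; set g := P B f; set m := pvm_meas E g.
have m01 : measurable (`[0, 1[%classic : set (measurableTypeR R)) by exact: measurable_itv.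
have mE01 : m (`[0, 1[%classic : set R) = (nrm g ^+ 2)%:E.
  by rewrite /m (pvm_meas_sqr m01) (nrm_subr0 HD (pproj_itv01 g)).
have mB0 : m (~` B) = 0%E.
  rewrite /m pvm_meas_sqr; last exact: measurableC.
  by rewrite pproj_disjoint ?expr0n ?setICl//; exact: measurableC.
have TE : D (Tl g) g = cintegral m `[0, 1[ (@ecirc R) by have [_] := HE; apply; exact: l2P.
rewrite (sqr_nrmB HD) (nrm_repT g z1) (nrmZ HD) normc_ecirc mul1r.
rewrite (ipZr HD) TE.
pose r x : R := complex.Re (conjc (ecirc x0) * ecirc x).
pose c : R := 1 - (2 * pi * d) ^+ 2 / 2.
have iu (u : R -> R) : measurable_fun setT u -> (exists M : R, forall x, `|u x| <= M) ->
    m.-integrable `[0, 1[ (EFin \o u).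
  move=> mu_ [M uM]; apply: measurable_bounded_integrable => //.
  - by rewrite mE01 ltry.
  - exact: measurable_funTS.
  - exists M; split; first exact: num_real.
    by move=> a Ma x _; apply: (le_trans (uM x)); exact: ltW.
have rE x : r x = complex.Re (ecirc x0) * cos (2 * pi * x) - complex.Im (ecirc x0) * sin (2 * pi * x).
  by rewrite /r Re_mul Re_conj Im_conj re_ecirc im_ecirc [X in _ - X]mulrNN.
have mcos : measurable_fun setT (fun x : R => cos (2 * pi * x)) by case: (cmeas_ecirc R).
have msin : measurable_fun setT (fun x : R => complex.Im (ecirc x)) by case: (cmeas_ecirc R).
have mr : measurable_fun setT r.
  by case: (cmeasM (cmeas_cst (conjc (ecirc x0))) (cmeas_ecirc R)).
have rb : exists M : R, forall x, `|r x| <= M.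
  exists 1 => x; rewrite (le_trans (normr_Re_le _))// Normc.normcM normcJ !normc_ecirc mulr1//.
have -> : complex.Re ((ecirc x0)^* * cintegral m `[0, 1[ (@ecirc R)) =
    Rintegral m `[0, 1[ r.
  have bcos : exists M : R, forall x : R, `|cos (2 * pi * x)| <= M.
    exists 1 => x; rewrite -re_ecirc (le_trans (normr_Re_le _))// normc_ecirc//.
  have bsin : exists M : R, forall x : R, `|complex.Im (ecirc x)| <= M.
    exists 1 => x; rewrite (le_trans (normr_Im_le _))// normc_ecirc//.
  rewrite conjCE Re_mul Re_conj Im_conj /cintegral.
  rewrite -/(complex.Re (ecirc x0)).
  rewrite -RintegralZl//; last exact: iu.
  rewrite -RintegralZl//; last exact: iu.
  rewrite -RintegralB//; last 2 first.
    by apply: (integrableZl m01 _ (iu _ mcos bcos)).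
    by apply: (integrableZl m01 _ (iu _ msin bsin)).
suff : c * nrm g ^+ 2 <= Rintegral m `[0, 1[ r.
  rewrite /c; set s := nrm g ^+ 2; set t := (2 * pi * d) ^+ 2; lra.
have -> : c * nrm g ^+ 2 = Rintegral m `[0, 1[ (cst c).
  by rewrite Rintegral_cst// mE01.
rewrite -subr_ge0 -RintegralB//; last 2 first.
  exact: iu.
  by apply: iu; [exact: measurable_cst|exists `|c|].
(* The positive part agrees with r - c on B, which carries m, and has an evidently nonnegative
   integral. *)
pose k x : R := Num.max 0 (r x - c).
have mk : measurable_fun setT k.
  by apply: measurable_maxr => //; apply: measurable_funB.
suff IE : (\int[m]_(x in `[0%R, 1%R[) (r x - c)%R%:E = \int[m]_(x in `[0%R, 1%R[) (k x)%:E)%E.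
  rewrite /Rintegral [X in fine X]IE; apply: fine_ge0.
  by apply: integral_ge0 => x _; rewrite lee_fin le_max lexx.
apply: ae_eq_integral => //.
- by apply/measurable_EFinP/measurable_funTS/measurable_funB.
- by apply/measurable_EFinP/measurable_funTS.
exists (~` B); split => //; first exact: measurableC.
move=> x /= /existsNP[x01 neq] Bx; apply: neq; congr EFin.
rewrite /k /Num.max; case: ltP => //; rewrite le_eqVlt => /orP[/eqP->//|].
suff : c <= r x by move=> ? ?; lra.
have := normc_ecirc_sub x x0; have := Bd x Bx.
have := sqr_normc_sub_unit (normc_ecirc x) (normc_ecirc x0); rewrite -/(r x).
set s := Normc.normc _; set t := `|x - x0| => sE td st.
have s0 : 0 <= s by exact: normc_ge0.
have p0 := pi_gt0 R; have : s <= 2 * pi * d by rewrite (le_trans st)// ler_pM2l// mulr_gt0.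
move=> sd; have : s ^+ 2 <= (2 * pi * d) ^+ 2.
  by apply: lerXn2r => //; rewrite nnegrE (le_trans s0).
rewrite sE /c; lra.
Qed.

Lemma itv_co_split (a b c : R) : a <= b -> b <= c ->
  (`[a, c[ = `[a, b[ `|` `[b, c[)%classic.
Proof.
move=> ab bc; apply/seteqP; split=> x /=; rewrite !in_itv /=.
  by move=> /andP[-> ->]; rewrite andbT; have [|] := ltP x b; [left|right].
by move=> [] /andP[x1 x2]; apply/andP; split => //; [exact: lt_le_trans bc|exact: le_trans x1].
Qed.

Lemma itv_co_disj (a b c : R) : (`[a, b[ `&` `[b, c[ = set0)%classic.
Proof.
apply/seteqP; split=> x //= []; rewrite !in_itv /= => /andP[_ xb] /andP[bx _].
by move: xb; rewrite ltNge bx.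
Qed.

Lemma pproj_itv_split (a b c : R) f : a <= b -> b <= c ->
  nrm (P `[a, c[ f) ^+ 2 = nrm (P `[a, b[ f) ^+ 2 + nrm (P `[b, c[ f) ^+ 2 /\
  aeeq (W (P `[a, c[ f)) (fun x j => W (P `[a, b[ f) x j + W (P `[b, c[ f) x j).
Proof.
move=> ab bc; have mi u v : measurable (`[u, v[%classic : set (measurableTypeR R)).
  exact: measurable_itv.
have H1 := sqr_nrm_pprojU (mi a b) (mi b c) (itv_co_disj a b c) f.
have H2 := pprojU (mi a b) (mi b c) (itv_co_disj a b c) f.
split; first by rewrite (itv_co_split ab bc).
rewrite (itv_co_split ab bc).
have /(W_ext WW) H3 : aeeq (P (`[a, b[ `|` `[b, c[)%classic f) (P `[a, b[ f + P `[b, c[ f).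
  by apply/nrm_aeeq.
apply: aeeq_trans H3 _ => j.
have := W_lin WW 1 (P `[a, b[ f) (P `[b, c[ f) j; rewrite scale1r.
by apply: ae_impl => x ->; rewrite mul1r.
Qed.

Lemma arc_partition (a h : R) (n : nat) f : 0 <= h ->
  aeeq (W (P `[a, a + n%:R * h[ f))
       (\sum_(i < n) W (P `[a + i%:R * h, a + i.+1%:R * h[ f) : l2vect) /\
  nrm (P `[a, a + n%:R * h[ f) ^+ 2 =
    \sum_(i < n) nrm (P `[a + i%:R * h, a + i.+1%:R * h[ f) ^+ 2.
Proof.
move=> h0; elim: n => [|n [IH1 IH2]].
  have e0 : nrm (P `[a, a + 0%:R * h[ f) = 0.
    have m0 : measurable (set0 : set (measurableTypeR R)) by exact: measurable0.
    rewrite mul0r addr0 set_itvco0.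
    have := pvm_meas_sqr m0 f; rewrite measure0 => /esym[/eqP].
    by rewrite sqrf_eq0 => /eqP.
  rewrite !big_ord0 e0 expr0n; split => //; apply/nrm_aeeq.
  by rewrite subr0 (nrm_W WW).
have ab : a <= a + n%:R * h by rewrite lerDl mulr_ge0.
have bc : a + n%:R * h <= a + n.+1%:R * h by rewrite lerD2l ler_wpM2r// ler_nat.
have [H1 H2] := pproj_itv_split f ab bc.
split; last by rewrite big_ord_recr -IH2; exact: H1.
rewrite big_ord_recr; apply: aeeq_trans H2 _ => j; apply: ae_impl (IH1 j) => x ->.
rewrite -[in RHS](scale1r (\sum_(i < n) _)) [RHS]l2_linE.
by rewrite mul1r.
Qed.

(* Positive off the arc from a to b, and at most the distance to that arc. *)
Definition arc_weight (a b : R) (x : R) (j : 'I_p) : R :=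
  Num.max 0 (cos (pi * (b - a)) - complex.Re (conjc (ecirc ((a + b) / 2)) * (ecirc x * z j))).

Lemma arc_weightE a b x j : arc_weight a b x j =
  Num.max 0 (2 * (sin (pi * (angle th j x - a)) * sin (pi * (angle th j x - b)))).
Proof.
rewrite /arc_weight -thz -ecirc_angle -cos_arcE; congr (Num.max 0 (_ - _)).
by rewrite -ecircN -ecircD re_ecirc addrC.
Qed.

Lemma cmeas_arc_weight a b j : cmeas (fun x => (arc_weight a b x j)%:C).
Proof.
apply: cmeas_real; apply: measurable_maxr => //; apply: measurable_funB => //.
by case: (cmeasM (cmeas_cst (conjc (ecirc ((a + b) / 2)))) (cmeas_hat z j)).
Qed.

Lemma arc_weight_le a b x j : Normc.normc (arc_weight a b x j)%:C <= 2.
Proof.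
rewrite normc_real ger0_norm; last by rewrite /arc_weight le_max lexx.
rewrite ge_max; apply/andP; split => //.
have := normr_Re_le (conjc (ecirc ((a + b) / 2)) * (ecirc x * z j)).
rewrite !Normc.normcM normcJ !normc_ecirc z1 !mulr1 ler_norml => /andP[+ _].
have := cos_le1 (pi * (b - a)); lra.
Qed.

(** At y in the arc the difference that defines the weight is at most 0 by [cos_arcE], and the real
    part is 1-Lipschitz on the circle. *)
Lemma arc_weight_lip a b x j y : 0 <= a -> a <= y -> y <= b -> b <= 1 ->
  arc_weight a b x j <= Normc.normc (ecirc x * z j - ecirc y).
Proof.
move=> a0 ay yb b1.
have y0 : 2 * (sin (pi * (y - a)) * sin (pi * (y - b))) <= 0.
  rewrite pmulr_rle0// mulr_ge0_le0//.
    by rewrite sin_ge0_pi//; have p0 := pi_gt0 R; apply/andP; split; nra.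
  rewrite -oppr_ge0 -sinN -mulrN sin_ge0_pi//.
  by have p0 := pi_gt0 R; apply/andP; split; nra.
set al := conjc (ecirc ((a + b) / 2)).
have al_y : complex.Re (al * ecirc y) = cos (2 * pi * (y - (a + b) / 2)).
  by rewrite /al -ecircN -ecircD re_ecirc addrC.
rewrite /arc_weight -/al ge_max normc_ge0 /=.
have : complex.Re (al * ecirc y) - complex.Re (al * (ecirc x * z j)) <=
    Normc.normc (ecirc x * z j - ecirc y).
  have := normr_Re_le (al * (ecirc x * z j - ecirc y)).
  rewrite Normc.normcM normcJ normc_ecirc mul1r ler_norml => /andP[+ _].
  by rewrite mulrBr raddfB /= lerNl opprB.
by rewrite al_y; have := cos_arcE a b y; lra.
Qed.

(** The weighted transform has squared norm O(1 / n) for every n: the pieces contribute O(1 / n^2)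
    in total by orthogonality, and [sqr_nrm_sum] costs a factor n + 1. Hence it vanishes, and the
    transform lives where the weight is 0. *)
Lemma arc_support a b f : 0 <= a -> a <= b -> b <= 1 ->
  forall j, {ae mu, forall x, W (P `[a, b[ f) x j <> 0 ->
    sin (pi * (angle th j x - a)) * sin (pi * (angle th j x - b)) <= 0}.
Proof.
move=> a0 ab b1.
pose M (g : l2vect) := mkl2 (L2_mulb (cmeas_arc_weight a b) (arc_weight_le a b) (l2P g)).
have Mlin c g h : M (c *: g + h) = c *: M g + M h.
  by apply: l2vect_eq => x j; rewrite [RHS]l2_linE /= mulrDr mulrCA.
have M0 : M 0 = 0 by apply: l2vect_eq => x j /=; rewrite mulr0.
have Msum n (F : 'I_n -> l2vect) : M (\sum_(i < n) F i) = \sum_(i < n) M (F i).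
  apply: (big_ind2 (fun u v => M u = v)) => // u _ v _ <- <-.
  by rewrite -[in LHS](scale1r u) Mlin scale1r.
have Mext (g h : l2vect) : aeeq g h -> nrm (M g) = nrm (M h).
  move=> gh; apply: (nrm_subr0 HD); apply/nrm_aeeq.
  exact: (aeeq_mul (fun x j => (arc_weight a b x j)%:C) gh).
(* Cut the arc into n + 1 arcs; on each of them the weight is O(1/n). *)
have key n : nrm (M (W (P `[a, b[ f))) ^+ 2 <=
    (2 * pi) ^+ 2 * nrm f ^+ 2 / n.+1%:R.
  pose h := (b - a) / n.+1%:R.
  have h0 : 0 <= h by rewrite divr_ge0// subr_ge0.
  have nh : n.+1%:R * h = b - a by rewrite /h mulrC divfK// pnatr_eq0.
  have := arc_partition a n.+1 f h0.
  rewrite nh (addrC a) subrK => -[H1 H2].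
  rewrite (Mext _ _ H1) Msum.
  rewrite (le_trans (sqr_nrm_sum HD _))//.
  have Hi (i : 'I_n.+1) : nrm (M (W (P `[a + i%:R * h, a + i.+1%:R * h[ f))) ^+ 2 <=
      (2 * pi * h) ^+ 2 * nrm (P `[a + i%:R * h, a + i.+1%:R * h[ f) ^+ 2.
    set B := (`[_, _[%classic); set g := P B f; set zeta := ecirc (a + i%:R * h).
    have i1 : a + i.+1%:R * h <= 1.
      rewrite (le_trans _ b1)// -[leRHS](subrK a) -nh addrC lerD2r ler_wpM2r// ler_nat.
      exact: ltn_ord.
    have ai : a <= a + i%:R * h by rewrite lerDl mulr_ge0.
    pose G := mkl2 (L2_hatT z1 (l2P (W g))) - zeta *: W g.
    have GE x k : G x k = (ecirc x * z k - zeta) * W g x k.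
      by rewrite l2_subE mulrBl.
    have nG : nrm G = nrm (Tl g - zeta *: g).
      rewrite -(nrm_W WW (Tl g - zeta *: g)); apply: (nrm_subr0 HD); apply/nrm_aeeq => k.
      have := ae_conj (W_T z1 WW Wstep g k) (W_lin WW (- zeta) g (Tl g) k).
      apply: ae_impl => x [E1]; rewrite scaleNr addrC => ->.
      by rewrite E1 GE mulrBl mulNr addrC.
    have : nrm (M (W g)) <= nrm G.
      apply: nrm_le_pointwise => x k; rewrite GE !Normc.normcM ler_wpM2r ?normc_ge0//.
      rewrite normc_real ger0_norm; last by rewrite /arc_weight le_max lexx.
      apply: arc_weight_lip => //.
      rewrite -[leRHS](subrK a) -nh addrC lerD2r ler_wpM2r// ler_nat ltnW//.
    rewrite -(ler_pXn2r (_ : 0 < 2)%N)// ?nnegrE ?nrm_ge0// => /le_trans; apply.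
    rewrite nG; apply: arc_bound.
    - exact: measurable_itv.
    - move=> x /=; rewrite !in_itv /= => /andP[x1 x2].
      by rewrite (le_trans a0 (le_trans ai x1)) (lt_le_trans x2).
    - move=> x; rewrite /B /= in_itv /= -natr1 mulrDl mul1r => /andP[x1 x2].
      by rewrite ger0_norm ?subr_ge0// lerBlDl -addrA ltW.
  have : n.+1%:R * \sum_(i < n.+1) nrm (M (W (P `[a + i%:R * h, a + i.+1%:R * h[ f))) ^+ 2 <=
      n.+1%:R * ((2 * pi * h) ^+ 2 * nrm (P `[a, b[ f) ^+ 2).
    by rewrite ler_pM2l ?ltr0n// H2 mulr_sumr; apply: ler_sum => i _; exact: Hi.
  move=> /le_trans; apply.
  have mab : measurable (`[a, b[%classic : set (measurableTypeR R)) by exact: measurable_itv.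
  have := pproj_le mab f; set q := nrm _ ^+ 2; set q' := nrm f ^+ 2 => qq'.
  have q0 : 0 <= q by exact: sqr_ge0.
  have n0 : 0 < n.+1%:R :> R by rewrite ltr0n.
  rewrite ler_pdivlMr//.
  have -> : n.+1%:R * ((2 * pi * h) ^+ 2 * q) * n.+1%:R = (2 * pi) ^+ 2 * (n.+1%:R * h) ^+ 2 * q by ring.
  rewrite nh -mulrA ler_wpM2l ?sqr_ge0//.
  have : (b - a) ^+ 2 <= 1 by rewrite expr_le1// ?subr_ge0//; lra.
  by have := sqr_ge0 (b - a); nra.
have Mg0 : nrm (M (W (P `[a, b[ f))) = 0.
  apply/eqP; rewrite -sqrf_eq0 eq_le sqr_ge0 andbT leNgt; apply/negP => s0.
  move: key; set s := nrm _ ^+ 2 in s0 *; set K := _ * _ => key.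
  have K0 : 0 <= K / s by rewrite divr_ge0// ?(ltW s0)// mulr_ge0// sqr_ge0.
  have := archi_boundP K0; rewrite ltr_pdivrMr// => KB.
  have := key (Num.bound (K / s)); rewrite ler_pdivlMr ?ltr0n//.
  rewrite leNgt => /negP; apply; apply: (lt_le_trans KB).
  by rewrite mulrC ler_wpM2l ?(ltW s0)// ler_nat.
move=> j; have /nrm_aeeq/(_ j) : nrm (M (W (P `[a, b[ f)) - 0) = 0 by rewrite subr0.
apply: ae_impl => x /= /eqP; rewrite mulf_eq0 => /orP[|/eqP//].
rewrite eq_complex /= eqxx andbT arc_weightE => /eqP E0 _.
have : 2 * (sin (pi * (angle th j x - a)) * sin (pi * (angle th j x - b))) <= 0.
  by rewrite -E0 le_max lexx orbT.
by rewrite pmulr_rle0.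
Qed.

Lemma ae_angle_neq j (b : R) : {ae mu, forall x, angle th j x != b}.
Proof.
have : {ae mu, forall x (k : int), x <> b + k%:~R - th j}.
  apply: ae_forall_int => k; exists [set b + k%:~R - th j].
  by split => //; [exact: lebesgue_measure_set1|move=> x /= /contrapT].
apply: ae_impl => x H; apply/eqP => xb; apply: (H (Num.floor (x + th j))).
by rewrite -xb /angle /frac subrK addrK.
Qed.

(** W f is the sum of the pieces from [0, b[ and [b, 1[, each supported on its own arc, so each
    piece is W f there and 0 elsewhere. The angles 0 and b, where the sines vanish, form a null
    set. *)
Lemma pproj_hat b f : 0 <= b <= 1 ->
  aeeq (W (P `[0, b[ f)) (fun x j => if angle th j x < b then W f x j else 0).
Proof.
move=> /andP[b0 b1] j.
have [_ H1] := pproj_itv_split f b0 b1.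
have H2 : aeeq (W (P `[0, 1[ f)) (W f).
  by apply: (W_ext WW); apply/nrm_aeeq; exact: pproj_itv01.
have S1 := arc_support f (lexx 0) b0 b1 j.
have S2 := arc_support f b0 b1 (lexx 1) j.
have := ae_conj (ae_conj (H1 j) (H2 j)) (ae_conj (ae_conj S1 S2)
  (ae_conj (ae_angle_neq j 0) (ae_angle_neq j b))).
apply: ae_impl => x [[E1 E2] [[s1 s2] [y0 yb]]].
have := frac_itv (x + th j); rewrite -/(angle th j x) in_itv /= => /andP[y0' y1].
have ygt0 : 0 < angle th j x by rewrite lt0r y0.
have [ylt|] := ltP (angle th j x) b.
  rewrite -E2 E1 [X in _ + X](_ : _ = 0) ?addr0//.
  apply: contrapT => /s2; apply/negP; rewrite -ltNge.
  by rewrite nmulr_rgt0; apply: sin_pi_lt0; apply/andP; split; lra.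
rewrite le_eqVlt eq_sym (negbTE yb) /= => bly.
apply: contrapT => /s1; apply/negP; rewrite -ltNge.
by rewrite pmulr_rgt0; apply: sin_pi_gt0; apply/andP; split; lra.
Qed.

Lemma pvm_meas_ray (f : l2vect) (A : set (measurableTypeR R)) : measurable A ->
  pvm_meas E f A = pvm_meas E f (A `&` `[0, 1[).
Proof.
move=> mA; have m01 : measurable (`[0, 1[%classic : set (measurableTypeR R)) by exact: measurable_itv.
have mAD : measurable (A `\` `[0, 1[) by exact: measurableD.
have mAI : measurable (A `&` `[0, 1[) by exact: measurableI.
have -> : pvm_meas E f A = (pvm_meas E f (A `&` `[0%R, 1%R[) + pvm_meas E f (A `\` `[0%R, 1%R[))%E.
  rewrite -[in LHS](setUIDK A `[0, 1[%classic); apply: measureU => //.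
  by apply/seteqP; split=> x //= -[[_ x1] [_ x2]].
rewrite [X in (_ + X)%E](_ : _ = 0%E) ?adde0//.
rewrite (pvm_meas_sqr mAD) (nrm_subr0 HD (pproj_ext mAD (_ : nrm (f - P `[0, 1[ f) = 0))).
  rewrite pproj_disjoint ?expr0n//.
  by apply/seteqP; split=> x //= -[[_ x1] x2].
by rewrite nrmBC; [exact: pproj_itv01|exact: HD].
Qed.

(** Rays ]-oo, b[ are stable under intersection and generate the Borel sets, so agreement on them
    suffices. Such a ray meets [0, 1[ in [0, c[ with c the value of b clamped to [0, 1], where
    [pproj_hat] applies. *)
Lemma pvm_measE_circ (f : l2vect) (A : set (measurableTypeR R)) : measurable A ->
  pvm_meas E f A = circ_meas th (W f) A.
Proof.
move=> mA.
have m01 : measurable (`[0, 1[%classic : set (measurableTypeR R)) by exact: measurable_itv.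
apply: (@measure_unique _ R (measurableTypeR R) (@RGenInftyO.G R) (fun n => `]-oo, n%:R[%classic)) => //.
- exact: RGenInftyO.measurableE.
- move=> _ _ [x ->] [y ->]; exists (Num.min x y); apply/seteqP; split=> t /=.
    by rewrite !in_itv /= lt_min => -[-> ->].
  by rewrite !in_itv /= lt_min => /andP[-> ->].
- by move=> n; exists n%:R.
- apply/seteqP; split=> x // _; exists (Num.bound `|x|) => //=.
  rewrite in_itv /= (le_lt_trans (ler_norm x))// archi_boundP//.
- move=> _ [b ->].
  have mb : measurable (`]-oo, b[%classic : set (measurableTypeR R)) by exact: measurable_itv.
  pose c := Num.max 0 (Num.min b 1).
  have c01 : 0 <= c <= 1 by rewrite /c le_max lexx /= ge_max ler01 ge_min lexx orbT.
  have mc : measurable (`[0, c[%classic : set (measurableTypeR R)) by exact: measurable_itv.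
  have cE t : 0 <= t -> t < 1 -> (t < c) = (t < b).
    by move=> t0 t1; rewrite /c lt_max ltNge t0 /= lt_min t1 andbT.
  rewrite (pvm_meas_ray f mb) (_ : `]-oo, b[ `&` `[0, 1[ = `[0, c[)%classic; last first.
    apply/seteqP; split=> t /=; rewrite !in_itv /=.
      by move=> [tb /andP[t0 t1]]; rewrite t0 cE.
    move=> /andP[t0 tc]; have t1 : t < 1 by rewrite (lt_le_trans tc)//; case/andP: c01.
    by rewrite t0 t1 -cE.
  rewrite (pvm_meas_sqr mc) -(nrm_W WW) -sqnorm_l2 /sqnorm /circ_meas.
  apply: eq_bigr => j _; rewrite [RHS]integral_mkcond.
  apply: ae_eq_integral => //.
  - by have /cL2P[_ /measurable_int] := l2P (W (P `[0, c[ f)) j.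
  - apply/(measurable_restrictT _ _).1; first exact: measurable_angle_pre.
    by apply: measurable_funTS; apply/measurable_EFinP; exact: measurable_density.
  have := pproj_hat f c01 j; apply: ae_impl => x -> _; rewrite patchE.
  have := frac_itv (x + th j); rewrite -/(angle th j x) in_itv /= => /andP[y0 y1].
  rewrite (cE _ y0 y1) (_ : (x \in _) = (angle th j x < b)); last first.
    by apply/idP/idP; rewrite inE /= in_itv.
  by case: ifP => // _; rewrite Normc.normc0 expr0n.
- move=> n.
  have mn : measurable (`]-oo, n%:R[%classic : set (measurableTypeR R)) by exact: measurable_itv.
  by rewrite (pvm_meas_sqr mn) ltry.
Qed.

(** S is given only through <S g, g>, which [pvm_measE_circ] identifies with the form of the
    operator [M]; polarization concludes. *)
Lemma functional_calculus_hat (m : R[i] -> R[i]) (C : R) (S : vect -> vect) (f : l2vect) :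
  0 <= C -> cmeas (fun x => m (ecirc x)) ->
  {ae mu, forall x, Normc.normc (m (ecirc x)) <= C} ->
  spectral_integral E (fun x => m (ecirc x)) S ->
  aeeq (W (tol2 (S f))) (fun x j => m (ecirc x * z j) * W f x j).
Proof.
move=> C0 mm mC [[SL Slin _] SE].
pose m' := truncate m C.
have m'w j := cmeas_truncate_hat thz C mm j.
have m'C x j : Normc.normc (m' (ecirc x * z j)) <= C by exact: truncate_le.
have mm'E j := truncate_ae thz mC j.
pose M g := W' (mkl2 (L2_mulb m'w m'C (l2P (W g)))).
have ME g : aeeq (W (M g)) (mkl2 (L2_mulb m'w m'C (l2P (W g)))).
  exact: WVK WWV (mkl2 (L2_mulb m'w m'C (l2P (W g)))).
suff H : nrm (tol2 (S f) - M f) = 0.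
  have H1 : aeeq (W (tol2 (S f))) (W (M f)) by apply: (W_ext WW); apply/nrm_aeeq.
  apply: aeeq_trans H1 _; apply: aeeq_trans (ME f) _ => j.
  by apply: ae_impl (mm'E j) => x ->.
have SLl (g : l2vect) : L2 (S g) by apply: SL; exact: l2P.
apply: (polarization HD (A := fun g : l2vect => tol2 (S g)) (B := M)).
- move=> c g h k; rewrite -(ip_linear HD); apply: eq_l2dot_ae (aeeq_refl _).
  have := Slin c g h (l2P g) (l2P h); rewrite !tol2E//.
  by rewrite -[X in _ -> aeeq _ X]/(fun x j => c * l2fun (tol2 (S g)) x j + l2fun (tol2 (S h)) x j) !tol2E.
- move=> c g h k; rewrite -(ip_linear HD); apply: eq_l2dot_ae (aeeq_refl _).
  apply: (W_inj WW); apply: aeeq_trans (ME _) _.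
  apply: aeeq_trans (aeeq_sym (W_lin WW _ _ _)) => j.
  have := ae_conj (W_lin WW c g h j) (ae_conj (ME g j) (ME h j)).
  by apply: ae_impl => x /= [-> [-> ->]]; ring.
move=> g; rewrite -[LHS]/(dot (tol2 (S g)) g) tol2E//.
rewrite SE; last exact: l2P.
rewrite (cintegral_multiplier thz C0 mm mC (F := W g)); last by move=> A mA; exact: pvm_measE_circ.
by rewrite -WW (eq_l2dot_ae (ME g) (aeeq_refl _)).
Qed.

End PvmUnique.

Lemma l2_scaleE (R : realType) (p : nat) (c : R[i]) (f : l2vect R p) x j :
  l2fun (c *: f) x j = c * f x j.
Proof. by []. Qed.

(** * Existence of the spectral measure of T *)

Section Multiplier.
Variables (R : realType) (p : nat) (z : 'I_p -> R[i]) (th : 'I_p -> R).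
Local Notation mu := (@lebesgue_measure R).
Local Notation cI u := (cintegral mu setT u).
Local Notation vect := (vect R p).
Local Notation l2vect := (l2vect R p).
Local Notation D := (@l2dot R p).
Local Notation nrm := (nrm (@l2dot R p)).
Local Notation HD := (@l2_inner R p).
Hypothesis z1 : forall j, Normc.normc (z j) = 1.
Hypothesis thz : forall j, ecirc (th j) = z j.
Variables (W W' : l2vect -> l2vect).
Hypothesis WW : forall f g, l2dot (W f) (W g) = l2dot f g.
Hypothesis WWV : forall g, nrm (W (W' g) - g) = 0.
Hypothesis Wstep : forall i, nrm (W (step_fam i) - hat_fam i) = 0.

Definition multiplier (v : vect) (f : vect) : vect :=
  W' (tol2 (fun x j => v x j * W (tol2 f) x j)).

Section Bounded.
Variables (v : vect) (C : R).
Hypothesis mv : forall j, cmeas (v ^~ j).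
Hypothesis vC : forall x j, Normc.normc (v x j) <= C.

Lemma W_multiplier (f : vect) : aeeq (W (tol2 (multiplier v f))) (fun x j => v x j * W (tol2 f) x j).
Proof.
rewrite /multiplier tol2K; apply: aeeq_trans (WVK WWV _) _.
by rewrite tol2E; [exact: aeeq_refl|apply: (L2_mulb mv vC (l2P _))].
Qed.

Lemma L2_multiplier (f : vect) : L2 (multiplier v f).
Proof. exact: l2P. Qed.

Lemma aeeq_W_tol2 (f g : vect) : L2 f -> L2 g -> aeeq (W (tol2 f)) (W (tol2 g)) -> aeeq f g.
Proof. by move=> Lf Lg /(W_inj WW); rewrite !tol2E. Qed.

Lemma dot_W (f g : vect) : L2 f -> L2 g -> dot f g = D (W (tol2 f)) (W (tol2 g)).
Proof. by move=> Lf Lg; rewrite WW /l2dot !tol2E. Qed.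

Lemma dot_multiplier (f g : vect) : L2 f -> L2 g ->
  dot (multiplier v f) g = dot (fun x j => v x j * W (tol2 f) x j) (W (tol2 g)).
Proof.
move=> Lf Lg; rewrite dot_W//; last exact: L2_multiplier.
have H : aeeq (W (tol2 (multiplier v f))) (mkl2 (L2_mulb mv vC (l2P (W (tol2 f))))).
  exact: W_multiplier.
by rewrite (eq_l2dot_ae H (aeeq_refl _)).
Qed.

Lemma multiplier_lin a f g : L2 f -> L2 g ->
  aeeq (multiplier v (fun x j => a * f x j + g x j))
       (fun x j => a * multiplier v f x j + multiplier v g x j).
Proof.
move=> Lf Lg.
have Lh : L2 (fun x j => a * f x j + g x j) by move=> j; exact: cL2_lin.
have Lk : L2 (fun x j => a * multiplier v f x j + multiplier v g x j).
  by move=> j; apply: cL2_lin; exact: L2_multiplier.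
apply: aeeq_W_tol2; [exact: L2_multiplier|exact: Lk|].
apply: aeeq_trans (W_multiplier _) _.
have E1 : tol2 (fun x j => a * f x j + g x j) = a *: tol2 f + tol2 g.
  by apply: l2vect_eq => x j; rewrite l2_linE !tol2E.
have E2 : tol2 (fun x j => a * multiplier v f x j + multiplier v g x j) =
    a *: tol2 (multiplier v f) + tol2 (multiplier v g).
  apply: l2vect_eq => x j; rewrite l2_linE (tol2E Lk).
  by rewrite (tol2E (L2_multiplier f)) (tol2E (L2_multiplier g)).
rewrite E1 E2 => j.
have := ae_conj (ae_conj (W_lin WW a (tol2 f) (tol2 g) j)
  (W_lin WW a (tol2 (multiplier v f)) (tol2 (multiplier v g)) j))
  (ae_conj (W_multiplier f j) (W_multiplier g j)).
by apply: ae_impl => x [[-> ->] [-> ->]]; rewrite mulrDr mulrCA.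
Qed.

Lemma nrm_multiplier f : nrm (tol2 (multiplier v f)) <= `|C| * nrm (tol2 f).
Proof.
rewrite -(nrm_W WW (tol2 (multiplier v f))) -(nrm_W WW (tol2 f)).
set F := W (tol2 f); pose G := mkl2 (L2_mulb mv vC (l2P F)).
have H : nrm (W (tol2 (multiplier v f)) - G) = 0.
  by apply/nrm_aeeq; exact: W_multiplier.
have nZ : nrm (C%:C *: F) = `|C| * nrm F by rewrite (nrmZ HD) normc_real.
rewrite (nrm_subr0 HD H) -nZ.
have GE x j : l2fun G x j = v x j * F x j by [].
apply: nrm_le_pointwise => x j; rewrite GE l2_scaleE.
rewrite Normc.normcM [leRHS]Normc.normcM normc_real.
apply: ler_wpM2r; first exact: normc_ge0.
by rewrite (le_trans (vC x j))// ler_norm.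
Qed.

Lemma bounded_multiplier : bounded_op (multiplier v).
Proof.
split; [by move=> f _; exact: L2_multiplier|exact: multiplier_lin|].
exists (`|C| ^+ 2) => f Lf.
have E1 : sqnorm f = (nrm (tol2 f) ^+ 2)%:E by rewrite -sqnorm_l2 tol2E.
have E2 : sqnorm (multiplier v f) = (nrm (tol2 (multiplier v f)) ^+ 2)%:E.
  by rewrite -sqnorm_l2 (tol2E (L2_multiplier f)).
rewrite E1 E2 -EFinM lee_fin -exprMn.
by apply: lerXn2r (nrm_multiplier f); rewrite nnegrE ?mulr_ge0 ?nrm_ge0.
Qed.

End Bounded.

Lemma spectral_integral_multiplier (E : pvm R p) (m : R[i] -> R[i]) (C : R) :
  0 <= C -> cmeas (fun x => m (ecirc x)) ->
  {ae mu, forall x, Normc.normc (m (ecirc x)) <= C} ->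
  (forall f (A : set (measurableTypeR R)), L2 f -> measurable A -> pvm_meas E f A = circ_meas th (W (tol2 f)) A) ->
  spectral_integral E (fun x => m (ecirc x)) (multiplier (fun x j => truncate m C (ecirc x * z j))).
Proof.
move=> C0 mm mC EE.
have mv j : cmeas (fun x => truncate m C (ecirc x * z j)) by exact: cmeas_truncate_hat.
have vC x j : Normc.normc (truncate m C (ecirc x * z j)) <= C by exact: truncate_le.
split; first exact: (bounded_multiplier mv vC).
move=> f Lf; rewrite (dot_multiplier mv vC Lf Lf).
rewrite (cintegral_multiplier thz C0 mm mC (F := W (tol2 f)))// => A mA.
exact: EE.
Qed.

Definition arc_ind (A : set R) (x : R) (j : 'I_p) : R[i] :=
  if angle th j x \in A then 1 else 0.

Lemma cmeas_arc_ind (A : set R) j : measurable A -> cmeas (arc_ind A ^~ j).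
Proof.
move=> mA; apply: cmeas_if => //.
apply: (measurable_fun_bool true).
rewrite (_ : _ `&` _ = angle th j @^-1` A); first exact: measurable_angle_pre.
by apply/seteqP; split=> x; [move=> [_ /= xA]; rewrite -[A]set_mem_set|split => //=; exact/mem_set].
Qed.

Lemma arc_ind_le (A : set R) x j : Normc.normc (arc_ind A x j) <= 1.
Proof. by rewrite /arc_ind; case: ifP => _; rewrite ?Normc.normc1 ?Normc.normc0. Qed.

Lemma arc_ind_idem A x j : arc_ind A x j * arc_ind A x j = arc_ind A x j.
Proof. by rewrite /arc_ind; case: ifP => _; rewrite ?mulr1 ?mulr0. Qed.

Lemma conj_arc_ind A x j : conjc (arc_ind A x j) = arc_ind A x j.
Proof. by rewrite /arc_ind; case: ifP => _; rewrite ?conjc1 ?conjc0. Qed.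

Definition arc_proj (A : set R) : vect -> vect := multiplier (arc_ind A).

Lemma W_arc_proj A f : measurable A ->
  aeeq (W (tol2 (arc_proj A f))) (fun x j => arc_ind A x j * W (tol2 f) x j).
Proof.
by move=> mA; apply: (W_multiplier (fun j => cmeas_arc_ind j mA) (arc_ind_le A)).
Qed.

Lemma arc_proj_bounded (A : set (measurableTypeR R)) : measurable A -> bounded_op (arc_proj A).
Proof. by move=> mA; exact: (bounded_multiplier (fun j => cmeas_arc_ind j mA) (arc_ind_le A)). Qed.

Lemma arc_proj_idem (A : set (measurableTypeR R)) f : measurable A -> L2 f ->
  aeeq (arc_proj A (arc_proj A f)) (arc_proj A f).
Proof.
move=> mA Lf; apply: aeeq_W_tol2; try exact: L2_multiplier.
apply: aeeq_trans (W_arc_proj _ mA) _ => j; have := W_arc_proj f mA j.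
by apply: ae_impl => x ->; rewrite mulrA arc_ind_idem.
Qed.

Lemma arc_proj_adj (A : set (measurableTypeR R)) f g : measurable A -> L2 f -> L2 g ->
  dot (arc_proj A f) g = dot f (arc_proj A g).
Proof.
move=> mA Lf Lg; have mv j := cmeas_arc_ind j mA.
rewrite (dot_multiplier mv (arc_ind_le A) Lf Lg) dot_mul.
rewrite [RHS]dot_W//; last exact: L2_multiplier.
have H : aeeq (W (tol2 (arc_proj A g))) (mkl2 (L2_mulb mv (arc_ind_le A) (l2P (W (tol2 g))))).
  exact: W_arc_proj.
rewrite (eq_l2dot_ae (aeeq_refl _) H) /l2dot; congr dot.
by apply/funext => x; apply/funext => j; rewrite conj_arc_ind.
Qed.

Lemma arc_proj_id f : L2 f -> aeeq (arc_proj `[0, 1[ f) f.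
Proof.
move=> Lf; apply: aeeq_W_tol2 => //; first exact: L2_multiplier.
apply: aeeq_trans (W_arc_proj _ _) _; first exact: measurable_itv.
move=> j; apply: aeW => x; rewrite /arc_ind mem_set ?mul1r//.
exact: frac_itv.
Qed.

Lemma arc_proj_measE (A : set (measurableTypeR R)) f : measurable A -> L2 f ->
  circ_meas th (W (tol2 f)) A = (complex.Re (dot (arc_proj A f) f))%:E.
Proof.
move=> mA Lf; have mv j := cmeas_arc_ind j mA.
rewrite (dot_multiplier mv (arc_ind_le A) Lf Lf).
pose F := W (tol2 f); pose G := mkl2 (L2_mulb mv (arc_ind_le A) (l2P F)).
have -> : dot (fun x j => arc_ind A x j * F x j) F = D G G.
  rewrite /l2dot [RHS]dot_mul /dot; apply: eq_bigr => j _; congr cintegral.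
  apply/funext => x; rewrite /G /= !conjCE !conjcM !conj_arc_ind.
  by rewrite -[in LHS]arc_ind_idem; ring.
rewrite -(sqr_nrm HD) -sqnorm_l2; apply: eq_bigr => j _.
rewrite integral_mkcond; apply: eq_integral => x _; rewrite patchE /G /= /arc_ind.
rewrite (_ : (x \in _) = (angle th j x \in A)); last by apply/idP/idP; rewrite !inE.
by case: ifP => _; rewrite ?mul1r ?mul0r// Normc.normc0 expr0n.
Qed.

(** The converse has to exhibit a spectral measure: here E(A) multiplies the transform by the
    indicator of the points whose angle lies in A. *)
Definition circle_pvm : pvm R p := @Pvm R p arc_proj (fun f => circ_meas th (W (tol2 f)))
  arc_proj_bounded arc_proj_idem arc_proj_adj arc_proj_id arc_proj_measE.

Lemma spectral_integral_repT : spectral_integral circle_pvm (@ecirc R) (repT z).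
Proof.
split.
  split.
  - by move=> f; exact: L2_repT.
  - by move=> a f g _ _ j; apply: aeW => x; rewrite /repT; ring.
  - exists 1 => f Lf; rewrite mul1e -(tol2E Lf).
    rewrite -[repT z _]/(l2fun (mkl2 (L2_repT z (l2P (tol2 f))))).
    by rewrite !sqnorm_l2 nrm_repT.
move=> f Lf.
(* T itself is the multiplier with symbol m = id, which the bound 1 leaves untruncated on the
   circle. *)
have C1 : {ae mu, forall x : R, Normc.normc (id (ecirc x)) <= 1}.
  by apply: aeW => x; rewrite normc_ecirc.
have CM := @cintegral_multiplier R p z th thz id 1 ler01 (cmeas_ecirc R) C1 (W (tol2 f))
  (pvm_meas circle_pvm f) (fun A _ => erefl).
apply: etrans (esym CM).
have -> : dot (repT z f) f = D (mkl2 (L2_repT z (l2P (tol2 f)))) (tol2 f).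
  by rewrite /l2dot /= tol2E.
have H : aeeq (W (mkl2 (L2_repT z (l2P (tol2 f))))) (mkl2 (L2_hatT z1 (l2P (W (tol2 f))))).
  exact: (W_T z1 WW Wstep).
rewrite -WW; apply: etrans (eq_l2dot_ae H (aeeq_refl (W (tol2 f)))) _; congr dot.
apply/funext => x; apply/funext => j /=; rewrite /hatT /truncate.
by rewrite normc_hat// lexx.
Qed.

Lemma functional_calculus_of_hat (m : R[i] -> R[i]) (C : R) (f : l2vect) (N : nat) (N0 : (0 < N)%N) :
  0 <= C -> cmeas (fun x => m (ecirc x)) ->
  {ae mu, forall x, Normc.normc (m (ecirc x)) <= C} ->
  aeeq (hatU N (W f)) (fun x j => m (ecirc x * z j) * W f x j) ->
  exists S, functional_calculus (repT z) m S /\ aeeq (repU N f) (S f).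
Proof.
move=> C0 mm mC H.
pose v x j := truncate m C (ecirc x * z j).
have mv j : cmeas (v ^~ j) by exact: (cmeas_truncate_hat thz).
have vC x j : Normc.normc (v x j) <= C by exact: truncate_le.
exists (multiplier v); split.
  exists circle_pvm; split; last exact: spectral_integral_multiplier.
  exact: spectral_integral_repT.
apply: aeeq_W_tol2; [exact: L2_repU (l2P f)|exact: L2_multiplier|].
rewrite (_ : tol2 (repU N f) = mkl2 (L2_repU N0 (l2P f))); last first.
  by apply: l2vect_eq => x j; rewrite tol2E//; exact: L2_repU (l2P f).
apply: aeeq_trans (W_U N0 WW Wstep f) _; apply: aeeq_trans H _ => j.
have := ae_conj (W_multiplier mv vC f j) (truncate_ae thz mC j).
by apply: ae_impl => x [-> ->]; rewrite tol2K.
Qed.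

End Multiplier.

(** * Orbits and the two series *)

Section Series.
Variable R : realType.
Implicit Types u v : nat -> R.

Definition summable u : Prop := (\sum_(0 <= i <oo) (u i)%:E < +oo)%E.

Lemma summable_le u v : (forall i, 0 <= u i) -> (forall i, u i <= v i) ->
  summable v -> summable u.
Proof.
move=> u0 uv; apply: le_lt_trans; apply: lee_nneseries => i; rewrite ?lee_fin//.
Qed.

Lemma summableS u : (forall i, 0 <= u i) ->
  summable (fun i => u i.+1) <-> summable u.
Proof.
move=> u0; have u0' i : (0 <= (u i)%:E)%E by rewrite lee_fin.
have E : (\sum_(0 <= i <oo) (u i)%:E = (u 0)%:E + \sum_(0 <= i <oo) (u i.+1)%:E)%E.
  rewrite nneseries_recl//; congr (_ + _)%E.
  rewrite -(nneseries_addn 1 u0'); congr (limn _); apply/funext => n.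
  by apply: eq_bigr => i _; rewrite addn1.
rewrite /summable E; split=> [H|]; first by rewrite lte_add_pinfty// ltry.
by apply: le_lt_trans; rewrite leeDr.
Qed.

Lemma summable_addn u k : (forall i, 0 <= u i) ->
  summable (fun i => u (i + k)%N) <-> summable u.
Proof.
move=> u0; elim: k => [|k IH].
  by under [X in summable X]eq_fun do rewrite addn0.
rewrite -IH -[X in _ <-> X](summableS (u := fun i => u (i + k)%N))//.
by under [X in summable X <-> _]eq_fun do rewrite addnS -addSn.
Qed.

Lemma summableZ (c : R) u : 0 < c -> (forall i, 0 <= u i) ->
  summable (fun i => c * u i) <-> summable u.
Proof.
move=> c0 u0; rewrite /summable.
under [X in (limn X < _)%E <-> _]eq_fun do under eq_bigr do rewrite EFinM.
rewrite nneseriesZl; last by move=> i _; rewrite lee_fin.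
have S0 : (0 <= \sum_(0 <= i <oo) (u i)%:E)%E by apply: nneseries_ge0 => i _; rewrite lee_fin.
split; last by move=> H; rewrite lte_mul_pinfty// lee_fin ltW.
by case: (\sum_(0 <= i <oo) _)%E S0 => // [r|]; rewrite ?ltry// gt0_muley ?lte_fin.
Qed.

Lemma summable_prefix (u : nat -> R) (a : R) (v : nat -> R) :
  (forall i, 0 <= u i) -> (forall i, v i = a * u i) -> 0 <= a -> summable u -> summable v.
Proof.
move=> u0 vE; rewrite le_eqVlt => /orP[/eqP a0 _|a0 /(summableZ a0 u0)].
  rewrite /summable eseries0// => i _ _.
  by rewrite vE -a0 mul0r.
by rewrite (_ : v = fun i => a * u i)//; apply/funext.
Qed.

End Series.

Section GoodIndex.
Variables (R : realType) (a : int -> R).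
Hypothesis a0 : forall k, 0 <= a k.

(** Here n = kx - 1 - i, and the product starts at n - 1: hence i + 3 factors. *)
Lemma fsbig_downto (kx : int) (i : nat) :
  \big[*%R/1%R]_(k \in [set k : int | (kx - 1 - i%:Z - 1 <= k <= kx)%R]) a k =
  \prod_(t < i.+3) a (kx - t%:Z).
Proof.
rewrite (fsbig_ord _ _ (fun t : nat => a (kx - t%:Z))) (reindex_fsbig (fun t : nat => kx - t%:Z) `I_i.+3)//.
split.
- by move=> t /= ti; apply/andP; split; lia.
- by move=> t s _ _ /= /addrI /oppr_inj [].
- move=> k /= /andP[k1 k2]; exists (absz (kx - k)%R) => /=; lia.
Qed.

Lemma fsbig_upto (kx : int) (i : nat) :
  \big[*%R/1%R]_(k \in [set k : int | (kx + 1 <= k <= kx + 1 + i%:Z)%R]) a k =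
  \prod_(t < i.+1) a (kx + 1 + t%:Z).
Proof.
rewrite (fsbig_ord _ _ (fun t : nat => a (kx + 1 + t%:Z))) (reindex_fsbig (fun t : nat => kx + 1 + t%:Z) `I_i.+1)//.
split.
- by move=> t /= ti; apply/andP; split; lia.
- by move=> t s _ _ /= /addrI [].
- move=> k /= /andP[k1 k2]; exists (absz (k - kx - 1)%R) => /=; lia.
Qed.

Lemma esum_downto (kx : int) :
  \esum_(n in [set n : int | (n <= kx - 1)%R])
      (\big[*%R/1%R]_(k \in [set k : int | (n - 1 <= k <= kx)%R]) a k)%:E =
  (\sum_(0 <= i <oo) (\prod_(t < i.+3) a (kx - t%:Z))%:E)%E.
Proof.
rewrite nneseries_esumT; last by move=> i; rewrite lee_fin prodr_ge0.
rewrite (@reindex_esum R _ _ [set: nat] _ (fun i : nat => kx - 1 - i%:Z)).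
  by apply: eq_esum => i _; rewrite fsbig_downto.
split.
- by move=> i _ /=; lia.
- by move=> t s _ _ /= /addrI /oppr_inj [].
- by move=> k /= kk; exists (absz (kx - 1 - k)%R) => //; lia.
Qed.

Lemma esum_upto (kx : int) :
  (\esum_(n in [set n : int | (kx + 1 <= n)%R])
      ((\big[*%R/1%R]_(k \in [set k : int | (kx + 1 <= k <= n)%R]) a k)%:E)^-1 =
  \sum_(0 <= i <oo) ((\prod_(t < i.+1) a (kx + 1 + t%:Z)%R)%R%:E)^-1)%E.
Proof.
rewrite nneseries_esumT; last by move=> i; rewrite inve_ge0 lee_fin prodr_ge0.
rewrite (@reindex_esum R _ _ [set: nat] _ (fun i : nat => kx + 1 + i%:Z)).
  by apply: eq_esum => i _; rewrite fsbig_upto.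
split.
- by move=> i _ /=; lia.
- by move=> t s _ _ /= /addrI [].
- by move=> k /= kk; exists (absz (k - (kx + 1))%R) => //; lia.
Qed.

(* The convention 1/0 = +oo of the second series becomes the nonvanishing of all
   its factors. *)
Definition good_index (kx : int) : Prop :=
  [/\ summable (fun i => \prod_(t < i) a (kx - t%:Z)),
      forall t : nat, a (kx + 1 + t%:Z) != 0 &
      summable (fun i => \prod_(t < i) (a (kx + 1 + t%:Z))^-1)].

Lemma good_indexP (kx : int) : good_index kx <->
  (\esum_(n in [set n : int | (n <= kx - 1)%R])
      (\big[*%R/1%R]_(k \in [set k : int | (n - 1 <= k <= kx)%R]) a k)%:E < +oo)%E /\
  (\esum_(n in [set n : int | (kx + 1 <= n)%R])
      ((\big[*%R/1%R]_(k \in [set k : int | (kx + 1 <= k <= n)%R]) a k)%:E)^-1 < +oo)%E.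
Proof.
rewrite esum_downto esum_upto.
set P := fun i : nat => \prod_(t < i) a (kx - t%:Z).
set Q := fun i : nat => \prod_(t < i) a (kx + 1 + t%:Z).
have P0 i : 0 <= P i by exact: prodr_ge0.
have Q0 i : 0 <= Q i by exact: prodr_ge0.
have Q'0 i : 0 <= (Q i)^-1 by rewrite invr_ge0.
have QE i : \prod_(t < i) (a (kx + 1 + t%:Z))^-1 = (Q i)^-1 by rewrite prodfV.
have QV i : Q i != 0 -> (((Q i)%:E)^-1 = ((Q i)^-1)%:E)%E.
  by move=> Qi; rewrite inver (negbTE Qi).
rewrite /good_index (_ : (fun i => \prod_(t < i) _^-1) = fun i => (Q i)^-1); last exact/funext.
(* The lower limit n - 1 and the start at n = kx - 1 only drop the first three terms of the series
   of all products. *)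
have EP : summable (fun i => P i.+3) <-> summable P.
  by rewrite -(summable_addn 3 P0); under [X in _ <-> summable X]eq_fun do rewrite addn3.
split=> [[s1 nz s2]|[s1 s2]].
  split; first exact/EP.
  have /(summableS Q'0) := s2; apply: le_lt_trans; rewrite le_eqVlt; apply/orP; left.
  apply/eqP; apply: eq_eseriesr => i _; rewrite QV//.
  by apply/prodf_neq0 => t _; exact: nz.
have QS0 i : Q i.+1 != 0.
  apply/eqP => Qi; move: s2.
  rewrite (@nneseriesD1 R _ i xpredT)//; last by move=> k _; rewrite inve_ge0 lee_fin prodr_ge0.
  rewrite -/(Q i.+1) Qi inver eqxx addye ?ltxx//.
  rewrite gt_eqF// (lt_le_trans ltNy0)//.
  by apply: nneseries_ge0 => k _ _; rewrite inve_ge0 lee_fin prodr_ge0.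
split; first exact/EP.
  move=> t; have := QS0 t; rewrite /Q big_ord_recr mulf_eq0 negb_or => /andP[_].
  by [].
apply/(summableS Q'0); apply: le_lt_trans s2; rewrite le_eqVlt; apply/orP; left.
by apply/eqP; apply: eq_eseriesr => i _; rewrite QV.
Qed.

End GoodIndex.

Section TwoSided.
Variable R : realType.
Implicit Types a d : int -> R.

Definition summableZ2 d : Prop :=
  summable (fun i : nat => d i%:Z) /\ summable (fun i : nat => d (- i%:Z)).

Lemma summableZ2_shift1 d : (forall k, 0 <= d k) ->
  summableZ2 (fun k => d (k + 1)) <-> summableZ2 d.
Proof.
move=> d0; rewrite /summableZ2.
have -> : (fun i : nat => d (i%:Z + 1)) = (fun i : nat => d i.+1%:Z).
  by apply/funext => i; congr d; lia.
have E1 := summableS (u := fun i : nat => d i%:Z) (fun i => d0 _).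
have E2 := summableS (u := fun i : nat => d (- i%:Z + 1)) (fun i => d0 _).
have E3 : (fun i : nat => d (- i.+1%:Z + 1)) = (fun i : nat => d (- i%:Z)).
  by apply/funext => i; congr d; lia.
rewrite E3 in E2.
by split=> -[/E1 s1 /E2 s2].
Qed.

Lemma summableZ2_shift d l : (forall k, 0 <= d k) -> summableZ2 d ->
  summableZ2 (fun k => d (k + l)).
Proof.
move=> d0 sd; have H (n : nat) : summableZ2 (fun k => d (k + n%:Z)) /\
    summableZ2 (fun k => d (k - n%:Z)).
  elim: n => [|n [IH1 IH2]].
    by rewrite oppr0; under [X in summableZ2 X]eq_fun do rewrite addr0.
  split.
    have := (summableZ2_shift1 (d := fun k => d (k + n%:Z)) (fun k => d0 _)).2 IH1.
    by congr summableZ2; apply/funext => k; congr d; lia.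
  apply: (summableZ2_shift1 (d := fun k => d (k - n.+1%:Z)) (fun k => d0 _)).1.
  have := IH2; congr summableZ2; apply/funext => k; congr d; lia.
by case: l => n; [exact: (H n).1|rewrite NegzE; exact: (H n.+1).2].
Qed.

Lemma summableZ2_le d d' : (forall k, 0 <= d k <= d' k) -> summableZ2 d' -> summableZ2 d.
Proof.
by move=> dd [s1 s2]; split; [apply: summable_le s1|apply: summable_le s2] => i;
  have /andP[] := dd i%:Z; have /andP[] := dd (- i%:Z).
Qed.

Lemma summableZ2_scale (c : R) d d' : 0 <= c -> (forall k, 0 <= d k) ->
  (forall k, d' k = c * d k) -> summableZ2 d -> summableZ2 d'.
Proof.
move=> c0 d0 dE [s1 s2]; split.
  exact: (summable_prefix (u := fun i : nat => d i%:Z) (fun i => d0 _) (fun i => dE _) c0 s1).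
exact: (summable_prefix (u := fun i : nat => d (- i%:Z)) (fun i => d0 _) (fun i => dE _) c0 s2).
Qed.

(** Forward, the products of a are d(i) / d(0); backward, the products of inverses are d(-i) / d(0).
    Since d(0) is nonzero, the recursion forbids zeros of d at negative indices, hence of a at
    positive ones. *)
Lemma good_index_of_cocycle a d : (forall k, 0 <= d k) ->
  (forall k, d (k + 1) = a (- k) * d k) -> d 0 != 0 -> summableZ2 d -> good_index a 0.
Proof.
move=> d0 dS dn0 [s1 s2].
have dnz (t : nat) : d (- t%:Z) != 0.
  elim: t => [//|t]; have := dS (- t.+1%:Z).
  rewrite (_ : - t.+1%:Z + 1 = - t%:Z); last lia.
  by move=> ->; rewrite mulf_eq0 negb_or => /andP[].
have E (t : nat) : d (- t%:Z) = a (0 + 1 + t%:Z) * d (- t.+1%:Z).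
  rewrite -[LHS](_ : d (- t.+1%:Z + 1) = _); last by congr d; lia.
  by rewrite dS; congr (a _ * _); lia.
split.
- apply: (summable_prefix (a := (d 0)^-1) (u := fun i : nat => d i%:Z)) => //.
    elim=> [|i IH]; first by rewrite big_ord0 mulVf.
    rewrite big_ord_recr /= IH -[in RHS]addn1 PoszD dS sub0r.
    by rewrite -mulrA; congr (_ * _); exact: mulrC.
  by rewrite invr_ge0.
- by move=> t; have := dnz t; rewrite E mulf_eq0 negb_or => /andP[].
- apply: (summable_prefix (a := (d 0)^-1) (u := fun i : nat => d (- i%:Z))) => //.
    elim=> [|i IH]; first by rewrite big_ord0 oppr0 mulVf.
    rewrite big_ord_recr /= IH E; have := dnz i; rewrite E mulf_eq0 negb_or => /andP[an0 _].
    by rewrite -mulrA; congr (_ * _); rewrite mulrAC mulfV// mul1r.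
  by rewrite invr_ge0.
Qed.

Lemma good_index_shift a k kx :
  good_index (fun t => a (t - k)) kx <-> good_index a (kx - k).
Proof.
rewrite /good_index.
have -> : (fun i => \prod_(t < i) a (kx - t%:Z - k)) =
    (fun i => \prod_(t < i) a (kx - k - t%:Z)).
  by apply/funext => i; apply: eq_bigr => t _; congr a; lia.
have -> : (fun i => \prod_(t < i) (a (kx + 1 + t%:Z - k))^-1) =
    (fun i => \prod_(t < i) (a (kx - k + 1 + t%:Z))^-1).
  by apply/funext => i; apply: eq_bigr => t _; congr (a _)^-1; lia.
by split=> -[s1 nz s2]; split=> // t; have := nz t; congr (a _ != 0); lia.
Qed.

End TwoSided.

Lemma exists_scale (R : realType) (b x : R) : 1 < b -> x != 0 ->
  exists k : int, 1 <= `|b ^ k * x| < b.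
Proof.
move=> b1 x0; have b0 : 0 < b by rewrite (lt_trans _ b1).
have nx : 0 < `|x| by rewrite normr_gt0.
have unb (A : R) : exists n : nat, A < b ^+ n.
  exists (Num.bound (`|A| / (b - 1))).
  have b10 : 0 < b - 1 by rewrite subr_gt0.
  have := archi_boundP (divr_ge0 (normr_ge0 A) (ltW b10)); set n := Num.bound _.
  rewrite ltr_pdivrMr// => H; rewrite (le_lt_trans (ler_norm A))// (lt_le_trans H)//.
  have := @bernoulli_ineq R (b - 1) n; rewrite [1 + (b - 1)]addrC subrK => B.
  by apply: (le_trans _ (B _)); lra.
have nE (k : int) : `|b ^ k * x| = b ^ k * `|x|.
  by rewrite normrM (gtr0_norm (exprz_gt0 _ b0)).
have [x1|x1] := leP 1 `|x|.
  have [n nP nmin] := ex_minnP (unb `|x|).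
  case: n => [|n] in nP nmin *; first by move: nP; rewrite expr0 ltNge x1.
  exists (- n%:Z); rewrite nE -invr_expz; apply/andP; split.
    rewrite mulrC ler_pdivlMr ?exprn_gt0// mul1r leNgt; apply/negP => /nmin.
    by rewrite ltnn.
  by rewrite mulrC ltr_pdivrMr ?exprn_gt0// -exprS.
have [n0 n0P] := unb `|x|^-1.
have ex : exists n : nat, 1 <= b ^+ n * `|x|.
  by exists n0; rewrite -ler_pdivrMr// mul1r ltW.
have [n nP nmin] := ex_minnP ex.
case: n => [|n] in nP nmin *; first by move: nP; rewrite expr0 mul1r leNgt x1.
exists n.+1%:Z; rewrite nE -exprnP nP /= exprS -mulrA gtr_pMr// ltNge.
by apply/negP => /nmin; rewrite ltnn.
Qed.

(** * Integration over annuli *)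

Section Tiling.
Variables (R : realType) (b : R).
Local Notation mu := (@lebesgue_measure R).
Hypothesis b1 : 1 < b.

Definition annulus : set R := [set x | 1 <= `|x| < b].

Let b0 : 0 < b. Proof. exact: lt_trans b1. Qed.

Lemma measurable_annulus : measurable annulus.
Proof.
rewrite (_ : annulus = (fun x : R => `|x|) @^-1` `[1, b[%classic).
  by rewrite -[_ @^-1` _]setTI; apply: (@measurableT_comp _ _ _ _ _ _ (fun x : R => `|x|)) => //; exact: measurable_itv.
by apply/seteqP; split=> x; rewrite /annulus /= in_itv.
Qed.

Lemma measurable_annulus_pre (c : R) : measurable [set x | annulus (c * x)].
Proof.
rewrite (_ : [set x | _] = (fun x => c * x + 0) @^-1` annulus).
  rewrite -[_ @^-1` _]setTI; apply: measurable_affine => //.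
  exact: measurable_annulus.
by apply/seteqP; split=> x /=; rewrite addr0.
Qed.

Lemma annulus_uniq (k l : int) x : annulus (b ^ k * x) -> annulus (b ^ l * x) -> k = l.
Proof.
have H (k' l' : int) : annulus (b ^ k' * x) -> annulus (b ^ l' * x) -> (k' <= l')%R.
  rewrite /annulus /= => /andP[_ k2] /andP[l1 _]; rewrite leNgt; apply/negP => lk.
  move: k2; rewrite ltNge => /negP; apply.
  rewrite (_ : k' = (k' - l') + l'); last lia.
  rewrite expfzDr ?gt_eqF// -mulrA normrM (gtr0_norm (exprz_gt0 _ b0)).
  have : b <= b ^ (k' - l').
    have : exists n : nat, k' - l' = n.+1%:Z by exists (absz (k' - l' - 1)%R); lia.
    move=> [n ->]; rewrite -exprnP exprS ler_peMr ?(ltW b0)// exprn_ege1//; exact: ltW.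
  by move=> /le_trans; apply; rewrite ler_peMr// exprz_ge0 ?ltW.
by move=> Ak Al; apply/eqP; rewrite eq_le !H.
Qed.

(** The i-th piece is the image of the annulus under x |-> b^(s i) x, whose Jacobian is the factor
    in the sum. The sequence s allows the two halves of Z to be treated separately, as series over
    nat. *)
Lemma tiling (s : nat -> int) (f : R -> R) : injective s ->
  measurable_fun setT f -> (forall x, 0 <= f x) ->
  (\int[mu]_(x in \bigcup_i [set x | annulus (b ^ (- s i) * x)%R]) (f x)%:E =
   \int[mu]_(x in annulus) (\sum_(0 <= i <oo) (b ^ s i * f (b ^ s i * x))%R%:E))%E.
Proof.
move=> sinj mf f0.
have bs (k : int) : b ^ k != 0 by rewrite gt_eqF// exprz_gt0.
have mpre (k : int) := measurable_annulus_pre (b ^ k).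
have mEf : measurable_fun setT (EFin \o f) by exact/measurable_EFinP.
have mfs (k : int) : measurable_fun setT (fun x => (b ^ k * f (b ^ k * x))%:E).
  apply/measurable_EFinP; apply: measurable_funM => //.
  have -> : (fun x => f (b ^ k * x)) = f \o affine_map (b ^ k) 0.
    by apply/funext => x; rewrite /= /affine_map addr0.
  exact: (measurableT_comp mf (measurable_affine (b ^ k) 0)).
rewrite ge0_integral_bigcup//; last 4 first.
- by move=> k; exact: mpre.
- exact: measurable_funTS.
- by move=> x _; rewrite lee_fin.
- move=> i i' _ _ [x [/= A1 A2]]; apply: sinj; apply: oppr_inj.
  exact: annulus_uniq A1 A2.
rewrite integral_nneseries//; last 3 first.
- exact: measurable_annulus.
- by move=> i; apply: measurable_funTS; exact: mfs.
- by move=> i x _; rewrite lee_fin mulr_ge0// exprz_ge0// ltW.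
apply: eq_eseriesr => i _; rewrite integral_mkcond.
pose D := [set x | annulus (b ^ (- s i) * x)].
have mfD : measurable_fun setT ((EFin \o f) \_ D).
  exact: (measurable_restrictT (EFin \o f) (mpre (- s i))).1 (measurable_funTS mEf).
rewrite (ge0_integral_affine 0 (bs (s i)) mfD); last first.
  by move=> x; rewrite patchE; case: ifP => // _; rewrite lee_fin.
rewrite (gtr0_norm (exprz_gt0 _ b0)) [RHS]integral_mkcond -ge0_integralZl//; last 3 first.
- exact: (measurableT_comp mfD (measurable_affine (b ^ s i) 0)).
- by move=> x _; rewrite patchE; case: ifP => // _; rewrite lee_fin.
- by rewrite lee_fin exprz_ge0// ltW.
apply: eq_integral => x _; rewrite !patchE addr0.
have -> : (b ^ s i * x \in D) = (x \in annulus).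
  by apply/idP/idP; rewrite !inE /D /= mulrA -expfzDr ?gt_eqF// addNr expr0z mul1r.
by case: ifP => _; rewrite ?mule0// EFinM.
Qed.

End Tiling.

Section Orbit.
Variables (R : realType) (N p : nat) (z : 'I_p -> R[i]) (m : R[i] -> R[i]).
Local Notation mu := (@lebesgue_measure R).
Local Notation vect := (vect R p).
Local Notation l2vect := (l2vect R p).
Hypothesis N1 : (1 < N)%N.

Let Nn : N%:R != 0 :> R. Proof. by rewrite pnatr_eq0 -lt0n ltnW. Qed.
Let Np : 0 < N%:R :> R. Proof. by rewrite ltr0n ltnW. Qed.
Let Nz (k : int) : N%:R ^ k != 0 :> R. Proof. by rewrite expfz_neq0. Qed.

(* The index k is the opposite of the one in [sq_mod]. *)
Definition orbit_factor (x : R) (j : 'I_p) (k : int) : R[i] :=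
  m (ecirc (N%:R ^ k * x) * z (shift k j)).

Definition orbit_sq (x : R) (j : 'I_p) (k : int) : R :=
  Normc.normc (orbit_factor x j (- k)) ^+ 2.

Definition good (x : R) (j : 'I_p) (kx : int) : Prop := good_index (orbit_sq x j) kx.

Lemma orbit_factor_shift x j k l :
  orbit_factor (N%:R ^ k * x) (shift k j) l = orbit_factor x j (l + k).
Proof. by rewrite /orbit_factor shift_shift mulrA -expfzDr. Qed.

Lemma good_shift x j k kx : good (N%:R ^ k * x) (shift k j) kx <-> good x j (kx - k).
Proof.
rewrite /good -good_index_shift (_ : orbit_sq (N%:R ^ k * x) (shift k j) =
  fun t => orbit_sq x j (t - k))//.
by apply/funext => t; rewrite /orbit_sq orbit_factor_shift opprB addrC.
Qed.

Lemma ae_orbit (P : R -> 'I_p -> Prop) : (forall j, {ae mu, forall x, P x j}) ->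
  forall j, {ae mu, forall x (k : int), P (N%:R ^ k * x) (shift k j)}.
Proof.
move=> aP j; apply: ae_forall_int => k.
have := ae_affine 0 (Nz k) (aP (shift k j)); apply: ae_impl => x.
by rewrite addr0.
Qed.

(** After j0 - j steps the orbit of (x, j) is in copy j0; further steps by multiples of p stay there
    and scale by powers of N^p, so the orbit meets the annulus of ratio N^p. [good_shift] carries
    the index back. *)
Lemma good_spread (j0 : 'I_p) :
  {ae mu, forall x, annulus (N%:R ^+ p) x -> exists kx, good x j0 kx} ->
  forall j, {ae mu, forall x, exists kx, good x j kx}.
Proof.
move=> H j; have p0 : (0 < p)%N by case: p j => [[]|].
pose P x i := i = j0 -> annulus (N%:R ^+ p) x -> exists kx, good x i kx.
have aP i : {ae mu, forall x, P x i}.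
  have [->|ij] := eqVneq i j0; first by apply: ae_impl H => x Hx _; exact: Hx.
  by apply: aeW => x ij0; rewrite ij0 eqxx in ij.
have := ae_conj (ae_orbit aP j) (ae_neq0 R); apply: ae_impl => x [Hx x0].
have Npow : 1 < N%:R ^+ p :> R by rewrite exprn_egt1 ?ltr1n// -lt0n.
pose e : int := j0%:Z - j%:Z.
have ej : shift e j = j0.
  apply: val_inj; apply/eqP; rewrite -eqz_nat shiftE /e addrC subrK.
  by rewrite modz_small// ltz_nat ltn_ord.
have [k kP] := exists_scale Npow (mulf_neq0 (Nz e) x0).
have E : (N%:R ^+ p) ^ k * (N%:R ^ e * x) = N%:R ^ (p%:Z * k + e) * x.
  by rewrite mulrA (expfzDr (p%:Z * k) e)// -exprz_exp.
have sK : shift (p%:Z * k + e) j = j0 by rewrite -shift_shift ej shift_mulp.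
have [kx gx] : exists kx, good (N%:R ^ (p%:Z * k + e) * x) (shift (p%:Z * k + e) j) kx.
  by apply: Hx => //; rewrite -E.
by exists (kx - (p%:Z * k + e)); exact: (good_shift x j _ kx).1.
Qed.

(** Summing |h|^2 over the copies gives a function H of x alone, so the tiling by annuli of ratio N
    needs no record of the copies. Integrability of H makes the sum of N^k H(N^k x) over k in Z
    finite for almost every x in the annulus; it dominates the squares of h along the orbit. *)
Lemma good_of_eigenvector (h : l2vect) : nonvanishing N h ->
  (forall j, {ae mu, forall x, hatU N h x j = m (ecirc x * z j) * h x j}) ->
  forall j, {ae mu, forall x, exists kx, good x j kx}.
Proof.
move=> nv heq j.
pose H x : R := \sum_(i < p) Normc.normc (h x i) ^+ 2.
pose dH x (k : int) : R := N%:R ^ k * H (N%:R ^ k * x).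
have H0 x : 0 <= H x by apply: sumr_ge0 => i _; exact: sqr_ge0.
have dH0 x k : 0 <= dH x k by rewrite mulr_ge0// exprz_ge0// ltW.
have iH : mu.-integrable setT (fun x => (H x)%:E).
  apply: (@eq_integrable _ _ _ mu setT measurableT
    (fun x => \sum_(i < p) (Normc.normc (h x i) ^+ 2)%:E)%E) => //.
    by move=> x _; rewrite sumEFin.
  by apply: integrable_sum => // i _; have /cL2P[] := l2P h i.
have mH : measurable_fun setT H by apply/measurable_EFinP; exact: measurable_int iH.
have NR1 : 1 < N%:R :> R by rewrite ltr1n.
have half (s : nat -> int) : injective s ->
    {ae mu, forall x, annulus N%:R x -> summable (fun i => dH x (s i))}.
  move=> sinj; have T := tiling NR1 sinj mH H0.
  have mann := measurable_annulus (N%:R : R).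
  have g0 x : (0 <= \sum_(0 <= i <oo) (N%:R ^ s i * H (N%:R ^ s i * x))%R%:E)%E.
    by apply: nneseries_ge0 => i _ _; rewrite lee_fin mulr_ge0// exprz_ge0// ltW.
  have ig : mu.-integrable (annulus N%:R)
      (fun x => \sum_(0 <= i <oo) (N%:R ^ s i * H (N%:R ^ s i * x))%R%:E)%E.
    apply/integrableP; split.
      apply: ge0_emeasurable_sum => [i x _ _|i _].
        by rewrite lee_fin mulr_ge0// exprz_ge0// ltW.
      apply: measurable_funTS; apply/measurable_EFinP; apply: measurable_funM => //.
      have -> : (fun x => H (N%:R ^ s i * x)) = H \o affine_map (N%:R ^ s i) 0.
        by apply/funext => x; rewrite /= /affine_map addr0.
      exact: (measurableT_comp mH (measurable_affine _ 0)).
    under eq_integral do rewrite gee0_abs//.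
    rewrite -T; have /integrableP[_ ] := iH; apply: le_lt_trans.
    under [leRHS]eq_integral do rewrite gee0_abs ?lee_fin//.
    apply: ge0_subset_integral => //.
    - by apply: bigcupT_measurable => i; exact: measurable_annulus_pre.
    - exact/measurable_EFinP.
    - by move=> x _; rewrite lee_fin.
  have := @integrable_ae _ _ R mu (annulus N%:R) mann _ ig; apply: ae_impl => x Hx Ax.
  by have := Hx Ax; rewrite ge0_fin_numE.
have fin : {ae mu, forall x, annulus N%:R x -> summableZ2 (dH x)}.
  have inj1 : injective (fun i : nat => i%:Z) by move=> a b [].
  have inj2 : injective (fun i : nat => - i%:Z) by move=> a b /oppr_inj [].
  have := ae_conj (half _ inj1) (half _ inj2).
  by apply: ae_impl => x [a b] Ax; split; [exact: a|exact: b].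
have fin' := ae_orbit (P := fun x _ => annulus N%:R x -> summableZ2 (dH x)) (fun _ => fin) j.
have heq' := ae_orbit heq j.
have := ae_conj (ae_conj fin' heq') (ae_conj (nv j) (ae_neq0 R)).
apply: ae_impl => x [[finx eqx] [[k0 hk0] x0]].
have [l Al] := exists_scale NR1 x0.
(* Summability is known at the point N^l x of the annulus. Moving to N^k0 x, where h does not
   vanish, shifts the index and costs the factor N^(l - k0). *)
have sx : summableZ2 (dH (N%:R ^ k0 * x)).
  have := summableZ2_shift (k0 - l) (dH0 _) (finx l Al).
  apply: (@summableZ2_scale _ (N%:R ^ (l - k0))) => [|k|k]; [by rewrite exprz_ge0// ltW|exact: dH0|].
  rewrite /dH !mulrA -!expfzDr//; congr (_ ^ _ * H (_ ^ _ * x)); lia.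
exists (0 - k0); apply: (good_shift x j k0 0).1.
set x' := N%:R ^ k0 * x in hk0 sx *; set j' := shift k0 j in hk0 *.
pose d (k : int) : R := N%:R ^ k * Normc.normc (h (N%:R ^ k * x') (shift k j')) ^+ 2.
apply: (good_index_of_cocycle (d := d)).
- by move=> k; rewrite mulr_ge0 ?sqr_ge0// exprz_ge0// ltW.
(* The squared modulus of the eigenvalue equation is the recursion for d; the factor N from sqrt N
   is absorbed by the weight N^k. *)
- move=> k; have := eqx (k + k0); rewrite /hatU /dil -shift1 => /(congr1 (fun w => Normc.normc w ^+ 2)).
  rewrite !Normc.normcM !exprMn normc_real (ger0_norm (sqrtr_ge0 _)) sqr_sqrtr; last exact: ltW.
  have NE : N%:R * (N%:R ^ (k + k0) * x) = N%:R ^ (1 + (k + k0)) * x.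
    by rewrite (expfzDr 1 (k + k0))// expr1z mulrA.
  rewrite shift_shift NE.
  rewrite -/(orbit_factor x j (k + k0)) -orbit_factor_shift -/x' -/j' => E.
  rewrite /orbit_sq opprK mulrCA.
  have -> : Normc.normc (orbit_factor x' j' k) ^+ 2 * Normc.normc (h (N%:R ^ k * x') (shift k j')) ^+ 2 =
      N%:R * Normc.normc (h (N%:R ^ (k + 1) * x') (shift (k + 1) j')) ^+ 2.
    have hx l' : h (N%:R ^ l' * x') (shift l' j') = h (N%:R ^ (l' + k0) * x) (shift (l' + k0) j).
      by rewrite /x' /j' shift_shift mulrA -expfzDr.
    by rewrite !hx -E (_ : k + 1 + k0 = 1 + (k + k0))//; lia.
  by rewrite /d [RHS]mulrA; congr (_ * _); rewrite (expfzDr k 1)// expr1z.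
- by rewrite /d expr0z mul1r shift0 mul1r sqrf_eq0; apply/eqP => /Normc.eq0_normc.
- apply: summableZ2_le sx => k.
  have Nk : 0 <= N%:R ^ k :> R by rewrite exprz_ge0// ltW.
  apply/andP; split; first by rewrite mulr_ge0 ?sqr_ge0.
  apply: ler_wpM2l => //; rewrite /H (bigD1 (shift k j'))//= lerDl.
  by apply: sumr_ge0 => i _; exact: sqr_ge0.
Qed.

End Orbit.

Lemma measurable_fun_countable_cover (d1 d2 : measure_display) (T1 : measurableType d1)
    (T2 : measurableType d2) (I : countType) (D : I -> set T1) (f : T1 -> T2) (y0 : T2) :
  (forall i, measurable (D i)) -> (forall i, measurable_fun (D i) f) ->
  (forall x, ~ (exists i, D i x) -> f x = y0) -> measurable_fun setT f.
Proof.
move=> mD mf f0; pose E n := if unpickle n is Some i then D i else set0.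
have mE n : measurable (E n) by rewrite /E; case: unpickle.
have mU : measurable (\bigcup_n E n) by exact: bigcupT_measurable.
have UE x : (\bigcup_n E n) x <-> exists i, D i x.
  split=> [[n _]|[i Dx]]; first by rewrite /E; case: unpickle => // i Dx; exists i.
  by exists (pickle i) => //; rewrite /E pickleK.
rewrite -(setUCl (\bigcup_n E n)); apply/measurable_funU => //; first exact: measurableC.
split; last first.
  apply/measurable_fun_bigcup => // n; rewrite /E; case: unpickle => //.
  exact: measurable_fun_set0.
apply: (eq_measurable_fun (cst y0)); last exact: measurable_cst.
by move=> x; rewrite inE => /= Ux; rewrite f0// => /UE.
Qed.

Lemma measurable_summable (d : measure_display) (T : measurableType d) (R : realType)
    (u : nat -> T -> R) : (forall i, measurable_fun setT (u i)) -> (forall i x, 0 <= u i x) ->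
  measurable [set x | summable (u ^~ x)].
Proof.
move=> mu_ u0.
have mS : measurable_fun setT (fun x => \sum_(0 <= i <oo) (u i x)%:E)%E.
  by apply: ge0_emeasurable_sum => [i x _ _|i _]; [rewrite lee_fin|exact/measurable_EFinP].
rewrite -[X in measurable X]setTI.
exact: (measurable_lte measurableT mS (measurable_cst +oo%E)).
Qed.

(** * Construction of an eigenfunction *)

Section Walk.
Variables (R : realType) (N : nat).
Hypothesis N1 : (1 < N)%N.
Let Nn : N%:R != 0 :> R. Proof. by rewrite pnatr_eq0 -lt0n ltnW. Qed.
Let Np : 0 < N%:R :> R. Proof. by rewrite ltr0n ltnW. Qed.
Let s : R := Num.sqrt N%:R.
Let s0 : 0 < s. Proof. by rewrite sqrtr_gt0. Qed.
Let sC0 : s%:C != 0 :> R[i].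
Proof. by rewrite eq_complex /= negb_and gt_eqF. Qed.

(* The solution of sqrt N * w (l + 1) = c l * w l with w (- kx) = 1. *)
Definition walk (kx : int) (c : int -> R[i]) (l : int) : R[i] :=
  match l + kx with
  | Posz i => \prod_(t < i) (s%:C^-1 * c (t%:Z - kx))
  | Negz i => \prod_(t < i.+1) (s%:C / c (- kx - 1 - t%:Z))
  end.

Lemma walk_pos kx c (i : nat) : walk kx c (i%:Z - kx) = \prod_(t < i) (s%:C^-1 * c (t%:Z - kx)).
Proof. by rewrite /walk subrK. Qed.

Lemma walk_neg kx c (i : nat) : walk kx c (- i%:Z - kx) = \prod_(t < i) (s%:C / c (- kx - 1 - t%:Z)).
Proof.
case: i => [|i]; last by rewrite -NegzE /walk subrK.
by rewrite (_ : - 0%:Z - kx = 0%:Z - kx)// walk_pos !big_ord0.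
Qed.

Lemma walk_step kx c l : (forall t : nat, c (- kx - 1 - t%:Z) != 0) ->
  s%:C * walk kx c (l + 1) = c l * walk kx c l.
Proof.
move=> nz; rewrite -(addrK kx l); case: (l + kx) => i.
  rewrite (_ : i%:Z - kx + 1 = i.+1%:Z - kx); last lia.
  by rewrite !walk_pos big_ord_recr /= mulrCA (mulVKf sC0) mulrC.
rewrite NegzE (_ : - i.+1%:Z - kx + 1 = - i%:Z - kx); last lia.
rewrite !walk_neg big_ord_recr /= (_ : - i.+1%:Z - kx = - kx - 1 - i%:Z); last lia.
by rewrite [RHS]mulrCA [c _ * _]mulrCA mulfV// mulr1 mulrC.
Qed.

Definition walk_sq (kx : int) (c : int -> R[i]) (l : int) : R :=
  N%:R ^ l * Normc.normc (walk kx c l) ^+ 2.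

Lemma walk_sq_ge0 kx c l : 0 <= walk_sq kx c l.
Proof. by rewrite mulr_ge0 ?sqr_ge0// exprz_ge0// ltW. Qed.

Let normc_prod (n : nat) (F : nat -> R[i]) :
  Normc.normc (\prod_(t < n) F t) = \prod_(t < n) Normc.normc (F t).
Proof.
elim: n => [|n IH]; first by rewrite !big_ord0 Normc.normc1.
by rewrite !big_ord_recr /= Normc.normcM IH.
Qed.

(** The weight N^l cancels the powers of sqrt N in the walk, so that up to the constant N^(-kx) the
    terms are the two products of [good_index]. *)
Lemma summable_walk kx c :
  good_index (fun k => Normc.normc (c (- k)) ^+ 2) kx -> summableZ2 (walk_sq kx c).
Proof.
move=> [s1 nz s2].
suff H : summableZ2 (fun l => walk_sq kx c (l - kx)).
  have := summableZ2_shift kx (fun k => walk_sq_ge0 _ _ _) H.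
  by congr summableZ2; apply/funext => k; rewrite addrK.
have s2N : s ^+ 2 = N%:R by rewrite sqr_sqrtr// ltW.
split.
- apply: summable_prefix (_ : 0 <= N%:R ^ (- kx)) s1 => [i|i|].
  + by apply: prodr_ge0 => t _; exact: sqr_ge0.
  + rewrite /walk_sq walk_pos (normc_prod i (fun t => s%:C^-1 * c (t%:Z - kx))) -prodrXl.
    under eq_bigr do rewrite Normc.normcM Normc.normcV normc_real gtr0_norm// exprMn exprVn s2N.
    rewrite big_split /= prodr_const card_ord addrC expfzDr// -!mulrA; congr (_ * _).
    rewrite mulrA -exprnP exprVn mulfV ?expf_neq0// mul1r.
    by apply: eq_bigr => t _; rewrite opprB.
  + by rewrite exprz_ge0// ltW.
- apply: summable_prefix (_ : 0 <= N%:R ^ (- kx)) s2 => [i|i|].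
  + by apply: prodr_ge0 => t _; rewrite invr_ge0 sqr_ge0.
  + rewrite /walk_sq walk_neg (normc_prod i (fun t => s%:C / c (- kx - 1 - t%:Z))) -prodrXl.
    under eq_bigr do rewrite Normc.normcM Normc.normcV normc_real gtr0_norm// exprMn exprVn s2N.
    rewrite big_split /= prodr_const card_ord addrC expfzDr// -!mulrA; congr (_ * _).
    rewrite mulrA -invr_expz -exprnP mulVf ?expf_neq0// mul1r.
    by apply: eq_bigr => t _; rewrite !opprD.
  + by rewrite exprz_ge0// ltW.
Qed.

(** The sum over all of Z, with the index 0 counted once. *)
Definition walk_norm (kx : int) (c : int -> R[i]) : \bar R :=
  (\sum_(0 <= i <oo) (walk_sq kx c i%:Z)%:E + \sum_(0 <= i <oo) (walk_sq kx c (- i.+1%:Z))%:E)%E.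

(** The 1 keeps the divisor positive even if [walk_norm] is infinite, where [fine] returns 0; when
    it is finite, the normalised total is at most 1, uniformly over the orbits. *)
Definition walk_vec (kx : int) (c : int -> R[i]) (l : int) : R[i] :=
  ((Num.sqrt (1 + fine (walk_norm kx c)))^-1)%:C * walk kx c l.

Lemma walk_vec_step kx c l : (forall t : nat, c (- kx - 1 - t%:Z) != 0) ->
  s%:C * walk_vec kx c (l + 1) = c l * walk_vec kx c l.
Proof. by move=> nz; rewrite /walk_vec mulrCA walk_step// mulrCA. Qed.

Let series_ge0 kx c (e : nat -> int) : (0 <= \sum_(0 <= i <oo) (walk_sq kx c (e i))%:E)%E.
Proof. by apply: nneseries_ge0 => i _ _; rewrite lee_fin walk_sq_ge0. Qed.

Lemma walk_norm_ge0 kx c : 0 <= fine (walk_norm kx c).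
Proof. by rewrite fine_ge0// adde_ge0. Qed.

Lemma walk_vec_neq0 kx c : walk_vec kx c (- kx) != 0.
Proof.
have := walk_pos kx c 0; rewrite sub0r big_ord0 /walk_vec => ->; rewrite mulr1.
rewrite eq_complex /= negb_and invr_eq0 sqrtr_eq0 -ltNge.
by rewrite ltr_pwDl// walk_norm_ge0.
Qed.

Lemma walk_vec_series kx c (e : nat -> int) :
  (e = fun i : nat => i%:Z) \/ (e = fun i : nat => - i.+1%:Z) ->
  good_index (fun k => Normc.normc (c (- k)) ^+ 2) kx ->
  (\sum_(0 <= i <oo) (N%:R ^ e i * Normc.normc (walk_vec kx c (e i)) ^+ 2)%:E <= 1)%E.
Proof.
move=> eE /summable_walk [sp sn].
have sn' : summable (fun i : nat => walk_sq kx c (- i.+1%:Z)).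
  by have := (summableS (u := fun i : nat => walk_sq kx c (- i%:Z)) (fun i => walk_sq_ge0 _ _ _)).2 sn.
set A := (1 + fine (walk_norm kx c)).
have A0 : 0 < A by rewrite ltr_pwDl// walk_norm_ge0.
have fin : walk_norm kx c \is a fin_num.
  rewrite ge0_fin_numE; first exact: lte_add_pinfty sp sn'.
  by rewrite /walk_norm adde_ge0.
under eq_eseriesr => i _.
  rewrite /walk_vec -/A Normc.normcM exprMn mulrCA normc_real real_normK ?num_real//.
  rewrite exprVn sqr_sqrtr ?(ltW A0)// -/(walk_sq kx c (e i)) EFinM; over.
rewrite nneseriesZl; last by move=> i _; rewrite lee_fin walk_sq_ge0.
rewrite muleC -lee_pdivlMr ?invr_gt0//.
rewrite invrK mul1e.
have : (\sum_(0 <= i <oo) (walk_sq kx c (e i))%:E <= walk_norm kx c)%E.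
  by rewrite /walk_norm; case: eE => ->; [rewrite leeDl|rewrite leeDr].
move=> /le_trans; apply; rewrite -[leLHS]fineK// lee_fin /A lerDr//.
Qed.

End Walk.

Lemma measurable_forall_nat (d : measure_display) (T : measurableType d) (F : nat -> set T) :
  (forall n, measurable (F n)) -> measurable [set x | forall n, F n x].
Proof.
move=> mF; rewrite (_ : [set x | _] = \bigcap_n F n); first exact: bigcapT_measurable.
by apply/seteqP; split=> x /= Fx => [n _|n]; exact: Fx.
Qed.

Lemma cmeas_prod (R : realType) (n : nat) (F : nat -> R -> R[i]) :
  (forall t, cmeas (F t)) -> cmeas (fun x => \prod_(t < n) F t x).
Proof.
move=> mF; elim: n => [|n IH].
  by under [X in cmeas X]eq_fun do rewrite big_ord0; exact: cmeas_cst.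
by under [X in cmeas X]eq_fun do rewrite big_ord_recr /=; exact: cmeasM.
Qed.

Section GoodMeasurable.
Variable R : realType.
Variable a : int -> R -> R.
Hypothesis ma : forall k, measurable_fun setT (a k).
Hypothesis a0 : forall k x, 0 <= a k x.

Lemma measurable_good_index kx : measurable [set x | good_index (a ^~ x) kx].
Proof.
rewrite (_ : [set x | _] =
  [set x | summable (fun i => \prod_(t < i) a (kx - t%:Z) x)] `&`
  [set x | forall t : nat, a (kx + 1 + t%:Z) x != 0] `&`
  [set x | summable (fun i => \prod_(t < i) (a (kx + 1 + t%:Z) x)^-1)]); last first.
  by apply/seteqP; split=> x /= => [[]//|[[]]].
have ma' k : measurable_fun setT (fun x => (a k x)^-1) by exact: measurable_inv_sqr.
apply: measurableI; first apply: measurableI.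
- apply: (@measurable_summable _ (measurableTypeR R) R (fun i x => \prod_(t < i) a (kx - t%:Z) x)) => [i|i x].
    by apply: (measurable_prod _ (h := fun (t : 'I_i) x => a (kx - t%:Z) x)) => t _; exact: ma.
  exact: prodr_ge0.
- apply: (measurable_forall_nat (F := fun t : nat => [set x | a (kx + 1 + t%:Z) x != 0])) => t.
  rewrite (_ : [set x | _] = ~` (a (kx + 1 + t%:Z) @^-1` [set 0])).
    by apply: measurableC; rewrite -[X in measurable X]setTI; exact: ma.
  by apply/seteqP; split=> x /= /eqP.
- apply: (@measurable_summable _ (measurableTypeR R) R (fun i x => \prod_(t < i) (a (kx + 1 + t%:Z) x)^-1)) => [i|i x].
    by apply: (measurable_prod _ (h := fun (t : 'I_i) x => (a (kx + 1 + t%:Z) x)^-1)) => t _; exact: ma'.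
  by apply: prodr_ge0 => t _; rewrite invr_ge0.
Qed.

End GoodMeasurable.

Lemma cmeas_walk_vec (R : realType) (N : nat) (kx l : int) (c : int -> R -> R[i]) :
  (forall k, cmeas (c k)) -> cmeas (fun x => walk_vec N kx (c ^~ x) l).
Proof.
move=> mc; have mw k : cmeas (fun x => walk N kx (c ^~ x) k).
  rewrite /walk; case: (k + kx) => i.
    apply: (@cmeas_prod R i (fun t x => (Num.sqrt N%:R)%:C^-1 * c (t%:Z - kx) x)) => t.
    by apply: cmeasM => //; exact: cmeas_cst.
  apply: (@cmeas_prod R i.+1 (fun t x => (Num.sqrt N%:R)%:C / c (- kx - 1 - t%:Z) x)) => t.
  by apply: cmeasM; [exact: cmeas_cst|exact: cmeasV].
have msq k : measurable_fun setT (fun x => walk_sq N kx (c ^~ x) k).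
  by apply: measurable_funM => //; exact: cmeas_sqr.
have mn : measurable_fun setT (fun x => walk_norm N kx (c ^~ x)).
  by apply: emeasurable_funD; apply: ge0_emeasurable_sum => [i x _ _|i _];
    rewrite ?lee_fin ?walk_sq_ge0//; apply/measurable_EFinP; exact: msq.
apply: cmeasM => //; apply: cmeas_real; apply: measurable_inv_sqr.
  by move=> x; exact: sqrtr_ge0.
apply: measurableT_comp.
  by apply: continuous_measurable_fun; exact: sqrt_continuous.
apply: measurable_funD => //.
exact: measurableT_comp.
Qed.

Section Eigenvector.
Variables (R : realType) (N p : nat) (z : 'I_p -> R[i]) (m : R[i] -> R[i]).
Local Notation mu := (@lebesgue_measure R).
Local Notation l2vect := (l2vect R p).
Hypothesis N1 : (1 < N)%N.
Hypothesis mm : forall j, cmeas (fun x => m (ecirc x * z j)).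
Hypothesis all_good : forall j, {ae mu, forall x, exists kx, good N z m x j kx}.

Let Nz (k : int) : N%:R ^ k != 0 :> R.
Proof. by rewrite expfz_neq0// pnatr_eq0 -lt0n ltnW. Qed.
Let NR1 : 1 < N%:R :> R. Proof. by rewrite ltr1n. Qed.

Local Notation factor := (orbit_factor N z m).
Local Notation good := (good N z m).

Let e (n : nat) : int := odflt 0 (unpickle n).

Definition first_good (x : R) (j : 'I_p) (n : nat) : Prop :=
  good x j (e n) /\ forall n' : nat, (n' < n)%N -> ~ good x j (e n').

Definition orbit_index (y : R) (j : 'I_p) (q : int * nat) : Prop :=
  annulus N%:R (N%:R ^ q.1 * y) /\ first_good (N%:R ^ q.1 * y) (shift q.1 j) q.2.

(** Seen from the point of its orbit that lies in the annulus, y has index -q.1. *)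
Definition orbit_value (y : R) (j : 'I_p) (q : int * nat) : R[i] :=
  walk_vec N (e q.2) (factor (N%:R ^ q.1 * y) (shift q.1 j)) (- q.1).

(* The orbit of each x <> 0 meets the annulus 1 <= |x| < N exactly once. There
   k_x is taken to be the first admissible integer in an enumeration, which makes
   the choice measurable. *)
Definition eigenfun (y : R) (j : 'I_p) : R[i] :=
  if pselect (exists q, orbit_index y j q) is left H then orbit_value y j (projT1 (cid H)) else 0.

Lemma first_good_uniq x j n n' : first_good x j n -> first_good x j n' -> n = n'.
Proof.
move=> [g1 m1] [g2 m2]; apply/eqP; rewrite eqn_leq; apply/andP.
by split; rewrite leqNgt; apply/negP => lt; [exact: m1 lt g2|exact: m2 lt g1].
Qed.

Lemma orbit_index_uniq y j q q' : orbit_index y j q -> orbit_index y j q' -> q = q'.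
Proof.
case: q => k n; case: q' => k' n' [/= A1 F1] [/= A2 F2].
have E := annulus_uniq NR1 A1 A2; rewrite -E in F2 *.
by rewrite (first_good_uniq F1 F2).
Qed.

Lemma eigenfunE y j q : orbit_index y j q -> eigenfun y j = orbit_value y j q.
Proof.
move=> H; rewrite /eigenfun; case: pselect => [H'|[]]; last by exists q.
by congr orbit_value; apply: orbit_index_uniq H; exact: (projT2 (cid H')).
Qed.

Lemma eigenfun0 y j : ~ (exists q, orbit_index y j q) -> eigenfun y j = 0.
Proof. by move=> H; rewrite /eigenfun; case: pselect. Qed.

Let pow_shift (K k : int) (y : R) : N%:R ^ (k - K) * (N%:R ^ K * y) = N%:R ^ k * y.
Proof. by rewrite mulrA -expfzDr ?subrK// pnatr_eq0 -lt0n ltnW. Qed.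

Let shift_sub (K k : int) (j : 'I_p) : shift (k - K) (shift K j) = shift k j.
Proof. by rewrite shift_shift subrK. Qed.

Lemma orbit_index_shift (K : int) y j q : orbit_index y j q ->
  orbit_index (N%:R ^ K * y) (shift K j) (q.1 - K, q.2).
Proof. by case: q => k n; rewrite /orbit_index /= pow_shift shift_sub. Qed.

Lemma eigenfun_shift (K : int) y j q : orbit_index y j q ->
  eigenfun (N%:R ^ K * y) (shift K j) =
  walk_vec N (e q.2) (factor (N%:R ^ q.1 * y) (shift q.1 j)) (K - q.1).
Proof.
move=> /(orbit_index_shift K) /eigenfunE ->.
by rewrite /orbit_value /= pow_shift shift_sub opprB.
Qed.

Lemma eigenfun_step y j :
  (Num.sqrt N%:R)%:C * eigenfun (N%:R * y) (ordS j) = m (ecirc y * z j) * eigenfun y j.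
Proof.
have NE : N%:R * y = N%:R ^ (1 : int) * y by rewrite expr1z.
have [[q Q]|H] := pselect (exists q, orbit_index y j q).
  rewrite NE -shift1 (eigenfun_shift 1 Q) (eigenfunE Q) [1 - _]addrC.
  have [_ [[_ nz _] _]] := Q; rewrite walk_vec_step//.
    have := orbit_factor_shift z m N1 y j q.1 (- q.1).
    by rewrite addNr => ->; rewrite /orbit_value /orbit_factor expr0z mul1r shift0.
  move=> t; have := nz t; rewrite /orbit_sq sqrf_eq0; apply: contraNN => /eqP.
  rewrite (_ : - (e q.2 + 1 + t%:Z) = - e q.2 - 1 - t%:Z); last lia.
  by move=> ->; rewrite Normc.normc0.
rewrite !eigenfun0 ?mulr0// => -[q /(orbit_index_shift (- 1))].
rewrite -shift1 shift_shift addNr shift0 NE mulrA -expfzDr; last by rewrite pnatr_eq0 -lt0n ltnW.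
by rewrite addNr expr0z mul1r => Q; apply: H; eexists; exact: Q.
Qed.

Lemma eigenfun_nonvanishing : nonvanishing N eigenfun.
Proof.
move=> j; have := ae_conj (all_good j) (ae_neq0 R); apply: ae_impl => x [[kx gx] x0].
have [k Ak] := exists_scale NR1 x0.
have ex : exists n, `[< good (N%:R ^ k * x) (shift k j) (e n) >].
  exists (pickle (kx + k)); apply/asboolP; rewrite /e pickleK /=.
  by apply: (good_shift z m N1 x j k (kx + k)).2; rewrite addrK.
have [n /asboolP gn nmin] := ex_minnP ex.
have Q : orbit_index x j (k, n).
  split=> //; split=> //= n' n'n g'; have := nmin n' (introT (asboolP _) g').
  by rewrite leqNgt n'n.
(* The walk starts from the value 1 at index -k_x, so it is nonzero there whatever the factors
   are. *)
exists (k - e n); rewrite (eigenfun_shift (k - e n) Q) /= (_ : k - e n - k = - e n); last lia.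
by apply/eqP; exact: walk_vec_neq0.
Qed.

Let cmeas_orbit j k : cmeas (fun x => factor x j k).
Proof.
have := cmeas_affine (N%:R ^ k) 0 (mm (shift k j)).
by under eq_fun do rewrite addr0.
Qed.

Lemma measurable_good j kx : measurable [set x | good x j kx].
Proof.
apply: (@measurable_good_index R (fun k x => orbit_sq N z m x j k)) => k.
  by apply: cmeas_sqr; exact: cmeas_orbit.
by move=> x; exact: sqr_ge0.
Qed.

Lemma measurable_orbit_index j q : measurable [set y | orbit_index y j q].
Proof.
have mF : measurable [set x | first_good x (shift q.1 j) q.2].
  rewrite (_ : [set x | _] = [set x | good x (shift q.1 j) (e q.2)] `&`
    [set x | forall n', (if (n' < q.2)%N then ~` [set x | good x (shift q.1 j) (e n')] else setT) x]).
    apply: measurableI; first exact: measurable_good.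
    apply: measurable_forall_nat => n'; case: ifP => // _.
    by apply: measurableC; exact: measurable_good.
  apply/seteqP; split=> x [/= g1 g2]; split=> // n'; first by case: ifP => // /g2.
  by move=> n'n; have := g2 n'; rewrite n'n.
rewrite (_ : [set y | _] = [set y | annulus N%:R (N%:R ^ q.1 * y)] `&`
   affine_map (N%:R ^ q.1) 0 @^-1` [set x | first_good x (shift q.1 j) q.2]).
  apply: measurableI; first exact: measurable_annulus_pre.
  by rewrite -[X in measurable X]setTI; exact: (measurable_affine (N%:R ^ q.1) 0).
by apply/seteqP; split=> y; rewrite /orbit_index /affine_map /= addr0.
Qed.

(** There are countably many pairs q. On the measurable set where q is the orbit index, the function
    is the explicit [orbit_value]; off all these sets it is 0. *)
Lemma cmeas_eigenfun j : cmeas (eigenfun ^~ j).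
Proof.
have mv q : cmeas (fun y => orbit_value y j q).
  apply: (cmeas_walk_vec N (e q.2) (- q.1) (c := fun k y => factor (N%:R ^ q.1 * y) (shift q.1 j) k)) => k.
  have := cmeas_affine (N%:R ^ q.1) 0 (cmeas_orbit (shift q.1 j) k).
  by under eq_fun do rewrite addr0.
have cover (g : R[i] -> R) :
    (forall q, measurable_fun setT (fun y => g (orbit_value y j q))) ->
    measurable_fun setT (fun y => g (eigenfun y j)).
  move=> mg; apply: (measurable_fun_countable_cover (I := (int * nat)%type)
    (D := fun q => [set y | orbit_index y j q]) (y0 := g 0)).
  - by move=> q; exact: measurable_orbit_index.
  - move=> q; apply: (eq_measurable_fun (fun y => g (orbit_value y j q))).
      by move=> y; rewrite inE => /= Q; rewrite (eigenfunE Q).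
    exact: measurable_funTS.
  - by move=> y H; rewrite eigenfun0.
by split; apply: cover => q; have [] := mv q.
Qed.

Let f (j : 'I_p) (y : R) : R := Normc.normc (eigenfun y j) ^+ 2.

Let f0 j y : 0 <= f j y. Proof. exact: sqr_ge0. Qed.

Lemma eigenfun_series (s : nat -> int) (j : 'I_p) x : annulus N%:R x ->
  (s = fun i : nat => i%:Z) \/ (s = fun i : nat => - i.+1%:Z) ->
  (\sum_(0 <= i <oo) (N%:R ^ s i * f (shift (s i) j) (N%:R ^ s i * x))%:E <= 1)%E.
Proof.
move=> Ax sE.
have [[q Q]|H] := pselect (exists q, orbit_index x j q).
  have q10 : q.1 = 0.
    by apply: (annulus_uniq NR1 Q.1); rewrite expr0z mul1r.
  have [_ [gq _]] := Q.
  apply: le_trans (walk_vec_series N1 sE gq); apply: lee_nneseries => i.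
    by move=> _ _; rewrite lee_fin mulr_ge0// exprz_ge0// ltW// (lt_trans _ NR1).
  by move=> _; rewrite /f (eigenfun_shift (s i) Q) q10 subr0.
rewrite eseries0 ?lee01// => i _ _; rewrite /f eigenfun0 ?Normc.normc0 ?expr0n ?mulr0//.
move=> -[q /(orbit_index_shift (- s i))].
rewrite shift_shift addNr shift0 mulrA -expfzDr; last by rewrite pnatr_eq0 -lt0n ltnW.
by rewrite addNr expr0z mul1r => Q; apply: H; eexists; exact: Q.
Qed.

Lemma eigenfun_half (s : nat -> int) (j : 'I_p) :
  (s = fun i : nat => i%:Z) \/ (s = fun i : nat => - i.+1%:Z) ->
  (\int[mu]_(x in \bigcup_i [set x | annulus N%:R (N%:R ^ (- s i) * x)%R]) (f j x)%:E < +oo)%E.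
Proof.
move=> sE; have sinj : injective s.
  by case: sE => -> a b; [case|move=> /oppr_inj []].
have mf : measurable_fun setT (f j) by exact: cmeas_sqr (cmeas_eigenfun j).
rewrite (tiling NR1 sinj mf (f0 j)).
have term0 (j' : 'I_p) k x : (0 <= (N%:R ^ k * f j' (N%:R ^ k * x))%:E)%E.
  by rewrite lee_fin mulr_ge0// exprz_ge0// ltW// (lt_trans _ NR1).
have mterm (j' : 'I_p) k : measurable_fun setT (fun x : R => (N%:R ^ k * f j' (N%:R ^ k * x))%:E).
  apply/measurable_EFinP; apply: measurable_funM => //.
  have -> : (fun x => f j' (N%:R ^ k * x)) = f j' \o affine_map (N%:R ^ k) 0.
    by apply/funext => x; rewrite /= /affine_map addr0.
  apply: measurableT_comp; last exact: measurable_affine.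
  by apply: cmeas_sqr; exact: cmeas_eigenfun.
apply: (@le_lt_trans _ _ (\int[mu]_(x in annulus N%:R) (p%:R)%:E)%E); last first.
  rewrite integral_cst; last exact: measurable_annulus.
  rewrite lte_mul_pinfty ?lee_fin//.
  apply: (le_lt_trans _ (lebesgue_measure_cc_lty (- N%:R) N%:R)).
  apply: le_measure; rewrite ?inE; [exact: measurable_annulus|exact: measurable_itv|].
  by move=> x /= /andP[_ /ltW]; rewrite ler_norml in_itv.
apply: ge0_le_integral => //.
- exact: measurable_annulus.
- by move=> x _; apply: nneseries_ge0 => i _ _; exact: term0.
- apply: ge0_emeasurable_sum => [i x _ _|i _]; [exact: term0|].
  by apply: measurable_funTS; exact: mterm.
(* The point N^(s i) x of copy j lies on the orbit of x started in a copy that varies with i.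
   Summing over all p starting copies covers every i and gives the bound p. *)
- move=> x Ax; apply: (@le_trans _ _
    (\sum_(j' < p) \sum_(0 <= i <oo) (N%:R ^ s i * f (shift (s i) j') (N%:R ^ s i * x))%:E)%E).
    rewrite -nneseries_sum; last by move=> j' i _; exact: term0.
    apply: lee_nneseries => [i _ _|i _]; first exact: term0.
    rewrite (bigD1 (shift (- s i) j))//= shift_shift addrN shift0 leeDl//.
    by apply: sume_ge0 => j' _; exact: term0.
  apply: (@le_trans _ _ (\sum_(j' < p) 1)%E).
    by apply: lee_sum => j' _; exact: eigenfun_series.
  by rewrite sumEFin lee_fin sumr_const card_ord.
Qed.

Lemma L2_eigenfun : L2 eigenfun.
Proof.
move=> j; apply/cL2P; split; first exact: cmeas_eigenfun.
have mf : measurable_fun setT (f j) by apply: cmeas_sqr; exact: cmeas_eigenfun.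
have mEf : measurable_fun setT (EFin \o f j) by exact/measurable_EFinP.
apply/integrableP; split => //.
rewrite [X in (X < _)%E](_ : _ = \int[mu]_y (f j y)%:E)%E; last first.
  by apply: eq_integral => y _; rewrite gee0_abs// lee_fin; exact: f0.
pose U (s : nat -> int) := \bigcup_i [set x : R | annulus N%:R (N%:R ^ (- s i) * x)%R].
pose s1 i : int := i%:Z; pose s2 (i : nat) : int := - i.+1%:Z.
have mU s : measurable (U s).
  by apply: bigcupT_measurable => i; exact: measurable_annulus_pre.
have supp y : (U s1 `|` U s2) y \/ f j y = 0.
  have [[[k n] [/= A _]]|H] := pselect (exists q, orbit_index y j q); last first.
    by right; rewrite /f eigenfun0// Normc.normc0 expr0n.
  left; case: k A => [[|i]|i]; rewrite ?NegzE => A; [left; exists 0%N|right; exists i|left; exists i.+1];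
    by move: A => //=; congr (annulus _ (_ ^ _ * _)); rewrite /s1 /s2; lia.
have -> : (\int[mu]_y (f j y)%:E = \int[mu]_(y in U s1 `|` U s2) (f j y)%:E)%E.
  rewrite [RHS]integral_mkcond; apply: eq_integral => y _; rewrite patchE.
  case: ifPn => // /negP; rewrite inE => Uy.
  by have [//|->] := supp y.
rewrite ge0_integral_setU; [|exact: mU|exact: mU|exact: measurable_funTS|..]; last 2 first.
- by move=> y _; rewrite lee_fin; exact: f0.
- rewrite disj_set2E; apply/eqP; rewrite -subset0 => y [[a _ /= Aa] [b _ /= Ab]].
  by have := annulus_uniq NR1 Aa Ab; rewrite /s1 /s2; lia.
apply: lte_add_pinfty; apply: eigenfun_half; [left|right] => //.
Qed.

Lemma eigenvector_of_good : exists h : l2vect, nonvanishing N h /\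
  forall j, {ae mu, forall x, hatU N h x j = m (ecirc x * z j) * h x j}.
Proof.
exists (mkl2 L2_eigenfun); split; first exact: eigenfun_nonvanishing.
by move=> j; apply: aeW => x; exact: eigenfun_step.
Qed.

End Eigenvector.

Lemma Lfun_infty_bounded (R : realType) (u : R -> R) : u \in Lfun lebesgue_measure +oo%E ->
  measurable_fun setT u /\ exists C : R, {ae @lebesgue_measure R, forall x, `|u x| <= C}.
Proof.
rewrite inE => /andP[]; rewrite !inE => mu_ fu; split=> //.
have muT : (0 < @lebesgue_measure R setT)%E.
  apply: (@lt_le_trans _ _ (@lebesgue_measure R `[0, 1]%classic)).
    by rewrite lebesgue_measure_itv /= lte01 oppr0 adde0.
  by apply: le_measure; rewrite ?inE//; exact: measurable_itv.
move: fu; rewrite /finite_norm unlock /Lnorm /= muT => fu.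
have /ess_supP H := lexx (ess_sup lebesgue_measure (abse \o (EFin \o u))).
case: (ess_sup _ _) fu H => [C| |] // _ H.
  by exists C; apply: ae_impl H => x; rewrite /= lee_fin.
by exists 0; apply: ae_impl H => x /=; rewrite leeNy_eq.
Qed.

Lemma Linfty_circle_bounded (R : realType) (m : R[i] -> R[i]) : Linfty_circle m ->
  cmeas (fun x => m (ecirc x)) /\
  exists2 C : R, 0 <= C & {ae @lebesgue_measure R, forall x, Normc.normc (m (ecirc x)) <= C}.
Proof.
move=> [/Lfun_infty_bounded [m1 [C1 h1]] /Lfun_infty_bounded [m2 [C2 h2]]]; split=> //.
exists (`|C1| + `|C2|); first by rewrite addr_ge0.
have := ae_conj h1 h2; apply: ae_impl => x [b1 b2].
apply: (le_trans (normc_le _)); apply: lerD.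
  exact: le_trans b1 (ler_norm _).
exact: le_trans b2 (ler_norm _).
Qed.

Theorem theorem5p4 (R : realType) (N p : nat) (z : 'I_p -> R[i])
    (theta : int -> R) (m0 : R[i] -> R[i]) :
  (2 <= N)%N ->
  is_cycle N z ->
  (forall (k : int) (j : 'I_p), (k = j%:Z %[mod p%:Z])%Z ->
     ecirc (theta k) = z j) ->
  Linfty_circle m0 ->
  (exists phi : vect R p,
     cyclic_vector N z phi /\
     exists S : vect R p -> vect R p,
       functional_calculus (repT z) m0 S /\ aeeq (repU N phi) (S phi))
  <->
  {ae @lebesgue_measure R, forall x : R,
     x \in (`]- (N%:R ^+ p), (-1)%R] `|` `[1%R, N%:R ^+ p[)%classic ->
     exists kx : int, sums_finite N theta m0 x kx}.
Proof.
move=> N2 [p0 z_inj zn _] thz /Linfty_circle_bounded [mm [C C0 mC]].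
have z1 j : Normc.normc (z j) = 1 by have /(congr1 (@complex.Re R)) := zn j.
pose th (j : 'I_p) := theta j%:Z.
have thE j : ecirc (th j) = z j by exact: thz.
have mmz j : cmeas (fun x => m0 (ecirc x * z j)).
  have := cmeas_affine 1 (th j) mm.
  by under eq_fun do rewrite mul1r ecircD thE.
pose j0 := Ordinal p0.
(* The theorem speaks of copy 0: theta_(-k) lies over z at -k mod p, the copy reached from 0 while x
   is scaled by N^(-k). *)
have goodE x kx : sums_finite N theta m0 x kx <-> good N z m0 x j0 kx.
  rewrite /sums_finite /good good_indexP; last by move=> k; exact: sqr_ge0.
  rewrite (_ : sq_mod N theta m0 x = orbit_sq N z m0 x j0)//.
  apply/funext => k; rewrite /sq_mod /orbit_sq /orbit_factor ecircD.
  rewrite (thz (- k) (shift (- k) j0)); last by rewrite shiftE add0r modz_mod.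
  by rewrite -invr_expz [_^-1 * _]mulrC.
have annE x : (x \in (`]- (N%:R ^+ p), (-1)%R] `|` `[1%R, N%:R ^+ p[)%classic) <->
    annulus (N%:R ^+ p : R) x.
  rewrite inE /annulus /= !in_itv /=; set A := N%:R ^+ p.
  have [x0|x0] := leP 0 x; [rewrite ger0_norm//|rewrite ltr0_norm//]; split.
  - by move=> [|//] /andP[_]; lra.
  - by move=> ?; right.
  - by move=> []/andP[a b]; [apply/andP; split; lra|lra].
  - by move=> /andP[a b]; left; apply/andP; split; lra.
have [W [W' [WW WWV Wstep]]] := fourier_unitary R p.
have N0 : (0 < N)%N by exact: ltnW.
split=> [[phi [cphi [S [[E [HE HS]] US]]]]|H].
  have Lphi : L2 phi by case: cphi.
  pose f := mkl2 Lphi.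
  have SL : L2 (S phi) by case: HS => -[+ _ _] _; apply.
  have heig j : {ae @lebesgue_measure R, forall x,
      hatU N (W f) x j = m0 (ecirc x * z j) * W f x j}.
    have e1 := aeeq_sym (W_U N0 WW Wstep f).
    have e2 : aeeq (W (mkl2 (L2_repU N0 (l2P f)))) (W (tol2 (S f))).
      by apply: (W_ext WW); rewrite tol2E.
    have e3 := functional_calculus_hat z1 thE WW WWV Wstep HE f C0 mm mC HS.
    exact: (aeeq_trans e1 (aeeq_trans e2 e3) j).
  have nv : nonvanishing N (W f) by exact: (nonvanishing_of_cyclic N2 z1 WW WWV Wstep (f := f) cphi).
  have := good_of_eigenvector N2 nv heig j0; apply: ae_impl => x [kx gx] _.
  by exists kx; apply/goodE.
have sp : {ae @lebesgue_measure R, forall x, annulus (N%:R ^+ p) x -> exists kx, good N z m0 x j0 kx}.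
  by apply: ae_impl H => x Hx /annE /Hx [kx /goodE]; exists kx.
have [h [nh eh]] := eigenvector_of_good N2 mmz (good_spread N2 sp).
(* The eigenfunction lives on the transform side; its preimage has it as transform only almost
   everywhere, so the two properties of h are carried over along almost every orbit. *)
pose f := W' h; have fh : aeeq (W f) h := WVK WWV h.
have nv : nonvanishing N (W f).
  move=> j; have := ae_conj (ae_orbit N2 fh j) (nh j).
  by apply: ae_impl => x [E [k hk]]; exists k; rewrite E.
have eig : aeeq (hatU N (W f)) (fun x j => m0 (ecirc x * z j) * W f x j).
  have e1 : aeeq (hatU N (W f)) (hatU N h) by apply: aeeq_dil fh; rewrite pnatr_eq0 -lt0n.
  apply: aeeq_trans e1 _ => j; have := ae_conj (eh j) (fh j).
  by apply: ae_impl => x [-> ->].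
exists f; split; first exact: (cyclic_of_nonvanishing N2 z_inj z1 WW Wstep nv).
exact: (functional_calculus_of_hat z1 thE WW WWV Wstep N0 C0 mm mC eig).
Qed.
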